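(* Let $\tau$ be the doubling map on $\mathbb{T}$, $\tau(x)=2x$, and let $A_1$ and $A_2$ be two disjoint intervals of $[0,1)$ such that $A_1\cup A_2=[0,1)$ and $m(A_k)>0$ for $k=1,2$. Let $\phi_1,\phi_2\in H^\infty(\mathbb{D})$ be nonconstant, and let $T(\omega)=(M_{\phi_1})^*$ if $\omega\in A_1$, $T(\omega)=(M_{\phi_2})^*$ if $\omega\in A_2$. Suppose that one of the two following conditions holds: (i) $|\phi_1^*|^{m(A_1)}\,|\phi_2^*|^{m(A_2)}=1$ almost everywhere on the unit circle, and one of the images $\phi_1(\mathbb{D})$ or $\phi_2(\mathbb{D})$ meets the unit circle; (ii) $|\phi_1^*|^{m(A_1)}\,|\phi_2^*|^{m(A_2)}=1$ almost everywhere on the unit circle, $\phi_1\phi_2$ is not outer, and either $\phi_1$ or $\phi_2$ is not inner. Then the random sequence $(T_n(\cdot))_{n\ge1}$ is topologically weakly mixing, i.e. $(T_n(\omega))_{n\ge1}$ is topologically weakly mixing for almost every $\omega\in\mathbb{T}$.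
   Context: $\mathbb{T}=\mathbb{R}/\mathbb{Z}$, identified with $[0,1)$, is equipped with the normalized Lebesgue measure $m$. For $\omega\in\mathbb{T}$ and $n\ge1$, $T_n(\omega):=T(\tau^{n-1}\omega)\cdots T(\tau\omega)T(\omega)$. A sequence $(S_n)_{n\ge1}$ of continuous maps on a space $X$ is topologically weakly mixing if for all nonempty open $U_1,U_2,V_1,V_2\subset X$ there is $n\ge1$ with $S_n(U_1)\cap V_1\ne\emptyset$ and $S_n(U_2)\cap V_2\neq\emptyset$. $\mathbb{D}$ is the open unit disk, $H^2(\mathbb{D})$ the Hardy (Hilbert) space, $H^\infty(\mathbb{D})$ the bounded holomorphic functions on $\mathbb{D}$. For $\phi\in H^\infty(\mathbb{D})$, $M_\phi f=\phi f$ on $H^2(\mathbb{D})$, $(M_\phi)^*$ is its Hilbert space adjoint, and $\phi^*(e^{it})=\lim_{r\to1^-}\phi(re^{it})$ (defined for a.e. $e^{it}$). A bounded analytic function $\phi$ on $\mathbb{D}$ is inner if $|\phi^*|=1$ a.e. An analytic function $F$ on $\mathbb{D}$ is outer if $F(z)=c\exp\left(\frac1{2\pi}\int_0^{2\pi}\frac{e^{it}+z}{e^{it}-z}\log h(e^{it})\,dt\right)$ for some $c$ with $|c|=1$ and some positive function $h$ on the unit circle with $\log h\in L^1$. *)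

(* Defs.v *)
From HB Require Import structures.
From mathcomp Require Import all_boot all_order all_algebra.
From mathcomp Require Import all_classical all_reals all_analysis.
From mathcomp Require Import complex ring lra.

Set Implicit Arguments.
Unset Strict Implicit.
Unset Printing Implicit Defensive.

Import Order.TTheory GRing.Theory Num.Theory.
Import numFieldNormedType.Exports ComplexField.Normc.

Local Open Scope classical_set_scope.
Local Open Scope ring_scope.
Local Open Scope complex_scope.

(* R[i]^o is R[i] as a normed module over itself (usual topology of C). *)

Section square_summable.
Context {R : realType}.
Implicit Types (a b : nat -> R[i]^o) (c : R[i]).

Definition sqsum a (n : nat) : R := \sum_(0 <= k < n) normc (a k) ^+ 2.

Definition l2 : {pred nat -> R[i]^o} :=
  [pred a | `[< cvgn (sqsum a : nat -> R) >]].

Lemma l2P a : reflect (cvgn (sqsum a : nat -> R)) (a \in l2).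
Proof. exact: asboolP. Qed.

Lemma normc_ge0 c : 0 <= normc c.
Proof. by case: c => x y /=; exact: sqrtr_ge0. Qed.

Lemma sqsum_nd a : nondecreasing_seq (sqsum a : nat -> R).
Proof.
apply/nondecreasing_seqP => n.
by rewrite /sqsum big_nat_recr//= lerDl sqr_ge0.
Qed.

Lemma sqsum_ge0 a n : 0 <= sqsum a n.
Proof. by apply: sumr_ge0 => k _; exact: sqr_ge0. Qed.

Lemma minkowski_step (p q x y : R) : 0 <= p -> 0 <= q -> 0 <= x -> 0 <= y ->
  (Num.sqrt p + Num.sqrt q) ^+ 2 + (x + y) ^+ 2 <=
  (Num.sqrt (p + x ^+ 2) + Num.sqrt (q + y ^+ 2)) ^+ 2.
Proof.
move=> p0 q0 x0 y0.
have px0 : 0 <= p + x ^+ 2 by rewrite addr_ge0// sqr_ge0.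
have qy0 : 0 <= q + y ^+ 2 by rewrite addr_ge0// sqr_ge0.
suff H : Num.sqrt p * Num.sqrt q + x * y <=
    Num.sqrt (p + x ^+ 2) * Num.sqrt (q + y ^+ 2).
  rewrite !sqrrD !sqr_sqrtr//; lra.
rewrite -(@ler_pXn2r _ 2)// ?nnegrE; last 2 first.
- by rewrite addr_ge0// mulr_ge0// sqrtr_ge0.
- by rewrite mulr_ge0// sqrtr_ge0.
rewrite [leRHS]exprMn !sqr_sqrtr// sqrrD !exprMn !sqr_sqrtr//.
have := sqr_ge0 (Num.sqrt p * y - Num.sqrt q * x).
rewrite sqrrB !exprMn !sqr_sqrtr//; lra.
Qed.

Lemma sqsum_minkowski a b n :
  sqsum (a + b) n <= (Num.sqrt (sqsum a n) + Num.sqrt (sqsum b n)) ^+ 2.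
Proof.
elim: n => [|n IH]; first by rewrite /sqsum big_nil; exact: sqr_ge0.
have recr d : sqsum d n.+1 = sqsum d n + normc (d n) ^+ 2.
  by rewrite /sqsum big_nat_recr.
rewrite !recr; apply: (le_trans _ (minkowski_step _ _ _ _));
  rewrite ?sqsum_ge0 ?normc_ge0//.
by rewrite lerD// lerXn2r ?nnegrE ?addr_ge0 ?normc_ge0// le_normcD.
Qed.

Lemma sqsumZ c a n : sqsum (c *: a) n = normc c ^+ 2 * sqsum a n.
Proof.
rewrite /sqsum mulr_sumr; apply: eq_bigr => k _.
by rewrite -exprMn -normcM.
Qed.

Lemma sqsum_le_lim a : a \in l2 -> forall n, sqsum a n <= limn (sqsum a).
Proof. by move/l2P => ca n; exact: nondecreasing_cvgn_le (@sqsum_nd a) ca n. Qed.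

Lemma l2_le a (M : R) : (forall n, sqsum a n <= M) -> a \in l2.
Proof.
move=> aM; apply/l2P/nondecreasing_is_cvgn; first exact: sqsum_nd.
by exists M => _ [n _ <-].
Qed.

Lemma lim_sqsum_le a (M : R) :
  a \in l2 -> (forall n, sqsum a n <= M) -> limn (sqsum a) <= M.
Proof. by move/l2P => ca aM; apply: limr_le => //; exact: nearW. Qed.

Lemma lim_sqsumZ c a : a \in l2 ->
  limn (sqsum (c *: a)) = normc c ^+ 2 * limn (sqsum a).
Proof.
move/l2P => ca.
have -> : sqsum (c *: a) = fun n => normc c ^+ 2 * sqsum a n.
  by apply/funext => n; rewrite -sqsumZ.
by apply/cvg_lim => //; apply: cvgMl_tmp.
Qed.

Lemma lim_sqsum_ge0 a : a \in l2 -> 0 <= limn (sqsum a).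
Proof. by move=> al; apply: le_trans (sqsum_le_lim al 0); exact: sqsum_ge0. Qed.

Lemma sqsumD_le a b : a \in l2 -> b \in l2 -> forall n,
  sqsum (a + b) n <= (Num.sqrt (limn (sqsum a)) + Num.sqrt (limn (sqsum b))) ^+ 2.
Proof.
move=> al bl n; apply: (le_trans (sqsum_minkowski a b n)).
by rewrite lerXn2r ?nnegrE ?addr_ge0 ?sqrtr_ge0// lerD// ler_wsqrtr// sqsum_le_lim.
Qed.

Lemma l2_submod_closed : submod_closed l2.
Proof.
split => [|c a b al bl].
  apply: (@l2_le _ 0) => n; rewrite /sqsum big1// => k _.
  by rewrite normc0 expr0n.
have cal : c *: a \in l2.
  apply: (@l2_le _ (normc c ^+ 2 * limn (sqsum a))) => n.
  by rewrite sqsumZ ler_wpM2l ?sqr_ge0// sqsum_le_lim.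
exact: l2_le (sqsumD_le cal bl).
Qed.

HB.instance Definition _ :=
  GRing.isSubmodClosed.Build R[i] (nat -> R[i]^o) l2 l2_submod_closed.

End square_summable.

(* The Hardy space H^2(D): an element is given by the square-summable sequence
   of its Taylor coefficients at 0, and [hardy_fun] is the function on the disk. *)
Record hardy2 (R : realType) := Hardy2 {
  taylor :> nat -> R[i]^o;
  taylor_l2 : taylor \in l2 }.

HB.instance Definition _ (R : realType) := [isSub for @taylor R].
HB.instance Definition _ (R : realType) := [Choice of hardy2 R by <:].
HB.instance Definition _ (R : realType) :=
  [SubChoice_isSubLmodule of hardy2 R by <:].

Section hardy_norm.
Context {R : realType}.
Implicit Types (f g : hardy2 R).

Definition hardy_norm f : R[i] := (Num.sqrt (limn (sqsum f)))%:C.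

Lemma hardy_normD f g : hardy_norm (f + g) <= hardy_norm f + hardy_norm g.
Proof.
rewrite /hardy_norm -rmorphD/= lecR.
have s0 : 0 <= Num.sqrt (limn (sqsum f)) + Num.sqrt (limn (sqsum g)).
  by rewrite addr_ge0// sqrtr_ge0.
rewrite -[leRHS]ger0_norm// -[leRHS]sqrtr_sqr; apply: ler_wsqrtr.
apply: (lim_sqsum_le (taylor_l2 (f + g))).
exact: sqsumD_le (taylor_l2 f) (taylor_l2 g).
Qed.

Lemma hardy_normZ (c : R[i]) f : hardy_norm (c *: f) = `|c| * hardy_norm f.
Proof.
rewrite /hardy_norm (lim_sqsumZ c (taylor_l2 f)).
by rewrite sqrtrM ?sqr_ge0// sqrtr_sqr ger0_norm ?normc_ge0// rmorphM.
Qed.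

Lemma hardy_norm_eq0 f : hardy_norm f = 0 -> f = 0.
Proof.
move=> /complexI/eqP; rewrite sqrtr_eq0 => le0.
apply/val_inj/funext => n /=; apply: eq0_normc.
have h := le_trans (sqsum_le_lim (taylor_l2 f) n.+1) le0.
have h' := sqsum_ge0 f n; rewrite /sqsum in h'.
rewrite /sqsum big_nat_recr//= in h.
have h2 : normc (f n) ^+ 2 <= 0 by lra.
by apply/eqP; rewrite -sqrf_eq0 eq_le h2 sqr_ge0.
Qed.

HB.instance Definition _ := Lmodule_isNormed.Build R[i] (hardy2 R)
  hardy_normD hardy_normZ hardy_norm_eq0.

End hardy_norm.

Section hardy_operators.
Context {R : realType}.
Implicit Types (f g : hardy2 R) (phi F : R[i] -> R[i]) (z : R[i]).

Definition hardy_fun f z : R[i] :=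
  limn (series (fun n => f n * z ^+ n) : nat -> R[i]^o).

Definition hardy_dot f g : R[i] :=
  limn (series (fun n => f n * (g n)^*) : nat -> R[i]^o).

Lemma hardy_dot_norm f : hardy_dot f f = `|f| ^+ 2.
Proof.
rewrite /hardy_dot [in RHS]/Num.norm/= /hardy_norm -rmorphXn/=.
rewrite sqr_sqrtr ?(lim_sqsum_ge0 (taylor_l2 f))//.
have -> : series (fun n => f n * (f n)^*) = fun n => (sqsum f n)%:C.
  apply/funext => n; rewrite /series/= /sqsum rmorph_sum/=.
  by apply: eq_bigr => k _; rewrite -sqr_normc rmorphXn.
apply: (@cvg_lim R[i]^o); first exact: norm_hausdorff.
apply/cvgrPdist_lt => e e0.
case: e e0 => x y; rewrite ltcE => /andP[/eqP/= -> e1].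
have /cvgrPdist_lt/(_ _ e1) := l2P _ (taylor_l2 f).
apply: filterS => n.
by rewrite -rmorphB normc_def/= expr0n addr0 sqrtr_sqr ltcR.
Qed.

Definition udisk : set R[i] := [set z | `|z| < 1].

(* complex differentiability: the derivative is along 1, over the field R[i] *)
Definition holomorphic F :=
  forall z, udisk z -> derivable (F : R[i]^o -> R[i]^o) z 1.

Definition Hinfty phi :=
  holomorphic phi /\ exists M : R, forall z, udisk z -> normc (phi z) <= M.

Definition constant_on_disk F := exists c, forall z, udisk z -> F z = c.

(* M_phi f is the element of H^2 whose function is phi f; for phi in H^infty it
   exists, and it is unique since Taylor coefficients are. *)
Definition mul_op phi f : hardy2 R :=
  get [set g | forall z, udisk z -> hardy_fun g z = phi z * hardy_fun f z].

(* For a bounded linear A exactly one map B satisfies the adjoint identity. *)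
Definition adjoint (A : hardy2 R -> hardy2 R) : hardy2 R -> hardy2 R :=
  get [set B : hardy2 R -> hardy2 R |
    forall f g, hardy_dot (A f) g = hardy_dot f (B g)].

End hardy_operators.

Section boundary.
Context {R : realType}.
Implicit Types (phi F : R[i] -> R[i]) (t : R) (z : R[i]).
Local Notation mu := (@lebesgue_measure R).

Definition expi t : R[i] := cos t +i* sin t.

Definition cexp z : R[i] := (expR (complex.Re z))%:C * expi (complex.Im z).

Definition cintegral (D : set R) (G : R -> R[i]) : R[i] :=
  (\int[mu]_(t in D) complex.Re (G t))%R +i*
  (\int[mu]_(t in D) complex.Im (G t))%R.

(* phi^*(e^{it}); lim returns an arbitrary value where the radial limit does not
   exist, which is a null set of t for phi in H^infty. *)
Definition radial_lim phi t : R[i] :=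
  lim ((phi (r%:C * expi t) : R[i]^o) @[r --> (1 : R)^'-]).

Definition ae_circle (P : R -> Prop) :=
  {ae mu, forall t, t \in `[0, 2 * pi[ -> P t}.

Definition inner phi :=
  Hinfty phi /\ ae_circle (fun t => normc (radial_lim phi t) = 1).

Definition outer F :=
  holomorphic F /\
  exists (c : R[i]) (h : R[i] -> R),
    [/\ `|c| = 1,
        forall u, `|u| = 1 -> 0 < h u,
        mu.-integrable `[0, 2 * pi] (EFin \o (fun t => ln (h (expi t)))) &
        forall z, udisk z ->
          F z = c * cexp (((2 * pi)^-1)%:C *
            cintegral `[0, 2 * pi] (fun t =>
              (expi t + z) / (expi t - z) * (ln (h (expi t)))%:C))].

End boundary.

(* the doubling map of R/Z, identified with [0, 1[ *)
Definition doubling {R : realType} (x : R) : R :=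
  2 * x - (Num.floor (2 * x))%:~R.

(* T_n(w) = T(tau^{n-1} w) ... T(tau w) T(w) *)
Fixpoint cocycle (W X : Type) (tau : W -> W) (T : W -> X -> X)
    (n : nat) (w : W) : X -> X :=
  if n is n'.+1 then T (iter n' tau w) \o cocycle tau T n' w else idfun.

Definition topologically_weakly_mixing (X : topologicalType)
    (S : nat -> X -> X) :=
  forall U1 U2 V1 V2 : set X,
    open U1 -> open U2 -> open V1 -> open V2 ->
    U1 !=set0 -> U2 !=set0 -> V1 !=set0 -> V2 !=set0 ->
    exists n, [/\ (1 <= n)%N,
      (S n @` U1) `&` V1 !=set0 & (S n @` U2) `&` V2 !=set0].

(* Main.v *)
(* Put p = m(A1), q = m(A2), and let D_n(w) be the number of visits of
   w, tau w, ..., tau^(n-1) w to A1, minus n p. The boundary condition says that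
   |phi1*| = exp v and |phi2*| = exp (- (p/q) v) for a bounded function v; let U be
   the Poisson integral of v. The operator T_n(w) is the adjoint of multiplication
   by Phi_n = phi1^k phi2^(n-k), whose boundary modulus is exp ((D_n/q) v). Hence the
   evaluation kernel k_z satisfies T_n k_z = conj (Phi_n z) k_z, while Riesz'
   theorem and Jensen's inequality provide a T_n-preimage of k_z of norm at most
   C_z exp (- (D_n/q) U(z)). The kernels k_z with z in a nonempty open set span a
   dense subspace, so it suffices to find times n along which Phi_n is small near
   one point and (D_n/q) U is large near another one.

   For almost every w both D_n and - D_n tend to infinity along times with
   D_n = o(n). Indeed D_n = o(n) by the maximal ergodic theorem, and if D_n were
   bounded above, then D_1 would be a coboundary G - G o tau and exp (2 i pi G) an
   eigenfunction of the doubling map with eigenvalue exp (2 i pi p) <> 1; there are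
   none, because composition with tau halves primitives.

   Finally phi1 = f1 exp (H) and phi2 = f2 exp (- (p/q) H) with Re H = U and
   |f1|, |f2| <= 1. If some |fi| < 1 on the disk, then Phi_n tends to 0 everywhere
   when D_n = o(n), and only U <> 0 is needed. Otherwise f1 and f2 are unimodular
   constants, so that phi1 phi2 is outer, (i) holds, and U takes both signs. *)
Require Import Defs.
From mathcomp Require Import all_boot all_order all_algebra.
From mathcomp Require Import all_classical all_reals all_analysis.
From mathcomp Require Import measurable_realfun complex ring lra.
Set Implicit Arguments.
Unset Strict Implicit.
Unset Printing Implicit Defensive.
Import Order.TTheory GRing.Theory Num.Theory.
Import numFieldNormedType.Exports ComplexField.Normc.
Local Open Scope classical_set_scope.
Local Open Scope ring_scope.
Local Open Scope complex_scope.
(* Keeps [z^*] syntactically equal to [conjc z] rather than [Num.conj z]. *)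
Local Notation "z ^*" := (conjc z) : ring_scope.

(** The step that shapes the proof is solving [T_n x = k_z] although [T_n] may fail to be
    invertible. By duality the equation says that [<Phi_n g, x> = g(z)] for all polynomials [g], so
    a solution of norm at most [K] exists as soon as [|g(z)| <= K |Phi_n g|]. Now [ln |g|] is
    subharmonic and [ln |Phi_n|] equals [(D_n/q) v] on the boundary, so twice
    [ln |g(z)| + (D_n/q) U(z)] is at most the Poisson integral of [ln (|Phi_n g|^2)]. Jensen bounds
    the exponential of the latter by a bound of the Poisson kernel at [z] times the squared norm of
    [Phi_n g]; [C_z] is the square root of that bound. Zeros of [Phi_n] inside the disk do no harm,
    because only boundary values enter. These are available for the following reason: where the
    product of powers equals 1 both values of [radial_lim] are nonzero, hence genuine limits, and
    the upper bound on each function bounds the logarithm of the other from below, so that [v] is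
    bounded on both sides. *)

(** * The real-valued modulus and limits of complex functions *)

Section complex_basics.
Context {R : realType}.
Implicit Types (z w : R[i]) (a : nat -> R[i]).

Lemma eqle (x y : R) : x = y -> x <= y.
Proof. by move=> ->. Qed.

Lemma normr_normc z : `|z| = (normc z)%:C.
Proof. by rewrite normc_def; case: z. Qed.

Lemma normrC_lt z (e : R) : (`|z| < e%:C) = (normc z < e).
Proof. by rewrite normr_normc ltcR. Qed.

Lemma normc_real (x : R) : normc x%:C = `|x|.
Proof. by rewrite /= expr0n addr0 sqrtr_sqr. Qed.

Lemma normc_conj z : normc z^* = normc z.
Proof. by case: z => x y /=; rewrite sqrrN. Qed.

Lemma normcX z n : normc (z ^+ n) = normc z ^+ n.
Proof.
elim: n => [|n IH]; first by rewrite !expr0 normc1.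
by rewrite !exprS normcM IH.
Qed.

Lemma normcB z w : normc (z - w) = normc (w - z).
Proof. by rewrite -opprB normcN. Qed.

Lemma normcD z w : normc (z + w) <= normc z + normc w.
Proof. exact: le_normcD. Qed.

Lemma normc_leB z w : normc (z - w) <= normc z + normc w.
Proof. by rewrite (le_trans (normcD _ _))// normcN. Qed.

Lemma normc_dist z w : `|normc z - normc w| <= normc (z - w).
Proof.
rewrite ler_norml; apply/andP; split.
  have := normcD z (w - z); rewrite subrKC (normcB w z); lra.
have := normcD w (z - w); rewrite subrKC; lra.
Qed.

Lemma normc_Re z : `|complex.Re z| <= normc z.
Proof.
case: z => x y /=; rewrite -[leLHS]sqrtr_sqr; apply: ler_wsqrtr.
by rewrite lerDl sqr_ge0.
Qed.

Lemma normc_Im z : `|complex.Im z| <= normc z.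
Proof.
case: z => x y /=; rewrite -[leLHS]sqrtr_sqr; apply: ler_wsqrtr.
by rewrite lerDr sqr_ge0.
Qed.

Lemma normc_ReIm z : normc z <= `|complex.Re z| + `|complex.Im z|.
Proof.
case: z => x y /=; rewrite -[leRHS]ger0_norm ?addr_ge0//.
rewrite -[leRHS]sqrtr_sqr; apply: ler_wsqrtr.
by rewrite sqrrD !real_normK ?num_real// lerD2r lerDl mulrn_wge0// mulr_ge0.
Qed.

Lemma normc_eq0 z : (normc z == 0) = (z == 0).
Proof. by apply/eqP/eqP => [/eq0_normc|->]//; rewrite normc0. Qed.

Lemma normc_gt0 z : (0 < normc z) = (z != 0).
Proof. by rewrite lt_neqAle normc_ge0 andbT eq_sym normc_eq0. Qed.

Lemma sqr_normcE z : (normc z ^+ 2)%:C = z * z^*.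
Proof. by rewrite -sqr_normc normr_normc rmorphXn. Qed.

Lemma sqr_normcE' z : normc z ^+ 2 = complex.Re z ^+ 2 + complex.Im z ^+ 2.
Proof. by case: z => x y /=; rewrite sqr_sqrtr// addr_ge0// sqr_ge0. Qed.

Lemma complexP z w : complex.Re z = complex.Re w ->
  complex.Im z = complex.Im w -> z = w.
Proof. by case: z w => ? ? [? ?] /= -> ->. Qed.

Lemma cReD z w : complex.Re (z + w) = complex.Re z + complex.Re w.
Proof. by case: z w => ? ? []. Qed.
Lemma cImD z w : complex.Im (z + w) = complex.Im z + complex.Im w.
Proof. by case: z w => ? ? []. Qed.
Lemma cReN z : complex.Re (- z) = - complex.Re z.
Proof. by case: z. Qed.
Lemma cImN z : complex.Im (- z) = - complex.Im z.
Proof. by case: z. Qed.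
Lemma cReM z w : complex.Re (z * w) =
  complex.Re z * complex.Re w - complex.Im z * complex.Im w.
Proof. by case: z w => ? ? []. Qed.
Lemma cImM z w : complex.Im (z * w) =
  complex.Re z * complex.Im w + complex.Im z * complex.Re w.
Proof. by case: z w => ? ? []. Qed.
Lemma cReJ z : complex.Re z^* = complex.Re z.
Proof. by case: z. Qed.
Lemma cImJ z : complex.Im z^* = - complex.Im z.
Proof. by case: z. Qed.

Lemma cJM z w : (z * w)^* = z^* * w^*. Proof. exact: rmorphM. Qed.
Lemma cJN z : (- z)^* = - z^*. Proof. exact: rmorphN. Qed.
Lemma cJX z n : (z ^+ n)^* = z^* ^+ n. Proof. exact: rmorphXn. Qed.
Lemma cJr (x : R) : x%:C^* = x%:C. Proof. exact: conjc_real. Qed.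

Lemma Re_sum (I : Type) (r : seq I) (P : pred I) (F : I -> R[i]) :
  complex.Re (\sum_(i <- r | P i) F i) = \sum_(i <- r | P i) complex.Re (F i).
Proof. by elim/big_rec2: _ => // i x y _ <-; rewrite cReD. Qed.
Lemma Im_sum (I : Type) (r : seq I) (P : pred I) (F : I -> R[i]) :
  complex.Im (\sum_(i <- r | P i) F i) = \sum_(i <- r | P i) complex.Im (F i).
Proof. by elim/big_rec2: _ => // i x y _ <-; rewrite cImD. Qed.

Lemma normc_sum (I : Type) (r : seq I) (P : pred I) (F : I -> R[i]) :
  normc (\sum_(i <- r | P i) F i) <= \sum_(i <- r | P i) normc (F i).
Proof.
elim/big_ind2: _ => [|z x w y zx wy|//]; first by rewrite normc0.
by rewrite (le_trans (normcD _ _))// lerD.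
Qed.

(** The norm of [R[i]^o] is itself complex valued, and [0 < e] in [R[i]] forces [e] to be real; this
    moves every limit to the real modulus [normc]. *)
Lemma cvg_normcP {T : Type} (F : set_system T) {FF : Filter F} (f : T -> R[i])
    (l : R[i]) :
  ((f x : R[i]^o) @[x --> F] --> (l : R[i]^o)) <->
  (normc (f x - l) @[x --> F] --> (0 : R)).
Proof.
split=> [/cvgrPdist_lt fl|/cvgrPdist_lt fl].
  apply/cvgrPdist_lt => e e0.
  have /fl : 0 < e%:C by rewrite ltcR.
  apply: filterS => x; rewrite normrC_lt normcB sub0r normrN.
  by rewrite ger0_norm// normc_ge0.
apply/cvgrPdist_lt => -[e y]; rewrite ltcE => /andP[/eqP/= -> /= e0].
have := fl _ e0; apply: filterS => x.
by rewrite sub0r normrN ger0_norm ?normc_ge0// normcB -normrC_lt.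
Qed.

Lemma cvg_ReIm {T : Type} (F : set_system T) {FF : Filter F} (f : T -> R[i])
    (l : R[i]) :
  ((f x : R[i]^o) @[x --> F] --> (l : R[i]^o)) <->
  (complex.Re (f x) @[x --> F] --> complex.Re l) /\
  (complex.Im (f x) @[x --> F] --> complex.Im l).
Proof.
split=> [/cvg_normcP fl|[fr fi]].
  have sq0 (g : T -> R) : (forall x, `|g x| <= normc (f x - l)) ->
      g x @[x --> F] --> (0 : R).
    move=> gf; apply/norm_cvg0P; apply: (@squeeze_cvgr _ _ _ _ (cst 0)).
    - by apply: nearW => x; apply/andP; split; [exact: normr_ge0|exact: gf].
    - exact: cvg_cst.
    - exact: fl.
  split; apply/subr_cvg0; apply: sq0 => x.
    by rewrite (le_trans _ (normc_Re _))// cReD cReN.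
  by rewrite (le_trans _ (normc_Im _))// cImD cImN.
apply/cvg_normcP.
apply: (@squeeze_cvgr _ _ _ _ (cst 0) (fun x =>
    `|complex.Re (f x) - complex.Re l| + `|complex.Im (f x) - complex.Im l|)).
- apply: nearW => x; rewrite normc_ge0/= (le_trans (normc_ReIm _))//.
  by rewrite cReD cReN cImD cImN.
- exact: cvg_cst.
- rewrite -[X in _ --> X]addr0; apply: cvgD.
    by apply/norm_cvg0P/subr_cvg0.
  by apply/norm_cvg0P/subr_cvg0.
Qed.

Lemma cvg_limC (u : nat -> R[i]) (l : R[i]) :
  ((u : nat -> R[i]^o) @ \oo --> (l : R[i]^o)) -> limn (u : nat -> R[i]^o) = l.
Proof. by move=> ul; apply: (@cvg_lim R[i]^o) => //; exact: norm_hausdorff. Qed.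

Lemma cvg_sum {T : Type} (F : set_system T) {FF : Filter F} (u : nat -> T -> R)
    (l : nat -> R) m : (forall k, u k x @[x --> F] --> l k) ->
  \sum_(0 <= k < m) u k x @[x --> F] --> \sum_(0 <= k < m) l k.
Proof.
move=> ul; elim: m => [|m IH].
  by rewrite big_geq//; under eq_fun do rewrite big_geq//; exact: cvg_cst.
rewrite big_nat_recr//=; under eq_fun do rewrite big_nat_recr//=.
exact: cvgD.
Qed.

End complex_basics.

(** * Absolutely summable series and power series in the unit disk *)

Section complex_series.
Context {R : realType}.
Implicit Types (z w h : R[i]) (a b : nat -> R[i]).

Definition csum a : R[i] := limn (series a : nat -> R[i]^o).
Definition csummable a := cvgn (series (fun n => normc (a n)) : nat -> R).

Lemma csummable_le a (b : nat -> R) :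
  (forall n, normc (a n) <= b n) -> cvgn (series b) -> csummable a.
Proof.
move=> ab; apply: (series_le_cvg _ _ ab) => n; first exact: normc_ge0.
by rewrite (le_trans (normc_ge0 (a n))).
Qed.

Lemma csum_cvg a : csummable a ->
  (series a : nat -> R[i]^o) @ \oo --> (csum a : R[i]^o).
Proof.
move=> sa.
have cr : cvgn (series (fun n => complex.Re (a n)) : nat -> R).
  apply: (@normed_cvg _ R^o); apply: (series_le_cvg _ _ _ sa) => n; first exact: normr_ge0.
    exact: normc_ge0.
  exact: normc_Re.
have ci : cvgn (series (fun n => complex.Im (a n)) : nat -> R).
  apply: (@normed_cvg _ R^o); apply: (series_le_cvg _ _ _ sa) => n; first exact: normr_ge0.
    exact: normc_ge0.
  exact: normc_Im.
have H : (series a : nat -> R[i]^o) @ \oo -->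
  ((limn (series (fun n => complex.Re (a n)) : nat -> R) +i*
   limn (series (fun n => complex.Im (a n)) : nat -> R)) : R[i]^o).
  apply/cvg_ReIm; rewrite /series/=; split.
    by under eq_fun do rewrite Re_sum; exact: cr.
  by under eq_fun do rewrite Im_sum; exact: ci.
by rewrite /csum (cvg_limC H).
Qed.

Lemma csum_lim a l : (series a : nat -> R[i]^o) @ \oo --> (l : R[i]^o) -> csum a = l.
Proof. exact: cvg_limC. Qed.

Lemma cvg_normc {T : Type} (F : set_system T) {FF : Filter F} (f : T -> R[i]) l :
  (f x : R[i]^o) @[x --> F] --> (l : R[i]^o) ->
  normc (f x) @[x --> F] --> normc l.
Proof.
move=> /cvg_normcP fl; apply/subr_cvg0/norm_cvg0P.
apply: (@squeeze_cvgr _ _ _ _ (cst 0)); [|exact: cvg_cst|exact: fl].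
by apply: nearW => x /=; rewrite normr_ge0; exact: normc_dist.
Qed.

Lemma csum_tail_le a (b : nat -> R) N : (forall n, normc (a n) <= b n) ->
  cvgn (series b) -> normc (csum a - series a N) <= limn (series b) - series b N.
Proof.
move=> ab cb.
have sa := csummable_le ab cb.
have h : (fun n => (series a n - series a N : R[i]^o)) @ \oo -->
    (csum a - series a N : R[i]^o).
  by apply: cvgB; [exact: csum_cvg|exact: cvg_cst].
have h1 : (fun n => normc (series a n - series a N)) @ \oo --> normc (csum a - series a N).
  exact: cvg_normc h.
rewrite -(cvg_lim (@Rhausdorff R) h1).
have h2 : (fun n => series b n - series b N) @ \oo --> limn (series b) - series b N.
  by apply: cvgB => //; exact: cvg_cst.
rewrite -(cvg_lim (@Rhausdorff R) h2); apply: ler_lim.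
- by apply/cvg_ex; eexists; exact: h1.
- by apply/cvg_ex; eexists; exact: h2.
near=> n.
have Nn : (N <= n)%N by near: n; exact: nbhs_infty_ge.
rewrite !sub_series_geq// (le_trans (normc_sum _ _ _))//.
by apply: ler_sum => i _.
Unshelve. all: by end_near.
Qed.

Lemma csum_le a (b : nat -> R) : (forall n, normc (a n) <= b n) ->
  cvgn (series b) -> normc (csum a) <= limn (series b).
Proof.
move=> ab cb; have := csum_tail_le 0 ab cb.
by rewrite !/series/= !big_geq// !subr0.
Qed.

Lemma csumD a b : csummable a -> csummable b ->
  csum (fun n => a n + b n) = csum a + csum b.
Proof.
move=> sa sb; apply: csum_lim.
have -> : series (fun n => a n + b n) = (fun n => series a n + series b n).
  by apply/funext => n; rewrite /series/= big_split.
by apply: (@cvgD _ R[i]^o); exact: csum_cvg.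
Qed.

Lemma csumZ z a : csummable a -> csum (fun n => z * a n) = z * csum a.
Proof.
move=> sa; apply: csum_lim.
have -> : series (fun n => z * a n) = (fun n => z * series a n).
  by apply/funext => n; rewrite /series/= mulr_sumr.
by apply: (@cvgMl_tmp _ _ _ _ (series a : nat -> R[i]^o)); exact: csum_cvg.
Qed.

Lemma csummableZ z a : csummable a -> csummable (fun n => z * a n).
Proof.
move=> sa; rewrite /csummable.
have -> : series (fun n => normc (z * a n)) = (fun n => normc z * series (fun n => normc (a n)) n).
  by apply/funext => n; rewrite /series/= mulr_sumr; apply: eq_bigr => k _; rewrite normcM.
by apply: is_cvgMl_tmp.
Qed.

Lemma csummableD a b : csummable a -> csummable b -> csummable (fun n => a n + b n).
Proof.
move=> sa sb; apply: (@csummable_le _ (fun n => normc (a n) + normc (b n))).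
  by move=> n; exact: normcD.
have -> : series (fun n => normc (a n) + normc (b n)) =
    (fun n => series (fun n => normc (a n)) n + series (fun n => normc (b n)) n).
  by apply/funext => n; rewrite /series/= big_split.
exact: is_cvgD.
Qed.

Lemma csum_conj a : csummable a -> csum (fun n => (a n)^*) = (csum a)^*.
Proof.
move=> /csum_cvg/cvg_ReIm [cr ci]; apply: csum_lim.
have E : (series (fun n => (a n)^*) : nat -> R[i]^o) = (fun n => (series a n)^*).
  by apply/funext => n; rewrite /series/= rmorph_sum.
rewrite E; apply/cvg_ReIm; split.
  by under eq_fun do rewrite cReJ; rewrite cReJ.
by under eq_fun do rewrite cImJ; rewrite cImJ; apply: cvgN.
Qed.

Lemma csum_fin a N : (forall n, (N <= n)%N -> a n = 0) -> csum a = series a N.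
Proof.
move=> a0; apply: csum_lim; apply: cvg_near_cst; near=> n.
have Nn : (N <= n)%N by near: n; exact: nbhs_infty_ge.
apply/eqP; rewrite -subr_eq0 sub_series_geq// big_nat big1// => i /andP[Ni _].
exact: a0.
Unshelve. all: by end_near.
Qed.

Lemma csumS a : csummable a -> csum a = a 0 + csum (fun n => a n.+1).
Proof.
move=> sa; apply: csum_lim.
have E n : series a n.+1 = a 0 + series (fun n => a n.+1) n.
  by rewrite /series/= big_nat_recl.
have sS : csummable (fun n => a n.+1).
  move: sa => /cvg_ex[l sa]; apply/cvg_ex; exists (l - normc (a 0)).
  have -> : series (fun n => normc (a n.+1)) =
      (fun n => series (fun n => normc (a n)) n.+1 - normc (a 0)).
    by apply/funext => n; rewrite /series/= big_nat_recl// addrC addKr.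
  apply: cvgB; last exact: cvg_cst.
  by rewrite (cvg_shiftS (series (fun n => normc (a n)))).
rewrite -(cvg_shiftS (series a : nat -> R[i]^o)) /=; under eq_fun do rewrite E.
by apply: (@cvgD _ R[i]^o); [exact: cvg_cst|exact: csum_cvg].
Qed.

Lemma geo_cvg (C r : R) : 0 <= r < 1 -> cvgn (series (fun n => C * r ^+ n)).
Proof.
move=> /andP[r0 r1]; have := @is_cvg_geometric_series _ C r.
by rewrite ger0_norm//; apply.
Qed.

Lemma geo_lim (C r : R) : 0 <= r < 1 ->
  limn (series (fun n => C * r ^+ n)) = C / (1 - r).
Proof.
move=> /andP[r0 r1]; have := @cvg_geometric_series _ C r.
by rewrite ger0_norm// => /(_ r1)/cvg_lim; apply.
Qed.

(* radius of convergence at least 1 *)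
Definition rc1 a := forall r : R, 0 <= r < 1 ->
  exists C, forall n, normc (a n) * r ^+ n <= C.

Lemma rc1_summableR a (r : R) : rc1 a -> 0 <= r < 1 ->
  cvgn (series (fun n => normc (a n) * r ^+ n) : nat -> R).
Proof.
move=> ra /andP[r0 r1].
pose s := (1 + r) / 2.
have s0 : 0 < s by rewrite /s; lra.
have s1 : 0 <= s < 1 by rewrite /s; lra.
have [C aC] := ra _ s1.
have rs : 0 <= r / s < 1.
  by rewrite divr_ge0 ?(ltW s0)//= ltr_pdivrMr// mul1r /s; lra.
apply: (@series_le_cvg _ _ (fun n => C * (r / s) ^+ n)).
- by move=> n; rewrite mulr_ge0 ?normc_ge0 ?exprn_ge0.
- move=> n; rewrite mulr_ge0//; last by rewrite exprn_ge0//; case/andP: rs.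
  by rewrite (le_trans _ (aC n))// mulr_ge0 ?normc_ge0// exprn_ge0// ltW.
- move=> n; rewrite expr_div_n mulrA ler_pdivlMr ?exprn_gt0//.
  by rewrite mulrAC ler_wpM2r ?exprn_ge0.
- exact: geo_cvg.
Qed.

Lemma rc1_summable a z : rc1 a -> normc z < 1 -> csummable (fun n => a n * z ^+ n).
Proof.
move=> ra z1; rewrite /csummable.
have -> : (fun n => normc (a n * z ^+ n)) = (fun n => normc (a n) * normc z ^+ n).
  by apply/funext => n; rewrite normcM normcX.
by apply: rc1_summableR => //; rewrite normc_ge0.
Qed.

Lemma rc1_bounded a (C : R) : (forall n, normc (a n) <= C) -> rc1 a.
Proof.
move=> aC r /andP[r0 r1]; exists C => n; rewrite (le_trans _ (aC n))//.
by rewrite ler_piMr ?normc_ge0// exprn_ile1// ltW.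
Qed.

(** Bernoulli's inequality. It absorbs the factor [n] of a differentiated power series, and shows
    that the powers of a number above 1 exceed any constant. *)
Lemma mulrn_expr_le (h : R) n : 0 <= h -> n%:R * h <= (1 + h) ^+ n.
Proof.
move=> h0; suff : 1 + n%:R * h <= (1 + h) ^+ n by apply: le_trans; lra.
elim: n => [|n IH]; first by rewrite expr0; lra.
rewrite exprS (le_trans _ (ler_wpM2l _ IH)) ?addr_ge0//.
have : 0 <= n%:R * h * h by rewrite !mulr_ge0.
by rewrite -natr1; nra.
Qed.

Lemma rc1_muln a : rc1 a -> rc1 (fun n => n%:R * a n).
Proof.
move=> ra r /andP[r0 r1].
pose h := (1 - r) / 2.
have h0 : 0 < h by rewrite /h; lra.
have r1h : 0 <= r * (1 + h) < 1.
  by rewrite mulr_ge0/= ?addr_ge0 ?(ltW h0)//; rewrite /h; nra.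
have [C aC] := ra _ r1h; exists (C / h) => n.
rewrite ler_pdivlMr// normcM (le_trans _ (aC n))// exprMn.
have -> : normc (n%:R : R[i]) = n%:R.
  by rewrite -(rmorph_nat (real_complex R)) normc_real ger0_norm.
rewrite [leLHS](_ : _ = normc (a n) * r ^+ n * (n%:R * h)); last by ring.
rewrite [leRHS](_ : _ = normc (a n) * r ^+ n * (1 + h) ^+ n); last by ring.
by rewrite ler_wpM2l ?mulr_ge0 ?normc_ge0 ?exprn_ge0// mulrn_expr_le// ltW.
Qed.

Lemma rc1_shift a : rc1 a -> rc1 (fun n => a n.+1).
Proof.
move=> ra r /andP[r0 r1].
have [s rs s1] : exists2 s, r < s & s < 1 by exists ((1 + r) / 2); lra.
have s0 : 0 < s by lra.
have [|C aC] := ra s; first by rewrite ltW.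
exists (C / s) => n.
rewrite ler_pdivlMr// (le_trans _ (aC n.+1))// exprSr mulrA ler_wpM2r ?(ltW s0)//.
by rewrite ler_wpM2l ?normc_ge0// lerXn2r ?nnegrE ?(ltW s0) ?(ltW rs).
Qed.

Definition psum a z := csum (fun n => a n * z ^+ n).

(** Induction on [n], the error being multiplied by [z + h] at each step. The factor [r ^+ 2] on the
    left stands for an exponent [n - 2] on the right, which would be truncated for small [n]. *)
Lemma taylor_remainder z h (r : R) n : normc z <= r -> normc (z + h) <= r ->
  normc ((z + h) ^+ n - z ^+ n - n%:R * z ^+ n.-1 * h) * r ^+ 2 <=
  n%:R ^+ 2 * r ^+ n * normc h ^+ 2.
Proof.
move=> zr zhr.
have r0 : 0 <= r by rewrite (le_trans (normc_ge0 z)).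
elim: n => [|n IH].
  by rewrite !expr0 subrr !mul0r subr0 normc0 mul0r expr0n/= !mul0r.
set e := (z + h) ^+ n - z ^+ n - n%:R * z ^+ n.-1 * h in IH.
have -> : (z + h) ^+ n.+1 - z ^+ n.+1 - n.+1%:R * z ^+ n.+1.-1 * h =
    (z + h) * e + n%:R * z ^+ n.-1 * h ^+ 2.
  rewrite /e; case: n {IH e} => [|n] /=; first by rewrite !expr0 !expr1; ring.
  by rewrite !exprS -!natr1; ring.
have nE : normc (n%:R : R[i]) = n%:R.
  by rewrite -(rmorph_nat (real_complex R)) normc_real ger0_norm.
apply: (@le_trans _ _ (r * (normc e * r ^+ 2) + n%:R * r ^+ n.-1 * normc h ^+ 2 * r ^+ 2)).
  rewrite [leRHS](_ : _ = (r * normc e + n%:R * r ^+ n.-1 * normc h ^+ 2) * r ^+ 2); last by ring.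
  rewrite ler_wpM2r ?exprn_ge0// (le_trans (normcD _ _))// !normcM !normcX nE.
  apply: lerD; first by rewrite ler_wpM2r ?normc_ge0.
  rewrite ler_wpM2r ?sqr_ge0 ?exprn_ge0 ?normc_ge0// ler_wpM2l//.
  by rewrite lerXn2r ?nnegrE ?normc_ge0.
apply: (@le_trans _ _ (r * (n%:R ^+ 2 * r ^+ n * normc h ^+ 2) + n%:R * r ^+ n.+1 * normc h ^+ 2)).
  rewrite lerD ?ler_wpM2l// mulrAC ler_wpM2r ?exprn_ge0 ?normc_ge0//.
  case: n {IH e nE} => [|n] /=; first by rewrite !mul0r.
  by rewrite !exprS; apply/eqle; ring.
rewrite [leLHS](_ : _ = (n%:R ^+ 2 + n%:R) * (r ^+ n.+1 * normc h ^+ 2)); last by rewrite (exprS r n); ring.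
rewrite -[leRHS]mulrA ler_wpM2r ?mulr_ge0 ?exprn_ge0 ?normc_ge0//.
by rewrite -natr1 sqrrD expr1n mulr1; have : 0 <= n%:R :> R by []; lra.
Qed.

Definition cderivable (F : R[i] -> R[i]) z := derivable (F : R[i]^o -> R[i]^o) z 1.

Lemma cderivableP (F : R[i] -> R[i]) z : cderivable F z <->
  exists l : R[i], forall e : R, 0 < e -> exists2 d : R, 0 < d &
    forall h, normc h < d -> normc (F (z + h) - F z - l * h) <= e * normc h.
Proof.
have E : (fun h : R[i]^o => h^-1 *: (((F : R[i]^o -> R[i]^o) \o shift z) (h *: (1 : R[i]^o)) - F z)) =
     (fun h : R[i]^o => (h^-1 * (F (z + h) - F z) : R[i]^o)).
  by apply/funext => h; rewrite /shift/= /GRing.scale/= mulr1 (addrC h).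
rewrite /cderivable /derivable E; split.
  move=> /cvg_ex[l /cvg_normcP/cvgrPdist_le H]; exists l => e e0.
  have [[d y]] := H _ e0; rewrite /= ltcE => /andP[/eqP/= y0 d0] B.
  subst y; exists d => // h hd.
  have [->|h0] := eqVneq h 0.
    by rewrite addr0 subrr mulr0 subrr !normc0 mulr0.
  have hd2 : `|h| < d%:C by rewrite normrC_lt.
  have := B h; rewrite /ball_/= sub0r normrN => /(_ hd2 h0).
  rewrite sub0r normrN ger0_norm ?normc_ge0// => hh.
  have -> : F (z + h) - F z - l * h = (h^-1 * (F (z + h) - F z) - l) * h.
    by rewrite mulrBl mulrAC mulVf// mul1r.
  by rewrite normcM ler_wpM2r// normc_ge0.
move=> [l H]; apply/cvg_ex; exists l; apply/cvg_normcP/cvgrPdist_le => e e0.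
have [d d0 hd] := H _ e0; exists d%:C; first by rewrite /= ltcR.
move=> h; rewrite /ball_/= sub0r normrN normrC_lt => hhd h0.
rewrite sub0r normrN ger0_norm ?normc_ge0//.
have -> : h^-1 * (F (z + h) - F z) - l = (F (z + h) - F z - l * h) * h^-1.
  by rewrite [RHS]mulrBl mulfK// [in RHS]mulrC.
by rewrite normcM normcV ler_pdivrMr ?normc_gt0// hd.
Qed.

Lemma psum_cderivable a z : rc1 a -> normc z < 1 -> cderivable (psum a) z.
Proof.
move=> ra z1; apply/cderivableP.
pose r := (1 + normc z) / 2.
have zr : normc z < r by rewrite /r; lra.
have r0 : 0 < r by rewrite /r; have := normc_ge0 z; lra.
have r1 : 0 <= r < 1 by rewrite ltW//= /r; lra.
pose l := csum (fun n => n%:R * a n * z ^+ n.-1); exists l.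
have S2 := rc1_summableR (rc1_muln (rc1_muln ra)) r1.
(* [K] sums [n^2 |a n| r^n]: by [taylor_remainder] the total error is at most [K |h|^2 / r^2]. *)
set K := limn (series (fun n => normc (n%:R * (n%:R * a n)) * r ^+ n)) in S2.
have K0 : 0 <= K.
  apply: limr_ge => //; apply: nearW => n; rewrite /series/=; apply: sumr_ge0 => k _.
  by rewrite mulr_ge0 ?normc_ge0 ?exprn_ge0// ltW.
have nE n : normc (n%:R : R[i]) = n%:R.
  by rewrite -(rmorph_nat (real_complex R)) normc_real ger0_norm.
have sl : csummable (fun n => n%:R * a n * z ^+ n.-1).
  apply: (@csummable_le _ (fun n => r^-1 * (normc (n%:R * a n) * r ^+ n))).
    move=> [|n]; first by rewrite !mul0r normc0 mul0r mulr0.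
    rewrite normcM mulrCA ler_wpM2l ?normc_ge0// exprS mulKf ?gt_eqF//.
    by rewrite normcX lerXn2r ?nnegrE ?normc_ge0 ?ltW.
  have -> : series (fun n => r^-1 * (normc (n%:R * a n) * r ^+ n)) =
     (fun n => r^-1 * series (fun n => normc (n%:R * a n) * r ^+ n) n).
    by apply/funext => n; rewrite /series/= mulr_sumr.
  by apply: is_cvgMl_tmp; exact: rc1_summableR (rc1_muln ra) r1.
have key h : normc (z + h) < r ->
    normc (psum a (z + h) - psum a z - l * h) <= K / r ^+ 2 * normc h ^+ 2.
  move=> zhr.
  have s1 := rc1_summable ra (lt_trans zhr (proj2 (andP r1))).
  have s2 := rc1_summable ra z1.
  rewrite (_ : psum a (z + h) - psum a z - l * h =
      csum (fun n => a n * ((z + h) ^+ n - z ^+ n - n%:R * z ^+ n.-1 * h))); last first.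
    rewrite [X in _ = csum X](_ : _ = fun n => a n * (z + h) ^+ n +
        (-1 * (a n * z ^+ n) + - h * (n%:R * a n * z ^+ n.-1))); last first.
      by apply/funext => n; ring.
    rewrite csumD//; last by apply: csummableD; exact: csummableZ.
    rewrite csumD; [|exact: csummableZ|exact: csummableZ].
    by rewrite !csumZ// /psum /l; ring.
  apply: (@le_trans _ _ (limn (series (fun n =>
      (normc h ^+ 2 / r ^+ 2) * (normc (n%:R * (n%:R * a n)) * r ^+ n))))).
    apply: csum_le; last first.
      have -> : series (fun n => (normc h ^+ 2 / r ^+ 2) * (normc (n%:R * (n%:R * a n)) * r ^+ n)) =
        (fun n => (normc h ^+ 2 / r ^+ 2) * series (fun n => normc (n%:R * (n%:R * a n)) * r ^+ n) n).
        by apply/funext => n; rewrite /series/= mulr_sumr.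
      exact: is_cvgMl_tmp.
    move=> n; rewrite [leRHS]mulrAC ler_pdivlMr ?exprn_gt0//.
    rewrite [in leLHS]normcM -[leLHS]mulrA.
    apply: le_trans (ler_wpM2l (normc_ge0 (a n)) (taylor_remainder n (ltW zr) (ltW zhr))) _.
    by rewrite !normcM !nE; apply/eqle; ring.
  rewrite [leRHS](_ : _ = (normc h ^+ 2 / r ^+ 2) * K); last by ring.
  have -> : series (fun n => (normc h ^+ 2 / r ^+ 2) * (normc (n%:R * (n%:R * a n)) * r ^+ n)) =
        (fun n => (normc h ^+ 2 / r ^+ 2) * series (fun n => normc (n%:R * (n%:R * a n)) * r ^+ n) n).
    by apply/funext => n; rewrite /series/= mulr_sumr.
  by apply/eqle/cvg_lim; [exact: Rhausdorff|apply: cvgMl_tmp].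
move=> e e0; pose K' := K / r ^+ 2 + 1.
have K'0 : 0 < K' by rewrite /K' ltr_pwDr// divr_ge0// exprn_ge0// ltW.
exists (Num.min (r - normc z) (e / K')).
  by rewrite lt_min subr_gt0 zr/= divr_gt0.
move=> h; rewrite lt_min => /andP[h1 h2].
rewrite (le_trans (key _ _))//.
  by rewrite (le_lt_trans (normcD _ _))//; lra.
rewrite expr2 mulrA ler_wpM2r ?normc_ge0//.
move: h2; rewrite ltr_pdivlMr// => h2; rewrite (le_trans _ (ltW h2))// mulrC.
by rewrite ler_wpM2l ?normc_ge0// /K' lerDl.
Qed.

Lemma psum0_coef a (d : R) : rc1 a -> 0 < d <= 1 ->
  (forall z, normc z < d -> psum a z = 0) -> forall n, a n = 0.
Proof.
move=> ra /andP[d0 d1] a0.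
(* Punctured discs, because the shifted series is obtained from [b] by dividing by [z]. *)
suff : forall m b, rc1 b -> (forall z, 0 < normc z < d -> psum b z = 0) -> forall n, (n < m)%N -> b n = 0.
  move=> H n; apply: (H n.+1) => // z /andP[_]; exact: a0.
elim=> [//|m IH] b rb b0.
have half1 : 0 <= (1/2:R) < 1 by lra.
have pS z : normc z < 1 -> psum b z = b 0 + z * psum (fun n => b n.+1) z.
  move=> z1; rewrite /psum csumS ?expr0 ?mulr1; last exact: rc1_summable.
  rewrite -csumZ; last exact: (rc1_summable (rc1_shift rb)).
  by congr (_ + csum _); apply/funext => n; rewrite exprS; ring.
have [K KP] : exists K : R, forall z, normc z <= 1/2 -> normc (psum (fun n => b n.+1) z) <= K.
  exists (limn (series (fun n => normc (b n.+1) * (1/2) ^+ n))) => z z1.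
  apply: csum_le; last exact: rc1_summableR (rc1_shift rb) half1.
  move=> n; rewrite normcM normcX ler_wpM2l ?normc_ge0//.
  by rewrite lerXn2r ?nnegrE ?normc_ge0//; lra.
have b00 : b 0%N = 0.
  apply/eqP; rewrite -normc_eq0; apply/eqP/le_anti; rewrite normc_ge0 andbT.
  apply/ler_addgt0Pl => e e0; rewrite addr0.
  pose K' := `|K| + 1.
  have K'0 : 0 < K' by rewrite /K' ltr_pwDr.
  pose x := Num.min (Num.min (d / 2) (1 / 2)) (e / K').
  have x0 : 0 < x by rewrite /x !lt_min !divr_gt0.
  have xE : normc x%:C = x by rewrite normc_real gtr0_norm.
  have xd : x < d.
    rewrite (@le_lt_trans _ _ (d / 2))//; last lra.
    by rewrite /x !ge_min lexx.
  have x2 : x <= 1/2 by rewrite /x !ge_min lexx orbT.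
  have xe : x <= e / K' by rewrite /x !ge_min lexx orbT.
  have := b0 x%:C; rewrite xE x0 xd pS ?xE; last lra.
  move=> /(_ isT)/eqP; rewrite addr_eq0 => /eqP ->.
  rewrite normcN normcM xE (le_trans (ler_wpM2l (ltW x0) (KP _ _)))//; first by rewrite xE.
  move: xe; rewrite ler_pdivlMr// => xe; rewrite (le_trans _ xe)// ler_wpM2l ?(ltW x0)//.
  by rewrite /K' (le_trans (ler_norm K))// lerDl.
move=> [//|n]; rewrite ltnS => nm; apply: (IH (fun n => b n.+1)) => //.
  exact: rc1_shift.
move=> z /andP[z0 zd]; have := b0 z; rewrite z0 zd pS ?b00 ?add0r => [/(_ isT)/eqP|].
  by rewrite mulf_eq0 -normc_eq0 gt_eqF//= => /eqP.
exact: lt_le_trans zd d1.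
Qed.

End complex_series.

(** * The Hilbert space structure: Cauchy-Schwarz, completeness, Riesz' theorem *)

Section hilbert.
Context {R : realType}.
Implicit Types (f g h : hardy2 R) (c : R[i]).
Local Notation dot := (@hardy_dot R).

Definition hn f : R := Num.sqrt (limn (sqsum f)).

Lemma hnE f : `|f| = (hn f)%:C. Proof. by []. Qed.

Lemma hn_ge0 f : 0 <= hn f. Proof. exact: sqrtr_ge0. Qed.

Lemma hn_sq f : hn f ^+ 2 = limn (sqsum f).
Proof. by rewrite sqr_sqrtr// lim_sqsum_ge0// taylor_l2. Qed.

Lemma hn0 : hn 0 = 0.
Proof. by apply: complexI; rewrite -hnE normr0. Qed.

Lemma hn_eq0 f : hn f = 0 -> f = 0.
Proof. by move=> h; apply/normr0_eq0; rewrite hnE h. Qed.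

Lemma hnD f g : hn (f + g) <= hn f + hn g.
Proof. by rewrite -lecR rmorphD/= -!hnE ler_normD. Qed.

Lemma hnZ c f : hn (c *: f) = normc c * hn f.
Proof. by apply: complexI; rewrite -hnE normrZ rmorphM/= normr_normc. Qed.

Lemma hnN f : hn (- f) = hn f.
Proof. by apply: complexI; rewrite -!hnE normrN. Qed.

Lemma taylorD f g n : (f + g) n = f n + g n. Proof. by []. Qed.
Lemma taylorZ c f n : (c *: f) n = c * f n. Proof. by []. Qed.
Lemma taylorN f n : (- f) n = - f n. Proof. by []. Qed.
Lemma taylorP f g : (forall n, f n = g n) -> f = g.
Proof. by move=> fg; apply/val_inj/funext => n /=; exact: fg. Qed.

Lemma dotE f g : dot f g = csum (fun n => f n * (g n)^*).
Proof. by []. Qed.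

Lemma dot_summable f g : csummable (fun n => f n * (g n)^*).
Proof.
apply: (@csummable_le _ _ (fun n => normc (f n) ^+ 2 + normc (g n) ^+ 2)) => [n|].
  rewrite normcM normc_conj.
  have := sqr_ge0 (normc (f n) - normc (g n)).
  by have := normc_ge0 (f n); have := normc_ge0 (g n); nra.
have -> : series (fun n => normc (f n) ^+ 2 + normc (g n) ^+ 2) = (fun n => sqsum f n + sqsum g n).
  by apply/funext => n; rewrite /series/= big_split.
by apply: is_cvgD; exact/l2P/taylor_l2.
Qed.

Lemma dotDl f g h : dot (f + g) h = dot f h + dot g h.
Proof.
rewrite !dotE -csumD; [|exact: dot_summable..].
by congr csum; apply/funext => n; rewrite taylorD mulrDl.
Qed.

Lemma dotZl c f h : dot (c *: f) h = c * dot f h.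
Proof.
rewrite !dotE -csumZ; last exact: dot_summable.
by congr csum; apply/funext => n; rewrite taylorZ mulrA.
Qed.

Lemma dotC f g : dot g f = (dot f g)^*.
Proof.
rewrite !dotE -csum_conj; last exact: dot_summable.
by congr csum; apply/funext => n; rewrite rmorphM/= conjcK mulrC.
Qed.

Lemma dotDr f g h : dot h (f + g) = dot h f + dot h g.
Proof. by rewrite dotC dotDl rmorphD/= -!dotC. Qed.

Lemma dotZr c f h : dot h (c *: f) = c^* * dot h f.
Proof. by rewrite dotC dotZl rmorphM/= -!dotC. Qed.

Lemma dotNl f h : dot (- f) h = - dot f h.
Proof. by rewrite -scaleN1r dotZl mulN1r. Qed.

Lemma dotNr f h : dot h (- f) = - dot h f.
Proof. by rewrite dotC dotNl rmorphN/= -dotC. Qed.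

Lemma dotff f : dot f f = (hn f ^+ 2)%:C.
Proof. by rewrite hardy_dot_norm hnE rmorphXn. Qed.

Lemma hn_sqD f g : hn (f + g) ^+ 2 = hn f ^+ 2 + hn g ^+ 2 + 2 * complex.Re (dot f g).
Proof.
apply: complexI; rewrite -dotff dotDl !dotDr !dotff (dotC f g).
by case: (dot f g) => x y; apply/complexP => /=; ring.
Qed.

Lemma coef_le_hn f n : normc (f n) <= hn f.
Proof.
rewrite -(@ler_pXn2r _ 2)// ?nnegrE ?normc_ge0 ?hn_ge0// hn_sq.
apply: le_trans (sqsum_le_lim (taylor_l2 f) n.+1).
by rewrite /sqsum big_nat_recr//= lerDr; exact: sqsum_ge0.
Qed.

Lemma dot_CS f g : normc (dot f g) <= hn f * hn g.
Proof.
have [/hn_eq0 ->|g0] := eqVneq (hn g) 0.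
  have -> : dot f 0 = 0 by rewrite -(subrr (0 : hardy2 R)) dotDr dotNr subrr.
  by rewrite normc0 mulr_ge0 ?hn_ge0.
have gp : 0 < hn g by rewrite lt_neqAle eq_sym g0 hn_ge0.
set d := dot f g.
(* [f + c g] is the component of [f] orthogonal to [g]; its squared norm [|f|^2 - |d|^2 / |g|^2] is
   nonnegative. *)
pose c := - (d * ((hn g ^+ 2)^-1)%:C).
have := sqr_ge0 (hn (f + c *: g)); rewrite hn_sqD hnZ dotZr -/d.
have -> : complex.Re (c^* * d) = - (normc d ^+ 2 / hn g ^+ 2).
  have -> // : c^* * d = (- (normc d ^+ 2 / hn g ^+ 2))%:C.
  rewrite /c sqr_normcE'; case: d {c} => x y; apply/complexP => /=; ring.
have nr : normc ((hn g ^+ 2)^-1)%:C = (hn g ^+ 2)^-1.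
  by rewrite normc_real ger0_norm// invr_ge0 sqr_ge0.
rewrite /c normcN normcM nr.
have -> : (normc d / hn g ^+ 2 * hn g) ^+ 2 = normc d ^+ 2 / hn g ^+ 2 by field.
move=> H; rewrite -(@ler_pXn2r _ 2)// ?nnegrE ?normc_ge0 ?mulr_ge0 ?hn_ge0//.
rewrite exprMn -ler_pdivrMr ?exprn_gt0//; lra.
Qed.

Definition hcvg (u : nat -> hardy2 R) f :=
  forall e : R, 0 < e -> exists N, forall i, (N <= i)%N -> hn (u i - f) <= e.

(** Coefficients converge one by one; letting [j] tend to infinity in each partial sum of
    [|u i - u j|^2] bounds the distance to the limit, uniformly in the length of the sum. *)
Lemma hardy_complete (u : nat -> hardy2 R) :
  (forall e : R, 0 < e -> exists N, forall i j, (N <= i)%N -> (N <= j)%N -> hn (u i - u j) <= e) ->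
  exists f, hcvg u f.
Proof.
move=> cu.
have cr (p : R[i] -> R) : (forall z w, p (z - w) = p z - p w) ->
    (forall z, `|p z| <= normc z) -> forall n, cvgn (fun i => p (u i n) : R).
  move=> pB pn n; apply: (@cauchy_cvg R^o); apply/cauchy_exP => e e0.
  have [N uN] := cu _ (divr_gt0 e0 (ltr0n R 2)).
  exists (p (u N n)); exists N => // i /= Ni; rewrite /ball/= -pB.
  rewrite (le_lt_trans (pn _))// -taylorN -taylorD (le_lt_trans (coef_le_hn _ _))//.
  by rewrite (le_lt_trans (uN _ _ _ _))//; lra.
have rB (z w : R[i]) : complex.Re (z - w) = complex.Re z - complex.Re w by rewrite cReD cReN.
have iB (z w : R[i]) : complex.Im (z - w) = complex.Im z - complex.Im w by rewrite cImD cImN.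
pose x n : R[i]^o := limn (fun i => complex.Re (u i n) : R) +i* limn (fun i => complex.Im (u i n) : R).
have ux n : (fun i => u i n) @ \oo --> x n.
  by apply/cvg_ReIm; split; [exact: (cr _ rB (@normc_Re R))|exact: (cr _ iB (@normc_Im R))].
have key e : 0 < e -> exists N, forall i, (N <= i)%N -> forall m, sqsum (fun n => u i n - x n) m <= e ^+ 2.
  move=> e0; have [N uN] := cu _ e0; exists N => i Ni m.
  have H : (fun j => sqsum (fun n => u i n - u j n) m) @ \oo --> sqsum (fun n => u i n - x n) m.
    rewrite /sqsum; apply: (cvg_sum (u := fun k j => normc (u i k - u j k) ^+ 2)) => k.
    have K : (fun j => (u i k - u j k : R[i]^o)) @ \oo --> (u i k - x k : R[i]^o).
      by apply: cvgB; [exact: cvg_cst|exact: ux].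
    by under eq_fun do rewrite expr2; rewrite expr2; apply: cvgM; exact: cvg_normc K.
  rewrite -(cvg_lim (@Rhausdorff R) H); apply: limr_le.
    by apply/cvg_ex; eexists; exact: H.
  near=> j; have Nj : (N <= j)%N by near: j; exact: nbhs_infty_ge.
  have := uN i j Ni Nj; rewrite -(@ler_pXn2r _ 2)// ?nnegrE ?hn_ge0 ?(ltW e0)// hn_sq.
  by apply: le_trans; exact: (sqsum_le_lim (taylor_l2 (u i - u j)) m).
have xl2 : x \in l2.
  have [N uN] := key 1 ltr01.
  have d2 : (fun n => u N n - x n) \in l2 by apply: l2_le => n; exact: uN.
  have -> : x = (u N : nat -> R[i]^o) - (fun n => u N n - x n).
    by apply/funext => n; rewrite -[RHS]/(u N n - (u N n - x n)) opprB addrC subrK.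
  by apply: rpredB => //; exact: taylor_l2.
exists (Hardy2 xl2) => e e0; have [N uN] := key e e0; exists N => i Ni.
rewrite -(@ler_pXn2r _ 2)// ?nnegrE ?hn_ge0 ?(ltW e0)// hn_sq.
by apply: lim_sqsum_le; [exact: taylor_l2|exact: uN].
Unshelve. all: by end_near.
Qed.

Lemma le_small (x y : R) : (forall e, 0 < e -> x <= y + e) -> x <= y.
Proof. by move=> H; apply/ler_addgt0Pr. Qed.

Lemma par_arith (x1 x2 x3 x4 x5 x6 : R) :
  x6 <= 2^-1 ^+ 2 * (x1 + x2 + 2 * x3) - 2 * (2^-1 * (x4 + x5)) ->
  x1 + x2 + 2 * - x3 <= 2 * (x1 - 2 * x4) + 2 * (x2 - 2 * x5) - 4 * x6.
Proof.
have -> : (2^-1 : R) ^+ 2 = 1 / 4 by field.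
lra.
Qed.

Lemma par_arith2 (a b x y d e : R) : a <= e / 4 -> b <= e / 4 ->
  x < d + a -> y < d + b -> 2 * x + 2 * y - 4 * d <= e.
Proof. lra. Qed.

Lemma par_arith3 (u2 L d n a X Y e Z m : R) : u2 - 2 * L < d + n ->
  d <= u2 + a + 2 * X - 2 * (L + Y) -> n <= e / 2 -> 2 * m <= e / 2 ->
  X <= Z + m -> 0 <= 2 * (Z + - Y) + a + e.
Proof. lra. Qed.

(* [W] need not be closed: [x] is the limit of a minimising sequence of
   [|w|^2 - 2 Re (l w)] in [W]. *)
Lemma riesz (W : set (hardy2 R)) (l : hardy2 R -> R[i]) (K : R) :
  W 0 -> (forall c f g, W f -> W g -> W (c *: f + g)) ->
  (forall c f g, W f -> W g -> l (c *: f + g) = c * l f + l g) ->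
  0 <= K -> (forall f, W f -> normc (l f) <= K * hn f) ->
  exists x, [/\ hn x <= K, (forall e, 0 < e -> exists2 w, W w & hn (w - x) <= e) &
    forall w, W w -> l w = dot w x].
Proof.
move=> W0 WD lD K0 lK.
have l0 : l 0 = 0.
  by have := lD (-1) 0 0 W0 W0; rewrite scaler0 addr0 mulN1r addNr.
have WZ c f : W f -> W (c *: f).
  by move=> Wf; rewrite -[_ *: _]addr0; exact: WD.
have lZ c f : W f -> l (c *: f) = c * l f.
  by move=> Wf; rewrite -[c *: f]addr0 lD// l0 addr0.
have WA f g : W f -> W g -> W (f + g).
  by move=> Wf Wg; rewrite -[f]scale1r; exact: WD.
have lA f g : W f -> W g -> l (f + g) = l f + l g.
  by move=> Wf Wg; rewrite -[f]scale1r lD// mul1r scale1r.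
pose J f : R := hn f ^+ 2 - 2 * complex.Re (l f).
have Jlb f : W f -> - K ^+ 2 <= J f.
  move=> Wf; have := lK _ Wf; have := normc_Re (l f); rewrite ler_norml => /andP[_ h1] h2.
  by have := sqr_ge0 (hn f - K); rewrite /J; nra.
pose E := [set J f | f in W].
have hE : has_inf E.
  split; first by exists (J 0), 0.
  by exists (- K ^+ 2) => _ [f Wf <-]; exact: Jlb.
pose d := inf E.
have dle f : W f -> d <= J f by move=> Wf; apply: ge_inf; [exact: hE.2|exists f].
have mseq (j : nat) : exists w, W w /\ J w < d + j.+1%:R^-1.
  have j0 : 0 < j.+1%:R^-1 :> R by rewrite invr_gt0.
  have [_ [f Wf <-] h] := inf_adherent j0 hE.
  by exists f.
have [u uP] := choice mseq.
have uW j : W (u j) by case: (uP j).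
have uJ j : J (u j) < d + j.+1%:R^-1 by case: (uP j).
(* Parallelogram identity: the midpoint of [f] and [g] lies in [W], where [J] is at least [d], so a
   minimising sequence is Cauchy. *)
have par f g : W f -> W g -> hn (f - g) ^+ 2 <= 2 * J f + 2 * J g - 4 * d.
  move=> Wf Wg.
  have := dle _ (WZ (2^-1)%:C _ (WA _ _ Wf Wg)).
  rewrite /J hnZ lZ ?lA//; last exact: WA.
  have -> : normc (2^-1)%:C = 2^-1 :> R by rewrite normc_real ger0_norm// invr_ge0.
  have -> : complex.Re ((2^-1)%:C * (l f + l g)) = 2^-1 * (complex.Re (l f) + complex.Re (l g)).
    by rewrite cReM cReD /= mul0r subr0.
  rewrite exprMn (hn_sqD f g) (hn_sqD f (- g)) hnN dotNr cReN.
  exact: par_arith.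
have inv_small (e : R) : 0 < e -> exists N, forall i, (N <= i)%N -> i.+1%:R^-1 <= e.
  move=> e0; exists (Num.truncn e^-1) => i Ni.
  rewrite invf_ple ?posrE//; apply/ltW; apply: lt_le_trans (truncnS_gt _) _.
  by rewrite ler_nat.
have [x ux] : exists f, hcvg u f.
  apply: hardy_complete => e e0.
  have e4 : 0 < e ^+ 2 / 4 by rewrite divr_gt0// exprn_gt0.
  have [N NP] := inv_small _ e4; exists N => i j Ni Nj.
  rewrite -(@ler_pXn2r _ 2)// ?nnegrE ?hn_ge0 ?(ltW e0)//.
  apply: le_trans (par _ _ (uW i) (uW j)) _.
  exact: (par_arith2 (NP _ Ni) (NP _ Nj) (uJ i) (uJ j)).
have lx w : W w -> l w = dot w x.
  move=> Ww.
  (* First variation: [J (u j + c w) >= d], while [J (u j)] is within [1/(j+1)] of [d]; let [j] tend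
     to infinity. *)
  have pos c : 0 <= 2 * complex.Re (c * (dot w x - l w)) + normc c ^+ 2 * hn w ^+ 2.
    apply: le_small => e e0.
    pose M := 2 * (normc c * hn w) + 1.
    have M0 : 0 < M by rewrite /M ltr_pwDr// !mulr_ge0 ?normc_ge0 ?hn_ge0.
    have e2 : 0 < e / 2 by lra.
    have [N1 N1P] := ux _ (divr_gt0 e2 M0).
    have [N2 N2P] := inv_small _ e2.
    pose j := maxn N1 N2.
    have := N1P j (leq_maxl _ _); have := N2P j (leq_maxr _ _).
    have := dle _ (WA _ _ (uW j) (WZ c _ Ww)); have := uJ j.
    rewrite /J hn_sqD lA ?lZ//; last exact: WZ.
    rewrite hnZ (dotC (c *: w)) cReJ dotZl cReD => h1 h2 h3 h4.
    have : complex.Re (c * dot w (u j)) <= complex.Re (c * dot w x) + normc c * hn w * (e / 2 / M).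
      have -> : complex.Re (c * dot w (u j)) = complex.Re (c * dot w x) + complex.Re (c * dot w (u j - x)).
        by rewrite dotDr dotNr -cReD -mulrDr addrCA subrr addr0.
      rewrite lerD2l (le_trans (le_trans (ler_norm _) (normc_Re _)))// normcM -mulrA.
      rewrite ler_wpM2l ?normc_ge0// (le_trans (dot_CS _ _))//.
      by rewrite ler_wpM2l ?hn_ge0.
    have : 2 * (normc c * hn w * (e / 2 / M)) <= e / 2.
      rewrite mulrA mulrCA ler_piMr ?(ltW e2)//.
      by rewrite ler_pdivrMr// mul1r /M lerDl.
    rewrite exprMn in h2; rewrite mulrBr cReD cReN => k1 k2.
    exact: (par_arith3 h1 h2 h3 k1 k2).
  apply/esym/eqP; rewrite -subr_eq0; set z := _ - _ in pos *.
  rewrite -normc_eq0; apply/eqP/le_anti; rewrite normc_ge0 andbT.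
  have {}pos (t : R) : 0 <= t -> 2 * t * normc z ^+ 2 <= t ^+ 2 * normc z ^+ 2 * hn w ^+ 2.
    move=> t0; have := pos ((- t)%:C * z^*).
    have -> : complex.Re ((- t)%:C * z^* * z) = - t * normc z ^+ 2.
      by rewrite -mulrA (mulrC z^*) -sqr_normcE -rmorphM.
    rewrite normcM normc_conj normc_real normrN exprMn (ger0_norm t0); lra.
  (* With [c = - t z^*] the variation reads [2 t |z|^2 <= t^2 |z|^2 |w|^2]; this [t] has
     [t |w|^2 <= 1], which leaves [t |z|^2 <= 0]. *)
  pose t := (1 + hn w ^+ 2)^-1.
  have h0 := sqr_ge0 (hn w); have z0 := sqr_ge0 (normc z).
  have t0 : 0 < t by rewrite invr_gt0; lra.
  have th : t * hn w ^+ 2 <= 1.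
    by rewrite mulrC ler_pdivrMr; lra.
  have := pos t (ltW t0).
  have -> : t ^+ 2 * normc z ^+ 2 * hn w ^+ 2 = t * normc z ^+ 2 * (t * hn w ^+ 2) by ring.
  move=> h; have : t * normc z ^+ 2 * (t * hn w ^+ 2) <= t * normc z ^+ 2.
    by rewrite ler_piMr// mulr_ge0// ltW.
  move=> h'; have : t * normc z ^+ 2 <= 0 by lra.
  by rewrite pmulr_rle0// => /(conj z0)/andP/le_anti/esym/eqP; rewrite sqrf_eq0 => /eqP ->.
exists x; split => //.
(* [lK] speaks of members of [W], so it is applied to the [u N] close to [x] instead of [x]. *)
- have [/hn_eq0 ->|x0] := eqVneq (hn x) 0; first by rewrite hn0.
  have xp : 0 < hn x by rewrite lt_neqAle eq_sym x0 hn_ge0.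
  rewrite -(@ler_pM2r _ (hn x))//; apply: le_small => e e0.
  have M0 : 0 < K + hn x + 1 by lra.
  have [N /(_ N (leqnn _)) uN] := ux _ (divr_gt0 e0 M0).
  have h1 : hn x * hn x <= normc (dot (u N) x) + hn (u N - x) * hn x.
    have -> : hn x * hn x = normc (dot x x) by rewrite dotff normc_real ger0_norm ?sqr_ge0.
    have -> : dot x x = dot (u N) x - dot (u N - x) x by rewrite dotDl dotNl opprB addrC subrK.
    by rewrite (le_trans (normc_leB _ _))// lerD2l dot_CS.
  have h2 : normc (dot (u N) x) <= K * hn (u N) by rewrite -lx// lK.
  have h3 : hn (u N) <= hn x + hn (u N - x).
    by have := hnD x (u N - x); rewrite addrC subrK.
  have h4 : hn (u N - x) * (K + hn x) <= e.
    apply: le_trans (ler_wpM2r _ uN) _; first by lra.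
    rewrite mulrAC -mulrA ler_piMr ?(ltW e0)// ler_pdivrMr// mul1r; lra.
  have := hn_ge0 (u N - x); nra.
- by move=> e e0; have [N uN] := ux _ e0; exists (u N) => //; exact: uN.
Qed.

End hilbert.

(** * Bounded measurable functions and their real and complex integrals *)

Section bounded_measurable.
Context {R : realType}.
Implicit Types (f g : R -> R) (F G : R -> R[i]).
Local Notation mu := (@lebesgue_measure R).

Lemma aeS (P Q : R -> Prop) : (forall x, P x -> Q x) ->
  {ae mu, forall x, P x} -> {ae mu, forall x, Q x}.
Proof. by move=> PQ; apply: filterS => //; exact: (ae_filter_ringOfSetsType mu). Qed.

Lemma aeS2 (P Q S : R -> Prop) : (forall x, P x -> Q x -> S x) ->
  {ae mu, forall x, P x} -> {ae mu, forall x, Q x} -> {ae mu, forall x, S x}.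
Proof.
move=> PQ; apply: filterS2 => //; exact: (ae_filter_ringOfSetsType mu).
Qed.

(** Both conditions are on the whole line: the class is stable under all the operations below, and
    integrability over any measurable set of finite measure is then automatic. *)
Definition bm f := measurable_fun [set: R] f /\ exists M, forall x, `|f x| <= M.

Lemma bm_cst (c : R) : bm (fun=> c).
Proof. by split; [exact: measurable_cst|exists `|c|]. Qed.

Lemma bmD f g : bm f -> bm g -> bm (fun x => f x + g x).
Proof.
move=> [mf [M fM]] [mg [N gN]]; split; first exact: measurable_funD.
by exists (M + N) => x; rewrite (le_trans (ler_normD _ _))// lerD.
Qed.

Lemma bmM f g : bm f -> bm g -> bm (fun x => f x * g x).
Proof.
move=> [mf [M fM]] [mg [N gN]]; split; first exact: measurable_funM.
by exists (M * N) => x; rewrite normrM ler_pM.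
Qed.

Lemma bmZ c f : bm f -> bm (fun x => c * f x).
Proof. by move=> bf; apply: bmM => //; exact: bm_cst. Qed.

Lemma bmN f : bm f -> bm (fun x => - f x).
Proof.
move=> [mf [M fM]]; split; first exact: (measurable_funN mf).
by exists M => x; rewrite normrN.
Qed.

Lemma bmB f g : bm f -> bm g -> bm (fun x => f x - g x).
Proof. by move=> bf bg; apply: bmD => //; exact: bmN. Qed.

Lemma bm_norm f : bm f -> bm (fun x => `|f x|).
Proof.
move=> [mf [M fM]]; split; first exact: (measurableT_comp (@normr_measurable R setT)).
by exists M => x; rewrite normr_id.
Qed.

Lemma bm_max f g : bm f -> bm g -> bm (fun x => Num.max (f x) (g x)).
Proof.
move=> [mf [M fM]] [mg [N gN]]; split; first exact: measurable_maxr.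
exists (Num.max M N) => x; rewrite /Num.max; case: ifP => _.
  by case: ifP => h //; rewrite (le_trans (gN x))// leNgt h.
by case: ifP => h //; rewrite (le_trans (fM x))// ltW.
Qed.

Lemma bm_comp_cont f (h : R -> R) : bm f -> continuous h ->
  (exists M, forall x, `|h (f x)| <= M) -> bm (fun x => h (f x)).
Proof.
move=> [mf _] ch hM; split => //.
by apply: (measurableT_comp (continuous_measurable_fun ch)).
Qed.

Lemma bm_sum (I : Type) (r : seq I) (f : I -> R -> R) :
  (forall i, bm (f i)) -> bm (fun x => \sum_(i <- r) f i x).
Proof.
move=> bf; elim: r => [|i r IH].
  by rewrite (_ : (fun _ => _) = fun=> 0); [exact: bm_cst|apply/funext => x; rewrite big_nil].
rewrite (_ : (fun x => _) = fun x => f i x + \sum_(i <- r) f i x); first exact: bmD.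
by apply/funext => x; rewrite big_cons.
Qed.

Lemma bm_indic (A : set R) : measurable A -> bm (\1_A : R -> R).
Proof.
move=> mA; split; first exact/measurable_indicP.
by exists 1 => x; rewrite indicE; case: (x \in A); rewrite ?normr1 ?normr0.
Qed.

Definition bmC F := bm (fun x => complex.Re (F x)) /\ bm (fun x => complex.Im (F x)).

Lemma bmCP F (M : R) : measurable_fun [set: R] (fun x => complex.Re (F x)) ->
  measurable_fun [set: R] (fun x => complex.Im (F x)) ->
  (forall x, normc (F x) <= M) -> bmC F.
Proof.
move=> mr mi FM; split; split => //; exists M => x; rewrite (le_trans _ (FM x))//.
  exact: normc_Re.
exact: normc_Im.
Qed.

Lemma bmC_cst c : bmC (fun=> c). Proof. by split; exact: bm_cst. Qed.

Lemma bmCD F G : bmC F -> bmC G -> bmC (fun x => F x + G x).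
Proof.
move=> [a b] [c d]; split.
  by under eq_fun do rewrite cReD; exact: bmD.
by under eq_fun do rewrite cImD; exact: bmD.
Qed.

Lemma bmCN F : bmC F -> bmC (fun x => - F x).
Proof.
move=> [a b]; split.
  by under eq_fun do rewrite cReN; exact: bmN.
by under eq_fun do rewrite cImN; exact: bmN.
Qed.

Lemma bmCB F G : bmC F -> bmC G -> bmC (fun x => F x - G x).
Proof. by move=> bF bG; apply: bmCD => //; exact: bmCN. Qed.

Lemma bmCM F G : bmC F -> bmC G -> bmC (fun x => F x * G x).
Proof.
move=> [a b] [c d]; split.
  by under eq_fun do rewrite cReM; apply: bmB; exact: bmM.
by under eq_fun do rewrite cImM; apply: bmD; exact: bmM.
Qed.

Lemma bmCJ F : bmC F -> bmC (fun x => (F x)^*).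
Proof.
move=> [a b]; split.
  by under eq_fun do rewrite cReJ.
by under eq_fun do rewrite cImJ; exact: bmN.
Qed.

Lemma bmC_real f : bm f -> bmC (fun x => (f x)%:C).
Proof. by move=> bf; split => //=; exact: bm_cst. Qed.

Lemma bmC_bound F : bmC F -> exists M, forall x, normc (F x) <= M.
Proof.
move=> [[_ [M FM]] [_ [N FN]]]; exists (M + N) => x.
by rewrite (le_trans (normc_ReIm _))// lerD.
Qed.

Lemma bmC_sum (I : Type) (r : seq I) (f : I -> R -> R[i]) :
  (forall i, bmC (f i)) -> bmC (fun x => \sum_(i <- r) f i x).
Proof.
move=> bf; split.
  by under eq_fun do rewrite Re_sum; apply: bm_sum => i; case: (bf i).
by under eq_fun do rewrite Im_sum; apply: bm_sum => i; case: (bf i).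
Qed.

Lemma bmC_normc2 F : bmC F -> bm (fun x => normc (F x) ^+ 2).
Proof.
move=> [a b]; under eq_fun do rewrite sqr_normcE' !expr2.
by apply: bmD; exact: bmM.
Qed.

Lemma bmC_normc F : bmC F -> bm (fun x => normc (F x)).
Proof.
move=> bF; have [M FM] := bmC_bound bF.
rewrite (_ : (fun x => _) = fun x => Num.sqrt (normc (F x) ^+ 2)); last first.
  by apply/funext => x; rewrite sqrtr_sqr ger0_norm// normc_ge0.
apply: (bm_comp_cont (bmC_normc2 bF)) => [|]; first exact: sqrt_continuous.
by exists M => x; rewrite sqrtr_sqr !ger0_norm ?normc_ge0.
Qed.

Section integral.
Variable D : set R.
Hypothesis mD : measurable D.
Hypothesis fD : (mu D < +oo)%E.
Local Notation I f := (\int[mu]_(x in D) f x).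

Lemma bm_integrable f : bm f -> mu.-integrable D (EFin \o f).
Proof.
move=> [mf [M fM]]; apply: measurable_bounded_integrable => //.
  exact: measurable_funS mf.
by exists M; split; [exact: num_real|move=> x Mx y _ /=; rewrite (le_trans (fM y))// ltW].
Qed.

Lemma ID f g : bm f -> bm g -> I (fun x => f x + g x) = I f + I g.
Proof. by move=> bf bg; rewrite RintegralD//; exact: bm_integrable. Qed.

Lemma IB f g : bm f -> bm g -> I (fun x => f x - g x) = I f - I g.
Proof. by move=> bf bg; rewrite RintegralB//; exact: bm_integrable. Qed.

Lemma IZ c f : bm f -> I (fun x => c * f x) = c * I f.
Proof. by move=> bf; rewrite RintegralZl//; exact: bm_integrable. Qed.

Lemma IN f : bm f -> I (fun x => - f x) = - I f.
Proof. by move=> bf; rewrite -mulN1r -IZ//; apply: eq_Rintegral => x _; rewrite mulN1r. Qed.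

Lemma Icst c : I (fun=> c) = c * fine (mu D).
Proof. exact: Rintegral_cst. Qed.

Lemma I_le f g : bm f -> bm g -> (forall x, D x -> f x <= g x) -> I f <= I g.
Proof. by move=> bf bg fg; apply: le_Rintegral => //; exact: bm_integrable. Qed.

Lemma I_norm f : bm f -> `|I f| <= I (fun x => `|f x|).
Proof. by move=> bf; apply: le_normr_Rintegral => //; exact: bm_integrable. Qed.

Lemma I_bound f M : bm f -> (forall x, D x -> `|f x| <= M) -> `|I f| <= M * fine (mu D).
Proof.
move=> bf fM; rewrite (le_trans (I_norm bf))// -Icst.
by apply: I_le => //; [exact: bm_norm|exact: bm_cst].
Qed.

Lemma I_ae f g : bm f -> bm g -> {ae mu, forall x, D x -> f x = g x} -> I f = I g.
Proof.
move=> [mf _] [mg _] fg; congr fine; apply: ae_eq_integral => //.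
- exact/measurable_EFinP/measurable_funTS.
- exact/measurable_EFinP/measurable_funTS.
- by apply: aeS fg => x + Dx => /(_ Dx) /= ->.
Qed.

Lemma I_dct (u : nat -> R -> R) f (M : R) : (forall n, bm (u n)) -> bm f ->
  (forall n x, `|u n x| <= M) ->
  {ae mu, forall x, D x -> (fun n => u n x) @ \oo --> f x} ->
  (fun n => I (u n)) @ \oo --> I f.
Proof.
move=> bu bf uM uf.
have [] := @dominated_convergence _ _ R mu D mD (fun n => EFin \o u n) (EFin \o f) (cst M%:E).
- by move=> n; apply/measurable_EFinP; apply: measurable_funTS; case: (bu n).
- by apply/measurable_EFinP; apply: measurable_funTS; case: bf.
- apply: aeS uf => x + Dx => /(_ Dx) h; apply: cvg_EFin => //; exact: nearW.
- exact: (bm_integrable (bm_cst M)).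
- by apply: aeW => x n _; rewrite lee_fin.
move=> _ _ h; apply: fine_cvg.
rewrite fineK//; apply: integrable_fin_num => //; exact: bm_integrable.
Qed.

Lemma cintE F : cintegral D F = I (fun x => complex.Re (F x)) +i* I (fun x => complex.Im (F x)).
Proof. by []. Qed.

Lemma eq_cint F G : (forall x, D x -> F x = G x) -> cintegral D F = cintegral D G.
Proof.
move=> FG; rewrite !cintE; congr (_ +i* _); apply: eq_Rintegral => x; rewrite inE => Dx;
by rewrite FG.
Qed.

Lemma cint_ae F G : bmC F -> bmC G -> {ae mu, forall x, D x -> F x = G x} ->
  cintegral D F = cintegral D G.
Proof.
move=> [a b] [c d] FG; rewrite !cintE; congr (_ +i* _); apply: I_ae => //;
by apply: aeS FG => x + Dx => /(_ Dx) ->.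
Qed.

Lemma cintD F G : bmC F -> bmC G ->
  cintegral D (fun x => F x + G x) = cintegral D F + cintegral D G.
Proof.
move=> [a b] [c d]; apply/complexP; rewrite ?cReD ?cImD /=.
  by under eq_Rintegral do rewrite cReD; rewrite ID.
by under eq_Rintegral do rewrite cImD; rewrite ID.
Qed.

Lemma cintZ c F : bmC F -> cintegral D (fun x => c * F x) = c * cintegral D F.
Proof.
move=> [a b]; apply/complexP; rewrite ?cReM ?cImM /=.
  by under eq_Rintegral do rewrite cReM; rewrite IB ?IZ//; exact: bmZ.
by under eq_Rintegral do rewrite cImM; rewrite ID ?IZ//; exact: bmZ.
Qed.

Lemma cintN F : bmC F -> cintegral D (fun x => - F x) = - cintegral D F.
Proof. by move=> bF; rewrite -mulN1r -cintZ//; apply: eq_cint => x _; rewrite mulN1r. Qed.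

Lemma cintB F G : bmC F -> bmC G ->
  cintegral D (fun x => F x - G x) = cintegral D F - cintegral D G.
Proof. by move=> bF bG; rewrite cintD ?cintN//; exact: bmCN. Qed.

Lemma cint_cst c : cintegral D (fun=> c) = c * (fine (mu D))%:C.
Proof.
by apply/complexP; rewrite /= !Icst; case: c => x y /=; rewrite !mulr0 ?subr0 ?add0r ?addr0 // mulrC.
Qed.

Lemma cintJ F : bmC F -> cintegral D (fun x => (F x)^*) = (cintegral D F)^*.
Proof.
move=> [a b]; apply/complexP; rewrite ?cReJ ?cImJ /=.
  by under eq_Rintegral do rewrite cReJ.
by under eq_Rintegral do rewrite cImJ; rewrite IN.
Qed.

Lemma cint_real f : cintegral D (fun x => (f x)%:C) = (I f)%:C.
Proof. by apply/complexP => //=; rewrite Icst mul0r. Qed.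

Lemma cint_norm F : bmC F -> normc (cintegral D F) <= I (fun x => normc (F x)).
Proof.
move=> bF; set z := cintegral D F.
have [z0|z0] := eqVneq (normc z) 0.
  by rewrite z0; apply: Rintegral_ge0 => x _; exact: normc_ge0.
(* Rotating by the unimodular [w] with [w z = |z|] turns the modulus of the integral into the
   integral of a real part. *)
pose w := z^* * ((normc z)^-1)%:C.
have w1 : normc w = 1.
  by rewrite normcM normc_conj normc_real ger0_norm ?invr_ge0 ?normc_ge0// divff.
have wz : w * z = (normc z)%:C.
  by rewrite /w mulrAC (mulrC z^*) -sqr_normcE -rmorphM expr2 mulfK.
have -> : normc z = complex.Re (cintegral D (fun x => w * F x)) by rewrite cintZ// -/z wz.
rewrite cintE/=; apply: I_le.
- by case: (bmCM (bmC_cst w) bF).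
- exact: bmC_normc.
- by move=> x _; rewrite (le_trans (ler_norm _))// (le_trans (normc_Re _))// normcM w1 mul1r.
Qed.

Lemma cint_bound F M : bmC F -> (forall x, D x -> normc (F x) <= M) ->
  normc (cintegral D F) <= M * fine (mu D).
Proof.
move=> bF FM; rewrite (le_trans (cint_norm bF))// -Icst.
by apply: I_le => //; [exact: bmC_normc|exact: bm_cst].
Qed.

Lemma cint_sum (J : Type) (r : seq J) (F : J -> R -> R[i]) : (forall i, bmC (F i)) ->
  cintegral D (fun x => \sum_(i <- r) F i x) = \sum_(i <- r) cintegral D (F i).
Proof.
move=> bF; elim: r => [|i r IH].
  rewrite (@eq_cint _ (fun=> 0)) => [|x _]; last by rewrite big_nil.
  by rewrite cint_cst mul0r big_nil.
rewrite big_cons -IH -cintD//; last exact: bmC_sum.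
by apply: eq_cint => x _; rewrite big_cons.
Qed.

End integral.
End bounded_measurable.

(** * The complex exponential, complex differentiability, integrals over intervals *)

Section complex_exponential.
Context {R : realType}.
Implicit Types (x y t : R) (z w h : R[i]).
Local Notation mu := (@lebesgue_measure R).

Lemma expiD x y : expi (x + y) = expi x * expi y.
Proof. by rewrite /expi cosD sinD; apply/complexP => /=; ring. Qed.

Lemma expi0 : expi 0 = 1 :> R[i].
Proof. by rewrite /expi cos0 sin0. Qed.

Lemma expiN x : expi (- x) = (expi x)^*.
Proof. by rewrite /expi cosN sinN. Qed.

Lemma normc_expi x : normc (expi x) = 1.
Proof. by rewrite /= cos2Dsin2 sqrtr1. Qed.

Lemma expi_neq0 x : expi x != 0.
Proof. by rewrite -normc_eq0 normc_expi oner_neq0. Qed.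

Lemma expiNV x : expi (- x) = (expi x)^-1.
Proof.
by apply: (mulfI (expi_neq0 x)); rewrite -expiD subrr expi0 divff// expi_neq0.
Qed.

Lemma expiMn x n : expi (n%:R * x) = expi x ^+ n.
Proof.
elim: n => [|n IH]; first by rewrite mul0r expi0 expr0.
by rewrite -natr1 mulrDl mul1r expiD IH exprSr.
Qed.

Lemma expi2pi : expi (2 * pi) = 1 :> R[i].
Proof. by rewrite /expi mulr_natl cos2pi sin2pi. Qed.

Lemma cexpD z w : cexp (z + w) = cexp z * cexp w.
Proof.
by rewrite /cexp cReD cImD expRD expiD rmorphM/=; ring.
Qed.

Lemma cexp0 : cexp 0 = 1 :> R[i].
Proof. by rewrite /cexp/= expR0 expi0 mul1r. Qed.

Lemma normc_cexp z : normc (cexp z) = expR (complex.Re z).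
Proof. by rewrite /cexp normcM normc_expi mulr1 normc_real ger0_norm// expR_ge0. Qed.

Lemma cexp_neq0 z : cexp z != 0.
Proof. by rewrite -normc_eq0 normc_cexp gt_eqF// expR_gt0. Qed.

Lemma cexpN z : cexp (- z) = (cexp z)^-1.
Proof.
by apply: (mulfI (cexp_neq0 z)); rewrite -cexpD subrr cexp0 divff// cexp_neq0.
Qed.

Lemma cexpMn z n : cexp (n%:R * z) = cexp z ^+ n.
Proof.
elim: n => [|n IH]; first by rewrite mul0r cexp0 expr0.
by rewrite -natr1 mulrDl mul1r cexpD IH exprSr.
Qed.

Lemma cexp_polar x y : cexp (x +i* y) = (expR x)%:C * expi y.
Proof. by []. Qed.

Lemma is_derive_eps (f : R -> R) x (l : R) : is_derive x 1 f l -> forall e, 0 < e ->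
  exists2 d, 0 < d & forall h : R, `|h| < d -> `|f (x + h) - f x - l * h| <= e * `|h|.
Proof.
move=> [df dl] e e0.
have : (fun h : R => h^-1 *: ((f \o shift x) (h *: (1 : R)) - f x)) @ 0^' --> l.
  by rewrite -dl; exact: df.
move=> /cvgrPdist_le/(_ _ e0)[d d0 hd]; exists d => // h hh.
have [->|h0] := eqVneq h 0.
  by rewrite addr0 subrr mulr0 subrr normr0 mulr0.
have := hd h; rewrite /ball_/= sub0r normrN => /(_ hh h0).
rewrite /GRing.scale/= mulr1 => H.
have -> : f (x + h) - f x - l * h = - ((l - h^-1 * (f (h + x) - f x)) * h).
  by rewrite mulrBl mulrAC mulVf// mul1r (addrC h) opprB.
by rewrite normrN normrM ler_wpM2r.
Qed.

(** [A], [c], [s] stand for [exp X], [cos Y], [sin Y], each known to first order; the two terms of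
    the conclusion are the real and imaginary parts of [exp h - 1 - h]. *)
Lemma exp_remainder_arith (A c s X Y N e e1 : R) : e1 <= 1 -> e1 <= e / 10 ->
  N < e1 -> `|X| <= N -> `|Y| <= N ->
  `|A - 1 - X| <= e1 * `|X| -> `|c - 1| <= e1 * `|Y| -> `|s - Y| <= e1 * `|Y| ->
  `|A * c - 1 - X| + `|A * s - Y| <= e * N.
Proof.
move=> e11 e1e Ne XN YN hA hc hs.
have N0 : 0 <= N by exact: le_trans XN.
have e10 : 0 <= e1 by lra.
have hA' : `|A - 1 - X| <= e1 * N by rewrite (le_trans hA)// ler_wpM2l.
have hc' : `|c - 1| <= e1 * N by rewrite (le_trans hc)// ler_wpM2l.
have hs' : `|s - Y| <= e1 * N by rewrite (le_trans hs)// ler_wpM2l.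
have A1 : `|A - 1| <= 2 * N.
  have -> : A - 1 = (A - 1 - X) + X by rewrite subrK.
  rewrite (le_trans (ler_normD _ _))//.
  have : e1 * N <= 1 * N by rewrite ler_wpM2r.
  lra.
have A3 : `|A| <= 3.
  have -> : A = (A - 1) + 1 by rewrite subrK.
  rewrite (le_trans (ler_normD _ _))// normr1; lra.
have p1 : `|A * c - 1 - X| <= e1 * N + 3 * (e1 * N).
  have -> : A * c - 1 - X = (A - 1 - X) + A * (c - 1) by ring.
  by rewrite (le_trans (ler_normD _ _))// lerD// normrM ler_pM.
have p2 : `|A * s - Y| <= 3 * (e1 * N) + (2 * N) * N.
  have -> : A * s - Y = A * (s - Y) + (A - 1) * Y by ring.
  by rewrite (le_trans (ler_normD _ _))// lerD// normrM ler_pM.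
have p3 : N * N <= e1 * N by rewrite ler_wpM2r// ltW.
have p4 : e1 * N <= e / 10 * N by rewrite ler_wpM2r.
have : 10 * (e1 * N) <= e * N by lra.
have : 0 <= e1 * N by rewrite mulr_ge0.
lra.
Qed.

Lemma cexp_eps0 (e : R) : 0 < e -> exists2 d, 0 < d &
  forall h, normc h < d -> normc (cexp h - 1 - h) <= e * normc h.
Proof.
move=> e0.
have [e1 [e10 e11 e1e]] : exists e1, [/\ 0 < e1, e1 <= 1 & e1 <= e / 10].
  exists (Num.min 1 (e / 10)).
  by rewrite lt_min ltr01 divr_gt0// !ge_min !lexx ?orbT.
have [d1 d10 D1] := is_derive_eps (is_derive_expR (0 : R)) e10.
have [d2 d20 D2] := is_derive_eps (is_derive_cos (0 : R)) e10.
have [d3 d30 D3] := is_derive_eps (is_derive_sin (0 : R)) e10.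
exists (Num.min (Num.min d1 d2) (Num.min d3 e1)).
  by rewrite !lt_min d10 d20 d30 e10.
move=> h; rewrite !lt_min => /andP[/andP[h1 h2] /andP[h3 h4]].
have := D1 _ (le_lt_trans (normc_Re h) h1).
have := D2 _ (le_lt_trans (normc_Im h) h2).
have := D3 _ (le_lt_trans (normc_Im h) h3).
rewrite !add0r expR0 cos0 sin0 oppr0 mul0r !mul1r !subr0 => k3 k2 k1.
apply: le_trans (normc_ReIm _) _.
rewrite !cReD !cImD !cReN !cImN cReM cImM/= !mul0r !subr0 !addr0.
rewrite addr0 in k3. exact: exp_remainder_arith e11 e1e h4 (normc_Re h) (normc_Im h) k1 k2 k3.
Qed.

Lemma cderivable_cexp z : cderivable cexp z.
Proof.
apply/cderivableP; exists (cexp z) => e e0.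
have c0 : 0 < normc (cexp z) by rewrite normc_gt0 cexp_neq0.
have [d d0 hd] := cexp_eps0 (divr_gt0 e0 c0); exists d => // h hh.
have -> : cexp (z + h) - cexp z - cexp z * h = cexp z * (cexp h - 1 - h).
  by rewrite cexpD; ring.
by rewrite normcM mulrC -ler_pdivlMr// mulrAC hd.
Qed.

Section regular_calculus.
Implicit Types (F G : R[i]^o -> R[i]^o) (u : R[i]^o).

Let comp_reg F G u : derivable F u 1 -> derivable G (F u) 1 -> derivable (G \o F) u 1.
Proof.
move=> /derivable1_diffP hf /derivable1_diffP hg; apply/derivable1_diffP.
exact (@differentiable_comp _ _ _ _ F G u hf hg).
Qed.

Let mul_reg F G u : derivable F u 1 -> derivable G u 1 ->
  derivable ((fun v : R[i]^o => F v * G v) : R[i]^o -> R[i]^o) u 1.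
Proof. move=> hf hg; exact (@derivableM _ R[i]^o F G u 1 hf hg). Qed.

Let add_reg F G u : derivable F u 1 -> derivable G u 1 ->
  derivable ((fun v : R[i]^o => F v + G v) : R[i]^o -> R[i]^o) u 1.
Proof. move=> hf hg; exact (@derivableD _ R[i]^o R[i]^o F G u 1 hf hg). Qed.

Let inv_reg F u : F u != 0 -> derivable F u 1 ->
  derivable ((fun v : R[i]^o => (F v)^-1) : R[i]^o -> R[i]^o) u 1.
Proof. move=> h0 hf; exact (@derivableV _ R[i]^o F u 1 h0 hf). Qed.

Let id_reg u : derivable (id : R[i]^o -> R[i]^o) u 1.
Proof. exact (@derivable_id _ R[i]^o u 1). Qed.

Let cst_reg (c : R[i]^o) u : derivable ((fun=> c) : R[i]^o -> R[i]^o) u 1.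
Proof. exact (@derivable_cst _ R[i]^o R[i]^o c u 1). Qed.

Let cont_reg F u : derivable F u 1 -> {for u, continuous F}.
Proof. by move=> /derivable1_diffP/differentiable_continuous. Qed.

Lemma cderivable_comp (f g : R[i] -> R[i]) z : cderivable f z -> cderivable g (f z) ->
  cderivable (fun w => g (f w)) z.
Proof. exact: comp_reg. Qed.

Lemma cderivableM (f g : R[i] -> R[i]) z : cderivable f z -> cderivable g z ->
  cderivable (fun w => f w * g w) z.
Proof. exact: mul_reg. Qed.

Lemma cderivableD (f g : R[i] -> R[i]) z : cderivable f z -> cderivable g z ->
  cderivable (fun w => f w + g w) z.
Proof. exact: add_reg. Qed.

Lemma cderivableV (f : R[i] -> R[i]) z : f z != 0 -> cderivable f z ->
  cderivable (fun w => (f w)^-1) z.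
Proof. exact: inv_reg. Qed.

Lemma cderivable_id z : cderivable (fun w => w) z.
Proof. exact: id_reg. Qed.

Lemma cderivable_cst c z : cderivable (fun=> c) z.
Proof. exact: cst_reg. Qed.

Lemma cderivable_cont (f : R[i] -> R[i]) z : cderivable f z ->
  {for z, continuous (f : R[i]^o -> R[i]^o)}.
Proof. exact: cont_reg. Qed.

End regular_calculus.

Lemma cderivableX (F : R[i] -> R[i]) z n : cderivable F z ->
  cderivable (fun w => F w ^+ n) z.
Proof.
move=> hF; elim: n => [|n IH]; first by under eq_fun do rewrite expr0; exact: cderivable_cst.
by under eq_fun do rewrite exprS; exact: cderivableM.
Qed.

Lemma cderivable_cont_eps (F : R[i] -> R[i]) z (e : R) : cderivable F z -> 0 < e ->
  exists2 d : R, 0 < d & forall w, normc (w - z) < d -> normc (F w - F z) < e.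
Proof.
move=> /cderivable_cont/cvg_normcP/cvgrPdist_lt/(_ _) H e0.
have [[d y]] := H _ e0; rewrite /= ltcE => /andP[/eqP/= y0 d0] B; subst y.
exists d => // w wz.
have hd2 : `|z - w| < d%:C by rewrite normrC_lt normcB.
have := B w; rewrite /ball_/= => /(_ hd2).
by rewrite sub0r normrN ger0_norm ?normc_ge0.
Qed.

Lemma Ix_FTC (f F : R -> R) a b : a <= b -> continuous f ->
  (forall x, is_derive x 1 F (f x)) ->
  \int[mu]_(x in `[a, b]) f x = F b - F a.
Proof.
rewrite le_eqVlt => /predU1P[->|ab] cf dF.
  by rewrite subrr set_itv1 Rintegral_set1.
have cF : continuous F.
  by move=> x; apply/differentiable_continuous/derivable1_diffP; case: (dF x).
rewrite /Rintegral (@continuous_FTC2 _ f F a b ab).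
- by rewrite -EFinB.
- exact: continuous_subspaceT.
- split.
  + by move=> x _; case: (dF x).
  + exact: (cvg_at_right_filter (cF a)).
  + exact: (cvg_at_left_filter (cF b)).
- by move=> x _; rewrite derive1E; case: (dF x).
Qed.

Lemma fin_itv (a b : R) : (mu `[a, b] < +oo)%E.
Proof. by rewrite lebesgue_measure_itv/=; case: ifP => _; rewrite ?ltry// -EFinB ltry. Qed.

Lemma Ix_split (f : R -> R) a m b : bm f -> a <= m -> m <= b ->
  \int[mu]_(x in `[a, b]) f x = \int[mu]_(x in `[a, m]) f x + \int[mu]_(x in `[m, b]) f x.
Proof.
move=> bf am mb.
have i1 c d : mu.-integrable `[c, d] (EFin \o f).
  by apply: bm_integrable => //; exact: fin_itv.
rewrite -(@Rintegral_itv_obnd_cbnd _ m _ f).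
  have h := @Rintegral_itvB _ f (BLeft a) (BRight b) m (i1 a b).
  rewrite !bnd_simp in h; by rewrite -(h am mb) addrC subrK.
apply: (integrableS _ _ _ (i1 m b)) => //; exact: subset_itv_oc_cc.
Qed.

(** Composing with it turns a function continuous on [[a, b]] only into a bounded measurable one on
    the line, without changing its integrals over [[a, b]]. *)
Definition clampR a b x : R := Num.max a (Num.min b x).

Lemma clampR_id a b x : a <= x <= b -> clampR a b x = x.
Proof.
by move=> /andP[ax xb]; rewrite /clampR (min_idPr xb) (max_idPr ax).
Qed.

Lemma clampR_itv a b x : a <= b -> a <= clampR a b x <= b.
Proof. by move=> ab; rewrite /clampR le_max lexx/= ge_max ab ge_min lexx. Qed.

Lemma continuous_clampR a b : continuous (clampR a b).
Proof.
move=> x; apply: (@continuous_max _ R^o (cst a) (fun x => Num.min b x)); first exact: cst_continuous.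
by apply: (@continuous_min _ R^o (cst b) id); [exact: cst_continuous|exact: cvg_id].
Qed.

Lemma bm_clamp (f : R -> R) a b : a <= b -> (forall x, a <= x <= b -> {for x, continuous f}) ->
  bm (fun x => f (clampR a b x)).
Proof.
move=> ab cf.
have cfc : continuous (fun x => f (clampR a b x)).
  move=> x; apply: (@continuous_comp _ _ _ (clampR a b) f); first exact: continuous_clampR.
  by apply: cf; exact: clampR_itv.
split; first exact: continuous_measurable_fun.
have cw : {within `[a, b], continuous (fun x => f (clampR a b x))}.
  exact: continuous_subspaceT.
have cw2 : {within `[a, b], continuous (fun x => - f (clampR a b x))}.
  by apply: continuous_subspaceT => x; apply: cvgN; exact: cfc.
have [c _ M1] := EVT_max ab cw; have [d _ M2] := EVT_max ab cw2.
exists (Num.max (f (clampR a b c)) (- f (clampR a b d))) => x.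
have xi : clampR a b x \in `[a, b] by rewrite in_itv/= clampR_itv.
have e : clampR a b (clampR a b x) = clampR a b x by rewrite clampR_id// clampR_itv.
have := M1 _ xi; have := M2 _ xi; rewrite e => h2 h1.
by rewrite ler_norml le_max h1/= lerNl le_max h2 orbT.
Qed.

End complex_exponential.

(** * Goursat's theorem on rectangles *)

Section goursat.
Context {R : realType}.
Implicit Types (x y t : R) (z w h : R[i]).
Local Notation mu := (@lebesgue_measure R).

Lemma eq_I (D : set R) (f g : R -> R) : (forall x, D x -> f x = g x) ->
  \int[mu]_(x in D) f x = \int[mu]_(x in D) g x.
Proof. by move=> fg; apply: eq_Rintegral => x; rewrite inE => /fg. Qed.

Lemma mu_itv (a b : R) : a <= b -> fine (mu `[a, b]) = b - a.
Proof.
rewrite lebesgue_measure_itv/= lte_fin le_eqVlt => /predU1P[->|->] //.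
by rewrite ltxx subrr.
Qed.

Lemma normcD4 (z1 z2 z3 z4 : R[i]) :
  normc (z1 + z2 + z3 + z4) <= normc z1 + normc z2 + normc z3 + normc z4.
Proof.
apply: le_trans (normcD _ _) _; rewrite lerD2r.
apply: le_trans (normcD _ _) _; rewrite lerD2r.
exact: normcD.
Qed.

Lemma pigeonhole4 (x b1 b2 b3 b4 : R) : x <= b1 + b2 + b3 + b4 ->
  4 * b1 < x -> 4 * b2 < x -> 4 * b3 < x -> x <= 4 * b4.
Proof. lra. Qed.

Lemma dist_arith (a s x w : R) : a <= x <= a + s -> a <= w <= a + s -> `|w + - x| <= s.
Proof. by move=> /andP[? ?] /andP[? ?]; rewrite ler_norml; lra. Qed.

Lemma sum4_arith (n1 n2 n3 n4 a b : R) : n3 <= b -> n4 <= b -> n1 <= a -> n2 <= a ->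
  n1 + n2 + (n3 + n4) <= 2 * (a + b).
Proof. lra. Qed.

Lemma cplxE (x y : R) : x +i* y = x%:C + 'i * y%:C.
Proof. by apply/complexP => /=; ring. Qed.

Lemma cint_split (f : R -> R[i]) a m b : bmC f -> a <= m -> m <= b ->
  cintegral `[a, b] f = cintegral `[a, m] f + cintegral `[m, b] f.
Proof.
move=> [br bi] am mb; apply/complexP; rewrite ?cReD ?cImD /=.
  by rewrite (Ix_split br am mb).
by rewrite (Ix_split bi am mb).
Qed.

Lemma cint_affine (al be : R[i]) a b : a <= b ->
  cintegral `[a, b] (fun x => al + be * x%:C) =
  al * (b - a)%:C + be * ((b ^+ 2 - a ^+ 2) / 2)%:C.
Proof.
move=> ab.
have cid : continuous (fun x : R => x) by move=> x; exact: cvg_id.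
have bid : bm (clampR a b) by apply: (@bm_clamp _ (fun x => x)) => // x _; exact: cid.
rewrite (@eq_cint _ _ _ (fun x => al + be * (clampR a b x)%:C)); last first.
  by move=> x; rewrite /= in_itv/= => xi; rewrite clampR_id.
have mi := measurable_itv `[a, b].
rewrite cintD ?cintZ ?cint_cst ?cint_real//; try exact: fin_itv.
- rewrite mu_itv//; congr (_ + _ * _%:C).
  rewrite (@eq_I _ _ (fun x => x)); last first.
    by move=> x; rewrite /= in_itv/= => xi; rewrite clampR_id.
  have d (x : R) : is_derive x 1 (fun x : R => x ^+ 2 / 2) x.
    have h := is_deriveZ (2^-1) (is_deriveM (is_derive_id x (1 : R)) (is_derive_id x (1 : R))).
    rewrite (_ : (fun x : R => _) = 2^-1 *: (id * id : R -> R)).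
      by apply: (is_derive_eq h); rewrite /GRing.scale/=; field.
    by apply/funext => x'; rewrite expr2 mulrC.
  by rewrite (Ix_FTC ab cid d) mulrBl.
- exact: bmC_real.
- exact: bmC_cst.
- by apply: bmCM; [exact: bmC_cst|exact: bmC_real].
Qed.

Variables (g : R[i] -> R[i]).
Hypothesis gx : forall y, bmC (fun x => g (x +i* y)).
Hypothesis gy : forall x, bmC (fun y => g (x +i* y)).

Definition hor y a b := cintegral `[a, b] (fun x => g (x +i* y)).
Definition ver x c d := cintegral `[c, d] (fun y => g (x +i* y)).
(** The counterclockwise integral of [g(z) dz] along the boundary; the factor ['i] comes from
    [dz = i dy] on the vertical sides. *)
Definition bdry a b c d := hor c a b - hor d a b + 'i * (ver b c d - ver a c d).

Lemma bdry_split a m b c n d : a <= m -> m <= b -> c <= n -> n <= d ->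
  bdry a b c d = bdry a m c n + bdry m b c n + bdry a m n d + bdry m b n d.
Proof.
move=> am mb cn nd; rewrite /bdry /hor /ver.
rewrite (cint_split (gx c) am mb) (cint_split (gx d) am mb).
rewrite (cint_split (gy a) cn nd) (cint_split (gy b) cn nd); ring.
Qed.

Variables (a0 c0 L M : R).
Hypotheses (L0 : 0 <= L) (M0 : 0 <= M).
(** Only points of the closed rectangle are compared, because the theorem is applied to a function
    that is clamped outside it. *)
Hypothesis gd : forall w, a0 <= complex.Re w <= a0 + L ->
  c0 <= complex.Im w <= c0 + M ->
  exists l : R[i], forall e : R, 0 < e -> exists2 d : R, 0 < d &
    forall w', a0 <= complex.Re w' <= a0 + L -> c0 <= complex.Im w' <= c0 + M ->
    normc (w' - w) < d ->
    normc (g w' - g w - l * (w' - w)) <= e * normc (w' - w).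

Definition sideL k := L / 2 ^+ k.
Definition sideM k := M / 2 ^+ k.
Lemma sideL_ge0 k : 0 <= sideL k. Proof. by rewrite divr_ge0// exprn_ge0. Qed.
Lemma sideM_ge0 k : 0 <= sideM k. Proof. by rewrite divr_ge0// exprn_ge0. Qed.
Lemma sideLS k : sideL k = sideL k.+1 + sideL k.+1.
Proof. by rewrite /sideL exprS; have : 2 ^+ k != 0 :> R; [rewrite expf_neq0|move=> ?; field]. Qed.
Lemma sideMS k : sideM k = sideM k.+1 + sideM k.+1.
Proof. by rewrite /sideM exprS; have : 2 ^+ k != 0 :> R; [rewrite expf_neq0|move=> ?; field]. Qed.

Definition bdry_dyadic k (p : R * R) := normc (bdry p.1 (p.1 + sideL k) p.2 (p.2 + sideM k)).

Lemma bdry_dyadicE k a c : bdry_dyadic k (a, c) =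
  normc (bdry a (a + sideL k) c (c + sideM k)).
Proof. by []. Qed.

(** The boundary integral is the sum of those over the four quarters, so one quarter carries at
    least a fourth of its modulus. *)
Lemma bdry_step k p : exists p' : R * R, [/\ p.1 <= p'.1, p'.1 + sideL k.+1 <= p.1 + sideL k,
  p.2 <= p'.2 & p'.2 + sideM k.+1 <= p.2 + sideM k] /\ bdry_dyadic k p <= 4 * bdry_dyadic k.+1 p'.
Proof.
have ss := sideL_ge0 k.+1; have tt := sideM_ge0 k.+1.
have := sideLS k; have := sideMS k => hT hS.
case: p => a c /=.
have f1 : a + sideL k.+1 <= a + sideL k by lra.
have f2 : a + sideL k.+1 + sideL k.+1 <= a + sideL k by lra.
have f3 : a <= a + sideL k.+1 by lra.
have f4 : c + sideM k.+1 <= c + sideM k by lra.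
have f5 : c + sideM k.+1 + sideM k.+1 <= c + sideM k by lra.
have f6 : c <= c + sideM k.+1 by lra.
have E : bdry_dyadic k (a, c) <= bdry_dyadic k.+1 (a, c) + bdry_dyadic k.+1 (a + sideL k.+1, c) +
   bdry_dyadic k.+1 (a, c + sideM k.+1) + bdry_dyadic k.+1 (a + sideL k.+1, c + sideM k.+1).
  have hS' : a + sideL k = a + sideL k.+1 + sideL k.+1 by rewrite hS addrA.
  have hT' : c + sideM k = c + sideM k.+1 + sideM k.+1 by rewrite hT addrA.
  rewrite !bdry_dyadicE hS' hT' (@bdry_split a (a + sideL k.+1) _ c (c + sideM k.+1)) ?lerDl//.
  exact: normcD4.
have [h1|h1] := leP (bdry_dyadic k (a, c)) (4 * bdry_dyadic k.+1 (a, c)).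
  by exists (a, c); split; [split|exact: h1].
have [h2|h2] := leP (bdry_dyadic k (a, c)) (4 * bdry_dyadic k.+1 (a + sideL k.+1, c)).
  by exists (a + sideL k.+1, c); split; [split|exact: h2].
have [h3|h3] := leP (bdry_dyadic k (a, c)) (4 * bdry_dyadic k.+1 (a, c + sideM k.+1)).
  by exists (a, c + sideM k.+1); split; [split|exact: h3].
exists (a + sideL k.+1, c + sideM k.+1); split; first by split.
exact: pigeonhole4 E h1 h2 h3.
Qed.

Lemma goursat_rectangle : bdry a0 (a0 + L) c0 (c0 + M) = 0.
Proof.
have [nx nxP] := choice (fun kp : nat * (R * R) => bdry_step kp.1 kp.2).
pose p := fix p k : R * R := if k is k'.+1 then nx (k', p k') else (a0, c0).
have pS k : [/\ (p k).1 <= (p k.+1).1, (p k.+1).1 + sideL k.+1 <= (p k).1 + sideL k,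
  (p k).2 <= (p k.+1).2 & (p k.+1).2 + sideM k.+1 <= (p k).2 + sideM k] /\
   bdry_dyadic k (p k) <= 4 * bdry_dyadic k.+1 (p k.+1) by exact: (nxP (k, p k)).
have nd1 : nondecreasing_seq (fun k => (p k).1).
  by apply/nondecreasing_seqP => k; have [[]] := pS k.
have nd2 : nondecreasing_seq (fun k => (p k).2).
  by apply/nondecreasing_seqP => k; have [[]] := pS k.
have ni1 : nonincreasing_seq (fun k => (p k).1 + sideL k).
  by apply/nonincreasing_seqP => k; have [[]] := pS k.
have ni2 : nonincreasing_seq (fun k => (p k).2 + sideM k).
  by apply/nonincreasing_seqP => k; have [[]] := pS k.
have ub1 j k : (p j).1 <= (p k).1 + sideL k.
  have [jk|kj] := leqP j k; first by rewrite (le_trans (nd1 _ _ jk))// lerDl sideL_ge0.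
  by apply: le_trans (ni1 _ _ (ltnW kj)); rewrite lerDl sideL_ge0.
have ub2 j k : (p j).2 <= (p k).2 + sideM k.
  have [jk|kj] := leqP j k; first by rewrite (le_trans (nd2 _ _ jk))// lerDl sideM_ge0.
  by apply: le_trans (ni2 _ _ (ltnW kj)); rewrite lerDl sideM_ge0.
have c1 : cvgn (fun k => (p k).1 : R).
  by apply: nondecreasing_is_cvgn => //; exists ((p 0%N).1 + sideL 0) => _ [k _ <-].
have c2 : cvgn (fun k => (p k).2 : R).
  by apply: nondecreasing_is_cvgn => //; exists ((p 0%N).2 + sideM 0) => _ [k _ <-].
(* Lower left corners increase and stay below all upper right ones, so [x +i* y] lies in every
   rectangle of the sequence. *)
pose x := limn (fun k => (p k).1 : R); pose y := limn (fun k => (p k).2 : R).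
have xk k : (p k).1 <= x <= (p k).1 + sideL k.
  by rewrite (nondecreasing_cvgn_le nd1 c1)/=; apply: limr_le => //; apply: nearW.
have yk k : (p k).2 <= y <= (p k).2 + sideM k.
  by rewrite (nondecreasing_cvgn_le nd2 c2)/=; apply: limr_le => //; apply: nearW.
have s0 : sideL 0 = L by rewrite /sideL expr0 divr1.
have t0 : sideM 0 = M by rewrite /sideM expr0 divr1.
have in1 k : a0 <= (p k).1 /\ (p k).1 + sideL k <= a0 + L.
  by split; [exact: (nd1 _ _ (leq0n k))|have := ni1 _ _ (leq0n k); rewrite s0].
have in2 k : c0 <= (p k).2 /\ (p k).2 + sideM k <= c0 + M.
  by split; [exact: (nd2 _ _ (leq0n k))|have := ni2 _ _ (leq0n k); rewrite t0].
have b4 k : bdry_dyadic 0 (a0, c0) <= 4 ^+ k * bdry_dyadic k (p k).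
  elim: k => [|k IH]; first by rewrite expr0 mul1r.
  rewrite (le_trans IH)// exprSr -mulrA ler_wpM2l ?exprn_ge0//.
  by case: (pS k).
apply/eqP; rewrite -normc_eq0; apply/eqP/le_anti; rewrite normc_ge0 andbT.
have -> : normc (bdry a0 (a0 + L) c0 (c0 + M)) = bdry_dyadic 0 (a0, c0).
  by rewrite bdry_dyadicE s0 t0.
have [||l lP] := gd (w := x +i* y) => /=.
  by have := xk 0%N; rewrite s0.
  by have := yk 0%N; rewrite t0.
(* Half the perimeter. At stage [k] an error [e sg] is integrated over a boundary of length [2 sg],
   with [sg = S / 2^k]; multiplying by [4^k] gives [e * 2 S^2]. *)
pose S := L + M.
suff main e : 0 < e -> bdry_dyadic 0 (a0, c0) <= e * (2 * S ^+ 2).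
  apply/ler_addgt0Pl => e e0; rewrite addr0.
  have S0 : 0 < 2 * S ^+ 2 + 1 by have := sqr_ge0 S; lra.
  apply: le_trans (main _ (divr_gt0 e0 S0)) _.
  rewrite -mulrA ler_piMr ?(ltW e0)// mulrC ler_pdivrMr// mul1r; lra.
move=> e0; have [d d0 dP] := lP _ e0.
have [k kP] : exists k, sideL k + sideM k < d.
  have : (fun k => S / 2 ^+ k) @ \oo --> (0 : R).
    rewrite -[X in _ --> X](mulr0 S); apply: cvgMl_tmp.
    under eq_fun do rewrite -exprVn; apply: cvg_expr.
    by rewrite ger0_norm ?invr_ge0// invf_lt1// ltr1n.
  move=> /cvgrPdist_lt/(_ _ d0)[k _ /(_ k (leqnn k))] /=.
  rewrite sub0r normrN ger0_norm; last by rewrite divr_ge0 ?addr_ge0 ?exprn_ge0.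
  by exists k; rewrite /sideL /sideM -mulrDl.
pose A := (p k).1; pose C := (p k).2; pose sg := sideL k + sideM k.
have sg0 : 0 <= sg by rewrite addr_ge0 ?sideL_ge0 ?sideM_ge0.
pose al := g (x +i* y) - l * (x +i* y).
have err w : A <= complex.Re w <= A + sideL k -> C <= complex.Im w <= C + sideM k ->
    normc (g w - (al + l * w)) <= e * sg.
  move=> wA wC.
  have h1 : normc (w - (x +i* y)) <= sg.
    rewrite (le_trans (normc_ReIm _))// cReD cImD cReN cImN/= /sg.
    by apply: lerD; [exact: dist_arith (xk k) wA|exact: dist_arith (yk k) wC].
  have -> : g w - (al + l * w) = g w - g (x +i* y) - l * (w - (x +i* y)).
    by rewrite /al; ring.
  have [i1 i2] := in1 k; have [i3 i4] := in2 k.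
  apply: le_trans (dP w _ _ (le_lt_trans h1 kP)) _.
  - by move: wA => /andP[k1 k2]; rewrite (le_trans i1 k1) (le_trans k2 i2).
  - by move: wC => /andP[k1 k2]; rewrite (le_trans i3 k1) (le_trans k2 i4).
  - by rewrite ler_wpM2l// ltW.
have As : A <= A + sideL k by rewrite lerDl sideL_ge0.
have Cs : C <= C + sideM k by rewrite lerDl sideM_ge0.
have Ab : A + sideL k - A = sideL k by rewrite addrAC subrr add0r.
have Cb : C + sideM k - C = sideM k by rewrite addrAC subrr add0r.
(* the first order Taylor polynomial integrates to zero over the boundary *)
pose P := (((A + sideL k) ^+ 2 - A ^+ 2) / 2)%:C : R[i].
pose Q := (((C + sideM k) ^+ 2 - C ^+ 2) / 2)%:C : R[i].
have hE y' : C <= y' <= C + sideM k ->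
    normc (hor y' A (A + sideL k) - ((al + l * ('i * y'%:C)) * (sideL k)%:C + l * P)) <= e * sg * sideL k.
  move=> y'C; have aff := cint_affine (al + l * ('i * y'%:C)) l As.
  rewrite Ab -/P in aff; rewrite -aff /hor.
  have cid : continuous (fun x : R => x) by move=> x'; exact: cvg_id.
  have bid : bm (clampR A (A + sideL k)).
    by apply: (@bm_clamp _ (fun x => x)) => // x' _; exact: cid.
  rewrite (@eq_cint _ _ (fun x => al + l * ('i * y'%:C) + l * x%:C)
     (fun x => al + l * ('i * y'%:C) + l * (clampR A (A + sideL k) x)%:C)); last first.
    by move=> x'; rewrite /= in_itv/= => xi; rewrite clampR_id.
  have ba : bmC (fun x => al + l * ('i * y'%:C) + l * (clampR A (A + sideL k) x)%:C).
    by apply: bmCD; [exact: bmC_cst|apply: bmCM; [exact: bmC_cst|exact: bmC_real]].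
  rewrite -cintB//; last exact: fin_itv.
  rewrite -[X in _ <= _ * X]Ab -mu_itv//; apply: cint_bound => //; first exact: fin_itv.
    exact: bmCB.
  move=> x'; rewrite /= in_itv/= => xi; rewrite clampR_id//.
  have -> : al + l * ('i * y'%:C) + l * x'%:C = al + l * (x' +i* y').
    by rewrite cplxE; ring.
  exact: err.
have vE x' : A <= x' <= A + sideL k ->
    normc (ver x' C (C + sideM k) - ((al + l * x'%:C) * (sideM k)%:C + l * 'i * Q)) <= e * sg * sideM k.
  move=> x'A; have aff := cint_affine (al + l * x'%:C) (l * 'i) Cs.
  rewrite Cb -/Q in aff; rewrite -aff /ver.
  have cid : continuous (fun x : R => x) by move=> y'; exact: cvg_id.
  have bid : bm (clampR C (C + sideM k)).
    by apply: (@bm_clamp _ (fun x => x)) => // y' _; exact: cid.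
  rewrite (@eq_cint _ _ (fun y => al + l * x'%:C + l * 'i * y%:C)
     (fun y => al + l * x'%:C + l * 'i * (clampR C (C + sideM k) y)%:C)); last first.
    by move=> y'; rewrite /= in_itv/= => xi; rewrite clampR_id.
  have ba : bmC (fun y => al + l * x'%:C + l * 'i * (clampR C (C + sideM k) y)%:C).
    by apply: bmCD; [exact: bmC_cst|apply: bmCM; [exact: bmC_cst|exact: bmC_real]].
  rewrite -cintB//; last exact: fin_itv.
  rewrite -[X in _ <= _ * X]Cb -mu_itv//; apply: cint_bound => //; first exact: fin_itv.
    exact: bmCB.
  move=> y'; rewrite /= in_itv/= => xi; rewrite clampR_id//.
  have -> : al + l * x'%:C + l * 'i * y'%:C = al + l * (x' +i* y').
    by rewrite cplxE; ring.
  exact: err.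
have A1 : A <= A <= A + sideL k by rewrite lexx.
have A2 : A <= A + sideL k <= A + sideL k by rewrite lexx As.
have C1 : C <= C <= C + sideM k by rewrite lexx.
have C2 : C <= C + sideM k <= C + sideM k by rewrite lexx Cs.
have bk : bdry_dyadic k (p k) <= 2 * (e * sg * sg).
  have normi z : normc ('i * z) = normc z.
    by rewrite normcM (_ : normc 'i = 1) ?mul1r//= expr0n/= add0r expr1n sqrtr1.
  have := hE _ C1; have := hE _ C2; have := vE _ A1; have := vE _ A2.
  set h1 := hor C _ _ - _; set h2 := hor (C + sideM k) _ _ - _.
  set v1 := ver A _ _ - _; set v2 := ver (A + sideL k) _ _ - _.
  move=> q1 q2 q3 q4; rewrite /bdry_dyadic /bdry -/A -/C.
  have -> : hor C A (A + sideL k) - hor (C + sideM k) A (A + sideL k) +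
      'i * (ver (A + sideL k) C (C + sideM k) - ver A C (C + sideM k)) = h1 - h2 + 'i * (v2 - v1).
    rewrite /h1 /h2 /v1 /v2 !rmorphD/=; ring.
  apply: le_trans (normcD _ _) _; rewrite normi.
  have -> : e * sg * sg = e * sg * sideL k + e * sg * sideM k by rewrite -mulrDr.
  apply: le_trans (lerD (normc_leB h1 h2) (normc_leB v2 v1)) _.
  exact: sum4_arith.
apply: le_trans (b4 k) _.
have -> : e * (2 * S ^+ 2) = 4 ^+ k * (2 * (e * sg * sg)).
  have -> : sg = S / 2 ^+ k by rewrite /sg /sideL /sideM -mulrDl.
  have -> : 4 ^+ k = 2 ^+ k * 2 ^+ k :> R by rewrite -exprMn -natrM.
  by have : 2 ^+ k != 0 :> R; [rewrite expf_neq0|move=> ?; field].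
by rewrite ler_wpM2l// exprn_ge0.
Qed.

End goursat.

(** * Circle integrals of a holomorphic function as the radius varies *)

Section circle_means.
Context {R : realType}.
Implicit Types (s t r : R) (z w : R[i]) (F : R[i] -> R[i]).
Local Notation mu := (@lebesgue_measure R).
Local Notation circle := (`[0%R, (2 * pi)%R]%classic : set R).

Lemma pi2_gt0 : 0 < 2 * pi :> R.
Proof. by rewrite mulr_gt0// pi_gt0. Qed.

Lemma cont_path F (p : R[i] -> R) (g : R -> R[i]) t :
  (forall z w, `|p z - p w| <= normc (z - w)) -> (forall s, normc (g s - g t) <= `|s - t|) ->
  cderivable F (g t) -> {for t, continuous (fun s => p (F (g s)))}.
Proof.
move=> pl gl dF; apply/cvgrPdist_lt => e e0.
have [d d0 hd] := cderivable_cont_eps dF e0.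
exists d => // s; rewrite /ball_/= distrC => sd.
by rewrite (le_lt_trans (pl _ _))// normcB hd// (le_lt_trans (gl _)).
Qed.

Lemma Re_lip z w : `|complex.Re z - complex.Re w| <= normc (z - w).
Proof. by rewrite -cReN -cReD normc_Re. Qed.

Lemma Im_lip z w : `|complex.Im z - complex.Im w| <= normc (z - w).
Proof. by rewrite -cImN -cImD normc_Im. Qed.

Lemma bmC_path F (g : R -> R[i]) a b : a <= b ->
  (forall s t, normc (g s - g t) <= `|s - t|) ->
  (forall t, a <= t <= b -> cderivable F (g t)) ->
  bmC (fun t => F (g (clampR a b t))).
Proof.
move=> ab gl dF; split.
  apply: (@bm_clamp _ (fun t => complex.Re (F (g t)))) => // t ti.
  by apply: cont_path; [exact: Re_lip|move=> s; exact: gl|exact: dF].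
apply: (@bm_clamp _ (fun t => complex.Im (F (g t)))) => // t ti.
by apply: cont_path; [exact: Im_lip|move=> s; exact: gl|exact: dF].
Qed.

Lemma hline_lip y s t : normc ((s +i* y) - (t +i* y)) <= `|s - t|.
Proof. by rewrite /= subrr expr0n/= addr0 sqrtr_sqr. Qed.

Lemma vline_lip y s t : normc ((y +i* s) - (y +i* t)) <= `|s - t|.
Proof. by rewrite /= subrr expr0n/= add0r sqrtr_sqr. Qed.

(** Goursat on the rectangle [[s0, s1] x [0, 2 pi]], whose horizontal sides cancel by
    periodicity. *)
Lemma half_plane_periodic F (s0 s1 : R) : s0 <= s1 < 0 ->
  (forall w, complex.Re w < 0 -> cderivable F w) ->
  (forall x, x < 0 -> F (x +i* (2 * pi)) = F (x +i* 0)) ->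
  ver F s0 0 (2 * pi) = ver F s1 0 (2 * pi).
Proof.
move=> /andP[s01 s10] dF pF.
have p0 := ltW pi2_gt0.
pose g w := F (clampR s0 s1 (complex.Re w) +i* clampR 0 (2 * pi) (complex.Im w)).
have cl s : clampR s0 s1 s < 0.
  by have /andP[_ h] := clampR_itv s s01; exact: le_lt_trans s10.
have gx y : bmC (fun x => g (x +i* y)).
  apply: (@bmC_path F (fun x => x +i* clampR 0 (2 * pi) y)) => //.
    exact: hline_lip.
  by move=> t /andP[_ t1]; apply: dF => /=; exact: le_lt_trans s10.
have gy x : bmC (fun y => g (x +i* y)).
  apply: (@bmC_path F (fun y => clampR s0 s1 x +i* y)) => //.
    exact: vline_lip.
  by move=> t _; apply: dF => /=; exact: cl.
have L0 : 0 <= s1 - s0 by rewrite subr_ge0.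
have gE w : s0 <= complex.Re w <= s1 -> 0 <= complex.Im w <= 2 * pi -> g w = F w.
  by move=> h1 h2; rewrite /g !clampR_id//; case: w {h1 h2}.
have sE : s0 + (s1 - s0) = s1 by rewrite addrC subrK.
have : bdry g s0 (s0 + (s1 - s0)) 0 (0 + 2 * pi) = 0.
  apply: goursat_rectangle => //; rewrite sE add0r => w w1 w2.
  have /cderivableP[l lP] : cderivable F w.
    by apply: dF; case/andP: w1 => _ /le_lt_trans; apply.
  exists l => e /lP[d d0 dP]; exists d => // w' w'1 w'2 ww.
  by rewrite !gE//; have := dP _ ww; rewrite (addrC w) subrK.
rewrite sE add0r /bdry.
have -> : hor g 0 s0 s1 = hor g (2 * pi) s0 s1.
  apply: eq_cint => x; rewrite /= in_itv/= => xi.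
  rewrite !gE//= ?lexx ?p0// pF//.
  by case/andP: xi => _ /le_lt_trans; apply.
rewrite subrr add0r => /eqP; rewrite mulf_eq0 => /orP[/eqP/(congr1 (@complex.Im R))/=/eqP|].
  by rewrite oner_eq0.
rewrite subr_eq0 => /eqP.
have -> : ver g s1 0 (2 * pi) = ver F s1 0 (2 * pi).
  by apply: eq_cint => y; rewrite /= in_itv/= => yi; rewrite gE//= lexx s01.
have -> : ver g s0 0 (2 * pi) = ver F s0 0 (2 * pi).
  by apply: eq_cint => y; rewrite /= in_itv/= => yi; rewrite gE//= lexx s01.
by move=> ->.
Qed.

Definition fourier (v : R -> R[i]) (n : nat) : R[i] :=
  ((2 * pi)^-1)%:C * cintegral circle (fun t => v t * expi (- (n%:R * t))).

Lemma cexp_nat_polar n x t : cexp (n%:R * (x +i* t)) = (expR x ^+ n)%:C * expi (n%:R * t).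
Proof. by rewrite cexpMn cexp_polar exprMn expiMn rmorphXn. Qed.

Lemma exp_circle F r : 0 < r < 1 -> (forall z, normc z < 1 -> cderivable F z) ->
  exists2 v : R -> R[i], bmC v & forall t, 0 <= t <= 2 * pi -> v t = F (r%:C * expi t).
Proof.
move=> /andP[r0 r1] dF.
exists (fun t => F (cexp (ln r +i* clampR 0 (2 * pi) t))); last first.
  by move=> t ti; rewrite clampR_id// cexp_polar lnK.
apply: (@bmC_path (fun w => F (cexp w)) (fun t => ln r +i* t)).
- exact/ltW/pi2_gt0.
- exact: vline_lip.
- move=> t _; apply: cderivable_comp; first exact: cderivable_cexp.
  by apply: dF; rewrite normc_cexp/= lnK.
Qed.

Lemma bmC_expi (k : R) : bmC (fun t => expi (k * t)).
Proof.
have cs (f : R -> R) : continuous f -> continuous (fun t : R => f (k * t)).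
  by move=> cf t; apply: (@continuous_comp _ _ _ ( *%R k) f); [exact: mulrl_continuous|exact: cf].
apply: (@bmCP _ _ 1).
- by apply: continuous_measurable_fun; apply: (cs cos); exact: continuous_cos.
- by apply: continuous_measurable_fun; apply: (cs sin); exact: continuous_sin.
- by move=> t; rewrite normc_expi.
Qed.

Lemma bmC_expiN n : bmC (fun t => expi (- (n%:R * t)) : R[i]).
Proof. by under eq_fun do rewrite -mulNr; exact: bmC_expi. Qed.

Lemma fine_circle : fine (mu `[0, (2 * pi)%R : R]) = 2 * pi.
Proof. by rewrite mu_itv ?subr0// ltW// pi2_gt0. Qed.

(** In the coordinate [w = ln r + i t] this is [half_plane_periodic] for [F (exp w) exp (c w)];
    [c = n] and [c = - n] yield the Fourier coefficients of index [- n] and [n]. *)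
Lemma circle_invariance F (c : R[i]) (r0 r1 : R) : 0 < r0 <= r1 -> r1 < 1 ->
  (forall z, normc z < 1 -> cderivable F z) -> cexp (c * (0 +i* (2 * pi))) = 1 ->
  cintegral circle (fun t => F (r0%:C * expi t) * cexp (c * (ln r0 +i* t))) =
  cintegral circle (fun t => F (r1%:C * expi t) * cexp (c * (ln r1 +i* t))).
Proof.
move=> /andP[r00 r01] r11 dF c1.
have r10 : 0 < r1 by exact: lt_le_trans r01.
pose G w := F (cexp w) * cexp (c * w).
have E r : 0 < r -> cintegral circle (fun t => F (r%:C * expi t) * cexp (c * (ln r +i* t))) =
    ver G (ln r) 0 (2 * pi).
  by move=> rp; apply: eq_cint => t _; rewrite /G cexp_polar lnK.
rewrite (E _ r00) (E _ r10); apply: half_plane_periodic.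
- by rewrite ler_ln ?posrE// r01 ln_lt0// r10.
- move=> w w0; apply: cderivableM; apply: cderivable_comp.
  + exact: cderivable_cexp.
  + by apply: dF; rewrite normc_cexp expR_lt1.
  + apply: cderivableM; [exact: cderivable_cst|exact: cderivable_id].
  + exact: cderivable_cexp.
- move=> x x0; rewrite /G.
  have E1 : x +i* (2 * pi) = x +i* 0 + (0 +i* (2 * pi)) by apply/complexP => /=; rewrite ?addr0 ?add0r.
  have E2 : c * (x +i* (2 * pi)) = c * (x +i* 0) + c * (0 +i* (2 * pi)).
    by rewrite -mulrDr -E1.
  have E3 : cexp (0 +i* (2 * pi)) = 1 :> R[i] by rewrite cexp_polar expR0 expi2pi mulr1.
  by rewrite E2 E1 (cexpD (x +i* 0)) (cexpD (c * (x +i* 0))) c1 E3 !mulr1.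
Qed.

Lemma cexp_period_nat n : cexp (n%:R * (0 +i* (2 * pi))) = 1 :> R[i].
Proof. by rewrite cexpMn cexp_polar expR0 expi2pi mul1r expr1n. Qed.

Lemma fourier_circle_neg F (r0 r1 : R) n : 0 < r0 <= r1 -> r1 < 1 ->
  (forall z, normc z < 1 -> cderivable F z) ->
  (r0 ^+ n)%:C * cintegral circle (fun t => F (r0%:C * expi t) * expi (n%:R * t)) =
  (r1 ^+ n)%:C * cintegral circle (fun t => F (r1%:C * expi t) * expi (n%:R * t)).
Proof.
move=> r01 r11 dF; have /andP[r00 r0r1] := r01.
have r10 : 0 < r1 by exact: lt_le_trans r0r1.
have := circle_invariance r01 r11 dF (cexp_period_nat n).
have E r : 0 < r < 1 -> cintegral circle (fun t => F (r%:C * expi t) * cexp (n%:R * (ln r +i* t))) =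
   (r ^+ n)%:C * cintegral circle (fun t => F (r%:C * expi t) * expi (n%:R * t)).
  move=> rr; have [v bv vE] := exp_circle rr dF.
  rewrite (@eq_cint _ _ _ (fun t => (r ^+ n)%:C * (v t * expi (n%:R * t)))); last first.
    move=> t; rewrite /= in_itv/= => ti; rewrite vE// cexp_nat_polar lnK ?posrE; first by ring.
    by case/andP: rr.
  rewrite cintZ//; [|exact: fin_itv|by apply: bmCM => //; exact: bmC_expi].
  by congr (_ * _); apply: eq_cint => t; rewrite /= in_itv/= => ti; rewrite vE.
have i0 : 0 < r0 < 1 by rewrite r00; exact: le_lt_trans r11.
have i1 : 0 < r1 < 1 by rewrite r10.
by rewrite (E _ i0) (E _ i1).
Qed.

Lemma cross_mul (A B X Y k : R[i]) : A != 0 -> B != 0 -> A^-1 * X = B^-1 * Y ->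
  B * (k * X) = A * (k * Y).
Proof.
move=> A0 B0 H; have -> : X = A * (B^-1 * Y) by rewrite -H mulrA divff// mul1r.
by field.
Qed.

Lemma fourier_circle F (r0 r1 : R) n : 0 < r0 <= r1 -> r1 < 1 ->
  (forall z, normc z < 1 -> cderivable F z) ->
  (r1 ^+ n)%:C * fourier (fun t => F (r0%:C * expi t)) n =
  (r0 ^+ n)%:C * fourier (fun t => F (r1%:C * expi t)) n.
Proof.
move=> r01 r11 dF; have /andP[r00 r0r1] := r01.
have r10 : 0 < r1 by exact: lt_le_trans r0r1.
have pn : cexp (- n%:R * (0 +i* (2 * pi))) = 1 :> R[i].
  by rewrite mulNr cexpN cexp_period_nat invr1.
have := circle_invariance r01 r11 dF pn.
have E r : 0 < r < 1 -> cintegral circle (fun t => F (r%:C * expi t) * cexp (- n%:R * (ln r +i* t))) =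
   ((r ^+ n)^-1)%:C * cintegral circle (fun t => F (r%:C * expi t) * expi (- (n%:R * t))).
  move=> rr; have [v bv vE] := exp_circle rr dF.
  rewrite (@eq_cint _ _ _ (fun t => ((r ^+ n)^-1)%:C * (v t * expi (- (n%:R * t))))); last first.
    move=> t; rewrite /= in_itv/= => ti; rewrite vE// mulNr cexpN cexp_nat_polar lnK ?posrE.
      by rewrite invfM expiNV fmorphV/=; ring.
    by case/andP: rr.
  rewrite cintZ//; [|exact: fin_itv|by apply: bmCM => //; exact: bmC_expiN].
  by congr (_ * _); apply: eq_cint => t; rewrite /= in_itv/= => ti; rewrite vE.
have n0 (r : R) : 0 < r -> (r ^+ n)%:C != 0 :> R[i].
  by move=> rp; rewrite -normc_eq0 normc_real gtr0_norm ?exprn_gt0// gt_eqF// exprn_gt0.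
have i0 : 0 < r0 < 1 by rewrite r00; exact: le_lt_trans r11.
have i1 : 0 < r1 < 1 by rewrite r10.
rewrite (E _ i0) (E _ i1) !fmorphV /fourier; exact: cross_mul (n0 _ r00) (n0 _ r10).
Qed.

Lemma fourier_bound v M n : bmC v -> (forall t, 0 <= t <= 2 * pi -> normc (v t) <= M) ->
  normc (fourier v n) <= M.
Proof.
move=> bv vM; rewrite /fourier normcM normc_real ger0_norm; last by rewrite invr_ge0 ltW// pi2_gt0.
rewrite mulrC ler_pdivrMr ?pi2_gt0//.
rewrite -[X in _ <= _ * X]fine_circle.
apply: cint_bound => //; first exact: fin_itv.
  by apply: bmCM => //; exact: bmC_expiN.
by move=> t; rewrite /= in_itv/= => ti; rewrite normcM normc_expi mulr1 vM.
Qed.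

End circle_means.

(** * The Szego and Poisson kernels *)

Section poisson.
Context {R : realType}.
Implicit Types (s t r : R) (z w : R[i]) (F : R[i] -> R[i]).
Local Notation mu := (@lebesgue_measure R).
Local Notation circle := (`[0%R, (2 * pi)%R]%classic : set R).

Lemma mcircle : measurable circle. Proof. exact: measurable_itv. Qed.
Lemma fcircle : (mu circle < +oo)%E. Proof. exact: fin_itv. Qed.
Hint Resolve mcircle fcircle : core.

Lemma bm_inv (f : R -> R) c : bm f -> 0 < c -> (forall s, c <= f s) -> bm (fun s => (f s)^-1).
Proof.
move=> bf c0 cf.
have E : (fun s => (f s)^-1) = (fun s => (fun y => (Num.max c y)^-1) (f s)).
  by apply/funext => s; rewrite (max_idPr (cf s)).
rewrite E; apply: (bm_comp_cont (h := fun y => (Num.max c y)^-1) bf).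
  move=> y; apply: cvgV; first by rewrite gt_eqF// lt_max c0.
  by apply: (@continuous_max _ R^o (cst c) id); [exact: cst_continuous|exact: cvg_id].
exists c^-1 => s; rewrite ger0_norm ?invr_ge0 ?le_max ?(ltW c0)//.
by rewrite lef_pV2 ?posrE ?le_max ?lt_max ?lexx ?c0.
Qed.

Lemma realcV (x : R) : (x^-1)%:C = (x%:C)^-1.
Proof. exact: fmorphV. Qed.

Lemma realcM (x y : R) : (x * y)%:C = x%:C * y%:C.
Proof. exact: rmorphM. Qed.

Lemma realcB (x y : R) : (x - y)%:C = x%:C - y%:C.
Proof. exact: rmorphB. Qed.

(** The generating function of [z^n expi (- n s)]; [pois] is twice its real part minus 1. *)
Definition szego z s : R[i] := (1 - z * expi (- s))^-1.
Definition pois z s : R := (1 - normc z ^+ 2) / normc (expi s - z) ^+ 2.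

Lemma szego_den z s : 1 - normc z <= normc (1 - z * expi (- s)).
Proof.
have := normcD (1 - z * expi (- s)) (z * expi (- s)).
by rewrite subrK normc1 normcM normc_expi mulr1 lerBlDr.
Qed.

Lemma szego_den_expi z s : expi s - z = expi s * (1 - z * expi (- s)).
Proof. by rewrite mulrBr mulr1 mulrCA -expiD subrr expi0 mulr1. Qed.

Lemma normc_szego_den z s : normc (1 - z * expi (- s)) = normc (expi s - z).
Proof. by rewrite szego_den_expi normcM normc_expi mul1r. Qed.

Lemma szego_den_neq0 z s : normc z < 1 -> 1 - z * expi (- s) != 0.
Proof.
by move=> z1; rewrite -normc_gt0; apply: lt_le_trans (szego_den z s); rewrite subr_gt0.
Qed.

Lemma normc_szego z s : normc z < 1 -> normc (szego z s) <= (1 - normc z)^-1.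
Proof.
move=> z1; rewrite /szego normcV lef_pV2 ?posrE ?subr_gt0//; first exact: szego_den.
by rewrite normc_gt0 szego_den_neq0.
Qed.

Lemma bmC_expNs : bmC (fun s => expi (- s) : R[i]).
Proof. by have := @bmC_expiN R 1; under eq_fun do rewrite mul1r. Qed.

Lemma bmC_szego z : normc z < 1 -> bmC (szego z).
Proof.
move=> z1; have z1' : 0 < 1 - normc z by rewrite subr_gt0.
have bd : bmC (fun s => 1 - z * expi (- s)).
  by apply: bmCB; [exact: bmC_cst|apply: bmCM; [exact: bmC_cst|exact: bmC_expNs]].
have -> : szego z = (fun s => ((normc (1 - z * expi (- s)) ^+ 2)^-1)%:C * (1 - z * expi (- s))^*).
  apply/funext => s; rewrite /szego fmorphV/= sqr_normcE invfM mulrAC -mulrA divff ?mulr1//.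
  by rewrite -normc_eq0 normc_conj normc_eq0 szego_den_neq0.
apply: bmCM; last exact: bmCJ.
apply: bmC_real; apply: (bm_inv (c := (1 - normc z) ^+ 2)).
- exact: bmC_normc2.
- by rewrite exprn_gt0.
- by move=> s; rewrite lerXn2r ?nnegrE ?normc_ge0 ?(ltW z1')// szego_den.
Qed.

Lemma pois_alg (u : R[i]) : u != 0 ->
  ((1 - normc (1 - u) ^+ 2) / normc u ^+ 2)%:C = u^-1 + (u^-1)^* - 1.
Proof.
rewrite -normc_eq0 -sqrf_eq0 !sqr_normcE'; case: u => x y /= n0.
by apply/complexP => /=; field.
Qed.

Lemma poisE z s : normc z < 1 -> (pois z s)%:C = szego z s + (szego z s)^* - 1.
Proof.
move=> z1; rewrite /szego -pois_alg; last exact: szego_den_neq0.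
by rewrite /pois -normc_szego_den subKr [in RHS]normcM normc_expi mulr1.
Qed.

Lemma pois_ge0 z s : normc z < 1 -> 0 <= pois z s.
Proof.
move=> z1; rewrite divr_ge0 ?sqr_ge0// subr_ge0 exprn_ile1 ?normc_ge0//.
exact: ltW.
Qed.

Lemma bm_pois z : normc z < 1 -> bm (pois z).
Proof.
move=> z1; have [+ _] : bmC (fun s => szego z s + (szego z s)^* - 1).
  by apply: bmCB; [apply: bmCD; [|apply: bmCJ]; exact: bmC_szego|exact: bmC_cst].
by under eq_fun do rewrite -poisE//.
Qed.

Lemma szego_series z s N : normc z < 1 ->
  normc (szego z s - \sum_(0 <= n < N) z ^+ n * expi (- (n%:R * s))) <=
  normc z ^+ N / (1 - normc z).
Proof.
move=> z1; set w := z * expi (- s).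
have E n : z ^+ n * expi (- (n%:R * s)) = w ^+ n.
  by rewrite -mulrN expiMn -exprMn.
under eq_bigr do rewrite E.
have w0 : 1 - w != 0 by exact: szego_den_neq0.
have -> : szego z s - \sum_(0 <= n < N) w ^+ n = w ^+ N * szego z s.
  rewrite /szego -/w big_mkord.
  have := subrX1 w N.
  move=> H; apply: (mulfI w0); rewrite mulrBr divff// mulrCA divff// mulr1.
  have -> : (1 - w) * (\sum_(i < N) w ^+ i) = - (w ^+ N - 1) by rewrite H; ring.
  by ring.
rewrite normcM normcX normcM normc_expi mulr1 ler_wpM2l ?exprn_ge0 ?normc_ge0//.
exact: normc_szego.
Qed.

Lemma rc1_fourier (v : R -> R[i]) : bmC v -> rc1 (fourier v).
Proof.
move=> bv; have [M vM] := bmC_bound bv; apply: (@rc1_bounded _ _ M) => n.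
exact: fourier_bound.
Qed.

Lemma pi2C_neq0 : (2 * pi)%:C != 0 :> R[i].
Proof. by rewrite -normc_eq0 normc_real gtr0_norm ?pi2_gt0// gt_eqF// pi2_gt0. Qed.

(** The geometric series of the kernel is integrated term by term; its tail is at most
    [|z|^N / (1 - |z|)], uniformly in [s]. *)
Lemma cint_szego (v : R -> R[i]) z : bmC v -> normc z < 1 ->
  cintegral circle (fun s => szego z s * v s) = (2 * pi)%:C * psum (fourier v) z.
Proof.
move=> bv z1.
have [M vM] := bmC_bound bv.
have M0 : 0 <= M by rewrite (le_trans (normc_ge0 (v 0))).
set X := cintegral _ _.
have bn n : bmC (fun s => z ^+ n * (v s * expi (- (n%:R * s)))).
  by apply: bmCM; [exact: bmC_cst|apply: bmCM => //; exact: bmC_expiN].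
have key N : normc (X - (2 * pi)%:C * series (fun n => fourier v n * z ^+ n) N) <=
    M / (1 - normc z) * (2 * pi) * normc z ^+ N.
  have -> : (2 * pi)%:C * series (fun n => fourier v n * z ^+ n) N =
      cintegral circle (fun s => \sum_(0 <= n < N) z ^+ n * (v s * expi (- (n%:R * s)))).
    rewrite cint_sum// /series/= mulr_sumr; apply: eq_bigr => n _.
    rewrite cintZ//; last by apply: bmCM => //; exact: bmC_expiN.
    rewrite /fourier realcV; move: (_%:C) pi2C_neq0 => P P0; by field.
  rewrite /X -cintB//; [|by apply: bmCM => //; exact: bmC_szego|exact: bmC_sum].
  have -> : M / (1 - normc z) * (2 * pi) * normc z ^+ N =
     (normc z ^+ N / (1 - normc z) * M) * fine (mu circle) by rewrite fine_circle; ring.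
  apply: cint_bound => //.
    by apply: bmCB; [apply: bmCM => //; exact: bmC_szego|exact: bmC_sum].
  move=> s _.
  have -> : szego z s * v s - \sum_(0 <= n < N) z ^+ n * (v s * expi (- (n%:R * s))) =
     (szego z s - \sum_(0 <= n < N) z ^+ n * expi (- (n%:R * s))) * v s.
    by rewrite mulrBl mulr_suml; congr (_ - _); apply: eq_bigr => n _; ring.
  by rewrite normcM ler_pM ?normc_ge0// szego_series.
have sm := rc1_summable (rc1_fourier bv) z1.
have cv : (fun N => (X - (2 * pi)%:C * series (fun n => fourier v n * z ^+ n) N : R[i]^o)) @ \oo -->
    (X - (2 * pi)%:C * psum (fourier v) z : R[i]^o).
  apply: (@cvgB _ R[i]^o); first exact: cvg_cst.
  by apply: (@cvgMl_tmp _ _ _ _ (series (fun n => fourier v n * z ^+ n) : nat -> R[i]^o)); exact: csum_cvg.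
have c0 : (fun N => M / (1 - normc z) * (2 * pi) * normc z ^+ N) @ \oo --> (0 : R).
  rewrite -[X in _ --> X](mulr0 (M / (1 - normc z) * (2 * pi))); apply: cvgMl_tmp.
  by apply: cvg_expr; rewrite ger0_norm ?normc_ge0.
have c1 : (fun N => normc (X - (2 * pi)%:C * series (fun n => fourier v n * z ^+ n) N)) @ \oo -->
   normc (X - (2 * pi)%:C * psum (fourier v) z) by exact: (cvg_normc cv).
apply/eqP; rewrite -subr_eq0 -normc_eq0; apply/eqP/le_anti; rewrite normc_ge0 andbT.
rewrite -(cvg_lim (@Rhausdorff R) c0) -(cvg_lim (@Rhausdorff R) c1).
apply: ler_lim.
- by apply/cvg_ex; eexists; exact: c1.
- by apply/cvg_ex; eexists; exact: c0.
- by apply: nearW => N; exact: key.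
Qed.

Definition cpois (v : R -> R[i]) z : R[i] :=
  ((2 * pi)^-1)%:C * cintegral circle (fun s => (pois z s)%:C * v s).

(** [pois = szego + szego^* - 1]. The first term gives the power series. The coefficients of [v] of
    negative index vanish by hypothesis, so the second gives only the constant term, which the third
    cancels. *)
Lemma cpois_fourier (v : R -> R[i]) z : bmC v -> normc z < 1 ->
  (forall n, (0 < n)%N -> fourier (fun s => (v s)^*) n = 0) ->
  cpois v z = psum (fourier v) z.
Proof.
move=> bv z1 vn.
have bs := bmC_szego z1.
have bvJ : bmC (fun s => (v s)^*) by exact: bmCJ.
have E : cintegral circle (fun s => (pois z s)%:C * v s) =
    cintegral circle (fun s => szego z s * v s) +
    (cintegral circle (fun s => szego z s * (v s)^*))^* - cintegral circle v.
  have b0 : bmC (fun s => szego z s * (v s)^*) by exact: bmCM.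
  have hJ := cintJ mcircle fcircle b0; rewrite -hJ.
  have b1 : bmC (fun s => szego z s * v s) by exact: bmCM.
  have b2 : bmC (fun s => (szego z s * (v s)^*)^*) by apply: bmCJ; exact: bmCM.
  rewrite -cintD// -cintB//; last exact: bmCD.
  by apply: eq_cint => s _; rewrite poisE// cJM conjcK; ring.
have v0 : cintegral circle v = (2 * pi)%:C * fourier v 0.
  rewrite /fourier realcV mulrA divff ?pi2C_neq0// mul1r.
  by apply: eq_cint => s _; rewrite mul0r oppr0 expi0 mulr1.
have vJ0 : (fourier (fun s => (v s)^*) 0)^* = fourier v 0.
  rewrite /fourier cJM cJr; congr (_ * _).
  have b0 : bmC (fun s => (v s)^* * expi (- (0%:R * s))).
    by apply: bmCM => //; exact: bmC_expiN.
  rewrite -(cintJ mcircle fcircle b0).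
  by apply: eq_cint => s _; rewrite mul0r oppr0 expi0 !mulr1 conjcK.
rewrite /cpois E !cint_szego// v0.
have -> : psum (fourier (fun s => (v s)^*)) z = fourier (fun s => (v s)^*) 0.
  rewrite /psum (@csum_fin _ _ 1).
    by rewrite /series/= big_nat1 expr0 mulr1.
  by move=> n n0; rewrite vn// mul0r.
rewrite cJM vJ0 cJr realcV; move: (_%:C) pi2C_neq0 => P P0; by field.
Qed.

Lemma fourier_cst1 n : fourier (fun=> 1 : R[i]) n = (n == 0)%:R.
Proof.
case: n => [|n] /=.
  rewrite /fourier (@eq_cint _ _ _ (fun=> 1)).
    by rewrite cint_cst// fine_circle mul1r realcV mulVf// pi2C_neq0.
  by move=> s _; rewrite mul0r oppr0 expi0 mulr1.
(* For a constant function the coefficient is the same on both circles, whereas [fourier_circle]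
   makes it scale like [r^n]; so it vanishes. *)
have r01 : 0 < (1/4 : R) <= 1/2 by lra.
have r1 : (1/2 : R) < 1 by lra.
have := fourier_circle n.+1 r01 r1 (fun z _ => @cderivable_cst R 1 z) => /=.
set X := fourier _ _ => /eqP; rewrite -subr_eq0 -mulrBl mulf_eq0 => /orP[|/eqP//].
rewrite -rmorphB/= -normc_eq0 normc_real normr_eq0 subr_eq0 => /eqP H.
have : (1/4 : R) ^+ n.+1 < (1/2) ^+ n.+1 by rewrite ltrXn2r//; lra.
by rewrite H ltxx.
Qed.

Lemma cpois_cst (c : R[i]) z : normc z < 1 -> cpois (fun=> c) z = c.
Proof.
move=> z1.
have -> : cpois (fun=> c) z = c * cpois (fun=> 1) z.
  rewrite /cpois mulrCA; congr (_ * _).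
  rewrite -cintZ//; last by apply: bmCM; [apply: bmC_real; exact: bm_pois|exact: bmC_cst].
  by apply: eq_cint => s _; ring.
rewrite cpois_fourier//.
- rewrite /psum (@csum_fin _ _ 1).
    by rewrite /series/= big_nat1 expr0 fourier_cst1 !mulr1.
  by move=> [//|n _]; rewrite fourier_cst1 mul0r.
- exact: bmC_cst.
- case=> [|n] _ //; rewrite (_ : (fun=> _) = fun=> 1) ?fourier_cst1//.
  by apply/funext => s; rewrite conjc1.
Qed.

Lemma int_pois z : normc z < 1 -> \int[mu]_(s in circle) pois z s = 2 * pi.
Proof.
move=> z1; have := cpois_cst 1 z1; rewrite /cpois.
rewrite (@eq_cint _ _ _ (fun s => (pois z s)%:C)); last by move=> s _; rewrite mulr1.
rewrite cint_real// -rmorphM => /complexI/(congr1 (fun x => 2 * pi * x)).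
by rewrite mulrA divff ?mul1r ?mulr1// gt_eqF// pi2_gt0.
Qed.

(** With [z = rho expi t], the distance [1 - rho] from [z] to [expi t] is at most [|expi s - z|], so
    [|expi s - expi t| <= 2 |expi s - z|]: the quadratic term cancels the denominator of the kernel,
    and near and far arcs are treated together. *)
Lemma poisson_approx (v : R -> R[i]) v0 t (rho e K : R) : bmC v -> 0 <= rho < 1 -> 0 <= K ->
  (forall s, 0 <= s <= 2 * pi -> normc (v s - v0) <= e + K * normc (expi s - expi t) ^+ 2) ->
  normc (cpois v (rho%:C * expi t) - v0) <= e + 4 * K * (1 - rho ^+ 2).
Proof.
move=> bv /andP[rho0 rho1] K0 vK; set z := _ * expi t.
have nz : normc z = rho by rewrite normcM normc_expi mulr1 normc_real ger0_norm.
have z1 : normc z < 1 by rewrite nz.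
have bp := bm_pois z1.
have bpC := bmC_real bp.
have dist s : normc (expi s - expi t) <= 2 * normc (expi s - z).
  have h1 : normc (expi s - expi t) <= normc (expi s - z) + normc (z - expi t).
    have -> : expi s - expi t = (expi s - z) + (z - expi t) by ring.
    exact: normcD.
  have h2 : normc (z - expi t) = 1 - rho.
    have -> : z - expi t = (rho - 1)%:C * expi t by rewrite rmorphB rmorph1 mulrBl mul1r.
    by rewrite normcM normc_expi mulr1 normc_real ler0_norm ?opprB// subr_le0 ltW.
  have h3 : 1 - rho <= normc (expi s - z) by rewrite -nz -normc_szego_den szego_den.
  by lra.
have den0 s : 0 < normc (expi s - z).
  by rewrite -normc_szego_den normc_gt0 szego_den_neq0.
rewrite -{1}(cpois_cst v0 z1) /cpois -mulrBr -cintB//; [|exact: bmCM|by apply: bmCM => //; exact: bmC_cst].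
rewrite normcM normc_real ger0_norm ?invr_ge0 ?(ltW pi2_gt0)// mulrC ler_pdivrMr ?pi2_gt0//.
have bdiff : bmC (fun s => (pois z s)%:C * v s - (pois z s)%:C * v0).
  by apply: bmCB; apply: bmCM => //; exact: bmC_cst.
apply: le_trans (cint_norm mcircle fcircle bdiff) _.
have b2 : bm (fun s => e * pois z s + 4 * K * (1 - rho ^+ 2)).
  by apply: bmD; [exact: bmZ|exact: bm_cst].
apply: (@le_trans _ _ (\int[mu]_(s in circle) (e * pois z s + 4 * K * (1 - rho ^+ 2)))).
  apply: I_le => //; first exact: bmC_normc.
  move=> s; rewrite /= in_itv/= => si.
  rewrite -mulrBr normcM normc_real (ger0_norm (pois_ge0 s z1)).
  apply: le_trans (ler_wpM2l (pois_ge0 s z1) (vK _ si)) _.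
  rewrite mulrDr [_ * e]mulrC lerD2l /pois nz.
  have d2 : normc (expi s - expi t) ^+ 2 <= 4 * normc (expi s - z) ^+ 2.
    apply: le_trans (_ : (2 * normc (expi s - z)) ^+ 2 <= _).
      by rewrite lerXn2r ?nnegrE ?mulr_ge0 ?normc_ge0.
    by rewrite exprMn -natrX.
  have r2 : 0 <= 1 - rho ^+ 2 by rewrite subr_ge0 exprn_ile1// ltW.
  rewrite mulrAC ler_pdivrMr ?exprn_gt0//.
  have -> : 4 * K * (1 - rho ^+ 2) * normc (expi s - z) ^+ 2 =
    (1 - rho ^+ 2) * (K * (4 * normc (expi s - z) ^+ 2)) by ring.
  by rewrite ler_wpM2l// ler_wpM2l.
rewrite ID//; [|exact: bmZ|exact: bm_cst].
by rewrite IZ// int_pois// Icst// fine_circle; apply: eqle; ring.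
Qed.

End poisson.

(** * Power series expansion of holomorphic functions *)

Section power_series.
Context {R : realType}.
Implicit Types (s t r : R) (z w : R[i]) (F : R[i] -> R[i]) (a : nat -> R[i]).
Local Notation mu := (@lebesgue_measure R).
Local Notation circle := (`[0%R, (2 * pi)%R]%classic : set R).
#[local] Hint Resolve mcircle fcircle : core.

Lemma polar z : exists2 t, 0 <= t <= 2 * pi & z = (normc z)%:C * expi t.
Proof.
have p0 := pi_gt0 R.
have [->|z0] := eqVneq z 0.
  by exists 0; rewrite ?normc0 ?mul0r// lexx ltW// mulr_gt0.
have nz : 0 < normc z by rewrite normc_gt0.
pose c := complex.Re z / normc z; pose q := complex.Im z / normc z.
have cq : c ^+ 2 + q ^+ 2 = 1.
  rewrite !exprMn -mulrDl -sqr_normcE' exprVn divff// expf_neq0// gt_eqF//.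
have c1 : -1 <= c <= 1.
  have := sqr_ge0 q => q0; have c2 : c ^+ 2 <= 1 by lra.
  by rewrite -ler_norml -(@ler_pXn2r _ 2)// ?nnegrE// expr1n real_normK ?num_real.
have [tp0 tpi] := (acos_ge0 c1, acos_lepi c1).
have sc : sin (acos c) = `|q|.
  rewrite sin_acos// -sqrtr_sqr; congr Num.sqrt; lra.
have zE : z = (normc z)%:C * (c +i* q).
  by apply/complexP => /=; rewrite !mul0r ?subr0 ?addr0 mulrC divfK// gt_eqF.
have [q0|q0] := leP 0 q.
  exists (acos c); first by rewrite tp0/=; lra.
  by rewrite /expi acosK// sc ger0_norm.
exists (2 * pi - acos c); first by apply/andP; split; lra.
rewrite {1}zE; congr (_ * _).
have -> : 2 * pi - acos c = - acos c + 2 * pi by rewrite addrC.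
by rewrite expiD expi2pi mulr1 /expi cosN sinN acosK// sc ltr0_norm// opprK.
Qed.

Lemma bmC_psum_circle a r : rc1 a -> 0 <= r < 1 -> bmC (fun t => psum a (r%:C * expi t)).
Proof.
move=> ra /andP[r0 r1].
have nz t : normc (r%:C * expi t) = r.
  by rewrite normcM normc_expi mulr1 normc_real ger0_norm.
pose S N t := series (fun n => a n * (r%:C * expi t) ^+ n) N.
have bS N : bmC (S N).
  rewrite /S /series/=; apply: bmC_sum => n.
  under eq_fun do rewrite exprMn -expiMn.
  by apply: bmCM; [exact: bmC_cst|apply: bmCM; [exact: bmC_cst|exact: bmC_expi]].
have SG t : (fun N => (S N t : R[i]^o)) @ \oo --> (psum a (r%:C * expi t) : R[i]^o).
  by apply: csum_cvg; apply: rc1_summable => //; rewrite nz.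
have sr : 0 <= r < 1 by rewrite r0.
apply: (@bmCP _ _ (limn (series (fun n => normc (a n) * r ^+ n)))).
- apply: (@measurable_fun_cvg _ _ _ _ (fun N t => complex.Re (S N t))).
    by move=> N; case: (bS N) => -[].
  by move=> t _; have /cvg_ReIm[] := SG t.
- apply: (@measurable_fun_cvg _ _ _ _ (fun N t => complex.Im (S N t))).
    by move=> N; case: (bS N) => _ [].
  by move=> t _; have /cvg_ReIm[] := SG t.
- move=> t; apply: csum_le; last exact: rc1_summableR.
  by move=> n; rewrite normcM normcX nz.
Qed.

Lemma subC3 (f q p : R[i]) : f - q = (p - q) - (p - f).
Proof. by ring. Qed.

Lemma abel_arith (K eta e : R) : 0 <= K -> 0 < eta -> eta * (8 * K + 1) <= e ->
  4 * K * (1 - (1 - eta) ^+ 2) <= e.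
Proof.
move=> K0 eta0; apply: le_trans.
have : 0 <= K * eta ^+ 2 by rewrite mulr_ge0// sqr_ge0.
have -> : 4 * K * (1 - (1 - eta) ^+ 2) = 8 * (K * eta) - 4 * (K * eta ^+ 2) by ring.
have -> : eta * (8 * K + 1) = 8 * (K * eta) + eta by ring.
lra.
Qed.

Lemma sum_arith (x y p e : R) : x <= e / 4 + p -> y < e / 4 -> p <= e / 4 -> 0 < e ->
  x + y <= e.
Proof. lra. Qed.

(* Goursat's theorem in polar coordinates, for [F (exp w) exp (- n w)] on
   rectangles, shows that the normalised Fourier coefficients of [F (r .)] do not
   depend on [r]. *)
Theorem holomorphic_psum F : (forall z, normc z < 1 -> cderivable F z) ->
  exists2 a, rc1 a & forall z, normc z < 1 -> F z = psum a z.
Proof.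
move=> dF.
pose a n := (2 ^+ n)%:C * fourier (fun t => F ((2^-1)%:C * expi t)) n.
have h0 : 0 < (2^-1 : R) < 1 by rewrite invr_gt0 invf_lt1// ltr0n ltr1n.
have aE r n : 0 < r < 1 -> fourier (fun t => F (r%:C * expi t)) n = a n * (r ^+ n)%:C.
  move=> /andP[r0 r1]; rewrite /a.
  have pw (x : R) : 0 < x -> (x ^+ n)%:C != 0 :> R[i].
    by move=> x0; rewrite -normc_eq0 normc_real gtr0_norm ?exprn_gt0// gt_eqF// exprn_gt0.
  apply: (mulfI (pw 2^-1 _)); first by case/andP: h0.
  have key : (2^-1 ^+ n)%:C * fourier (fun t => F (r%:C * expi t)) n =
      (r ^+ n)%:C * fourier (fun t => F ((2^-1)%:C * expi t)) n.
    have [rl|rl] := leP r 2^-1.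
      by apply: (fourier_circle n _ _ dF); [rewrite r0|case/andP: h0].
    apply/esym; apply: (fourier_circle n _ _ dF) => //.
    by case/andP: h0 => -> _; exact: ltW.
  have e2 : (2^-1 ^+ n)%:C * (2 ^+ n)%:C = 1 :> R[i].
    by rewrite -realcM -exprMn mulVf ?pnatr_eq0// expr1n.
  rewrite key; move: (fourier _ _) ((r ^+ n)%:C) => f2 rn; rewrite -[LHS]mul1r -e2; ring.
(* [x^n] times the integral on the circle of radius [x] does not depend on [x], and [F] is bounded
   near 0; let [x] tend to 0. *)
have fneg r n : 0 < r < 1 -> (0 < n)%N ->
    cintegral circle (fun t => F (r%:C * expi t) * expi (n%:R * t)) = 0.
  move=> /andP[r0 r1] n0; set X := cintegral _ _.
  have z01 : normc (0 : R[i]) < 1 by rewrite normc0.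
  have [d d0 dP] := cderivable_cont_eps (dF 0 z01) ltr01.
  have MX x : 0 < x -> x <= r -> x < d ->
      normc X * r ^+ n <= x * ((normc (F 0) + 1) * (2 * pi)).
    move=> x0 xr xd.
    have x1 : 0 < x < 1 by rewrite x0; exact: le_lt_trans r1.
    have := @fourier_circle_neg R F x r n; rewrite x0 xr => /(_ isT r1 dF) H.
    have -> : normc X * r ^+ n = normc ((r ^+ n)%:C * X).
      by rewrite normcM normc_real ger0_norm 1?mulrC// exprn_ge0// ltW.
    rewrite -H normcM normc_real ger0_norm ?exprn_ge0 ?(ltW x0)//.
    apply: ler_pM; rewrite ?exprn_ge0 ?normc_ge0 ?(ltW x0)//.
      by case: n n0 {H X} => // n _; rewrite exprS ler_piMr ?(ltW x0)// exprn_ile1 ?(ltW x0)//; case/andP: x1 => _ /ltW.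
    have [v bv vE] := exp_circle x1 dF.
    rewrite (@eq_cint _ _ _ (fun t => v t * expi (n%:R * t))); last first.
      by move=> t; rewrite /= in_itv/= => ti; rewrite vE.
    rewrite -[X in _ <= _ * X]fine_circle; apply: cint_bound => //.
      by apply: bmCM => //; exact: bmC_expi.
    move=> t; rewrite /= in_itv/= => ti; rewrite normcM normc_expi mulr1 vE//.
    have -> : F (x%:C * expi t) = F 0 + (F (x%:C * expi t) - F 0) by ring.
    apply: le_trans (normcD _ _) _; rewrite lerD2l ltW// dP//.
    by rewrite subr0 normcM normc_expi mulr1 normc_real gtr0_norm.
  apply/eqP; rewrite -normc_eq0; apply/eqP/le_anti; rewrite normc_ge0 andbT.
  rewrite -(@pmulr_rle0 _ (r ^+ n)) ?exprn_gt0// mulrC.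
  apply/ler_addgt0Pl => e e0; rewrite addr0.
  pose B := (normc (F 0) + 1) * (2 * pi).
  have B0 : 0 < B.
    by rewrite mulr_gt0 ?pi2_gt0// ltr_wpDl ?normc_ge0.
  pose x := Num.min (Num.min r (d / 2)) (e / B).
  have x0 : 0 < x by rewrite /x !lt_min r0 !divr_gt0.
  apply: le_trans (MX x x0 _ _) _.
  - by rewrite /x !ge_min lexx.
  - by rewrite (@le_lt_trans _ _ (d / 2))//; [rewrite /x !ge_min lexx orbT|lra].
  - by rewrite -ler_pdivlMr// /x ge_min lexx orbT.
have rca : rc1 a.
  move=> r /andP[r0 r1].
  have [x rx x1] : exists2 x, r < x & x < 1 by exists ((1 + r) / 2); lra.
  have xx : 0 < x < 1 by rewrite x1 andbT; exact: le_lt_trans rx.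
  have [v bv vE] := exp_circle xx dF; have [M vM] := bmC_bound bv.
  exists M => n; apply: (@le_trans _ _ (normc (a n) * x ^+ n)).
    by rewrite ler_wpM2l ?normc_ge0// lerXn2r ?nnegrE//; lra.
  have <- : normc (fourier v n) = normc (a n) * x ^+ n.
    have <- : fourier (fun t => F (x%:C * expi t)) n = fourier v n.
      by congr (_ * _); apply: eq_cint => t; rewrite /= in_itv/= => ti; rewrite vE.
    by rewrite aE// normcM normc_real ger0_norm// exprn_ge0//; case/andP: xx => /ltW.
  by apply: fourier_bound => // t _; exact: vM.
(* Abel summation: the Poisson integral of [v] at [rho expi t] is the power series at [rho z], and
   it tends to [v t = F z] as [rho] tends to 1. *)
have nz0 z : normc z < 1 -> z != 0 -> F z = psum a z.
  move=> z1 z0; have [t ti zE] := polar z.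
  set r := normc z in z1 zE.
  have rp : 0 < r by rewrite /r normc_gt0.
  have rr : 0 < r < 1 by rewrite rp.
  have [v bv vE] := exp_circle rr dF.
  have fv n : fourier v n = a n * (r ^+ n)%:C.
    by rewrite -aE//; congr (_ * _); apply: eq_cint => s; rewrite /= in_itv/= => si; rewrite vE.
  have vneg n : (0 < n)%N -> fourier (fun s => (v s)^*) n = 0.
    move=> n0; have bvn : bmC (fun s => v s * expi (n%:R * s)).
      by apply: bmCM => //; exact: bmC_expi.
    rewrite /fourier (@eq_cint _ _ _ (fun s => (v s * expi (n%:R * s))^*)); last first.
      by move=> s _; rewrite cJM -expiN.
    rewrite (cintJ mcircle fcircle bvn) (@eq_cint _ _ _ (fun t => F (r%:C * expi t) * expi (n%:R * t))).
      by rewrite fneg// conjc0 mulr0.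
    by move=> s; rewrite /= in_itv/= => si; rewrite vE.
  have vt : v t = F z by rewrite vE// -zE.
  have pE rho : 0 <= rho < 1 -> cpois v (rho%:C * expi t) = psum a (rho%:C * z).
    move=> /andP[rho0 rho1].
    have nr : normc (rho%:C * expi t) < 1.
      by rewrite normcM normc_expi mulr1 normc_real ger0_norm.
    rewrite cpois_fourier//; congr csum; apply/funext => n.
    by rewrite fv zE -mulrA; congr (_ * _); rewrite !exprMn rmorphXn; ring.
  have [M vM] := bmC_bound bv.
  have M0 : 0 <= M by rewrite (le_trans (normc_ge0 (v 0))).
  apply/eqP; rewrite -subr_eq0 -normc_eq0; apply/eqP/le_anti; rewrite normc_ge0 andbT.
  apply/ler_addgt0Pl => e e0; rewrite addr0.
  have e4 : 0 < e / 4 by rewrite divr_gt0.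
  have [d d0 dP] := cderivable_cont_eps (dF z z1) e4.
  have [d2 d20 d2P] := cderivable_cont_eps (psum_cderivable rca z1) e4.
  (* [v] oscillates by at most [2 M], so this [K] lets the quadratic term take over where
     [|expi s - expi t| >= d]. *)
  pose K := 2 * M / d ^+ 2.
  have K0 : 0 <= K by rewrite divr_ge0 ?mulr_ge0 ?exprn_ge0// ltW.
  have hyp s : 0 <= s <= 2 * pi -> normc (v s - F z) <= e / 4 + K * normc (expi s - expi t) ^+ 2.
    move=> si; have [h|h] := ltP (normc (expi s - expi t)) d.
      apply: (@le_trans _ _ (e / 4)); last by rewrite lerDl mulr_ge0// sqr_ge0.
      apply/ltW; rewrite vE//; apply: dP; rewrite {1}zE -mulrBr normcM normc_real gtr0_norm//.
      by apply: le_lt_trans h; rewrite ler_piMl ?normc_ge0// ltW.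
    apply: (@le_trans _ _ (2 * M)).
      rewrite -vt; apply: le_trans (normc_leB _ _) _.
      by have := vM s; have := vM t; lra.
    apply: (@le_trans _ _ (K * normc (expi s - expi t) ^+ 2)); last by rewrite lerDr ltW.
    rewrite /K mulrAC ler_pdivlMr ?exprn_gt0// ler_wpM2l ?mulr_ge0//.
    by rewrite lerXn2r ?nnegrE ?normc_ge0 ?(ltW d0).
  pose eta := Num.min (2^-1) (Num.min (d2 / 2) (e / 4 / (8 * K + 1))).
  have K1 : 0 < 8 * K + 1 by lra.
  have eta0 : 0 < eta by rewrite /eta !lt_min invr_gt0 ltr0n/= !divr_gt0.
  have eta1 : eta <= 2^-1 by rewrite /eta ge_min lexx.
  have eta2 : eta <= d2 / 2 by rewrite /eta !ge_min lexx orbT.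
  have eta3 : eta <= e / 4 / (8 * K + 1) by rewrite /eta !ge_min lexx !orbT.
  pose rho := 1 - eta.
  have rho1 : 0 <= rho < 1 by rewrite /rho; lra.
  have A1 := poisson_approx bv rho1 K0 hyp.
  have A2 : normc (psum a (rho%:C * z) - psum a z) < e / 4.
    apply: d2P; have -> : rho%:C * z - z = - (eta%:C * z) by rewrite /rho realcB; ring.
    rewrite normcN normcM normc_real gtr0_norm//.
    apply: (@le_lt_trans _ _ (eta * 1)); last by lra.
    by rewrite ler_wpM2l ?(ltW eta0)// ltW.
  rewrite pE// in A1.
  rewrite (subC3 _ _ (psum a (rho%:C * z))).
  apply: le_trans (normc_leB _ _) _; rewrite addrC.
  have rr2 : 4 * K * (1 - rho ^+ 2) <= e / 4.
    by move: eta3; rewrite ler_pdivlMr// /rho => eta3; exact: abel_arith K0 eta0 eta3.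
  exact: sum_arith A1 A2 rr2 e0.
(* The origin lies on no circle of positive radius and is reached by continuity of both sides. *)
exists a => // z z1; have [->|] := eqVneq z 0; last exact: nz0.
have n0 : normc (0 : R[i]) < 1 by rewrite normc0.
apply/eqP; rewrite -subr_eq0 -normc_eq0; apply/eqP/le_anti; rewrite normc_ge0 andbT.
apply/ler_addgt0Pl => e e0; rewrite addr0.
have e2 : 0 < e / 2 by rewrite divr_gt0.
have [d d0 dP] := cderivable_cont_eps (dF 0 n0) e2.
have [d2 d20 d2P] := cderivable_cont_eps (psum_cderivable rca n0) e2.
pose x := Num.min (2^-1) (Num.min (d / 2) (d2 / 2)).
have x0 : 0 < x by rewrite /x !lt_min invr_gt0 ltr0n/= !divr_gt0.
have xh : x <= 2^-1 by rewrite /x ge_min lexx.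
have xd : x < d by rewrite (@le_lt_trans _ _ (d / 2))//; [rewrite /x !ge_min lexx orbT|lra].
have xd2 : x < d2 by rewrite (@le_lt_trans _ _ (d2 / 2))//; [rewrite /x !ge_min lexx !orbT|lra].
have nx : normc (x%:C) = x by rewrite normc_real gtr0_norm.
have xE : F x%:C = psum a x%:C.
  by apply: nz0; rewrite ?nx; [lra|rewrite -normc_gt0 nx].
have B1 : normc (F x%:C - F 0) < e / 2 by apply: dP; rewrite subr0 nx.
have B2 : normc (psum a x%:C - psum a 0) < e / 2 by apply: d2P; rewrite subr0 nx.
rewrite (subC3 _ _ (psum a x%:C)) -{2}xE.
apply: le_trans (normc_leB _ _) _; rewrite addrC [e]splitr; exact: lerD (ltW B1) (ltW B2).
Qed.

End power_series.

(** * Parseval's identity, Cauchy's estimate and the maximum principle *)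

Section parseval.
Context {R : realType}.
Implicit Types (s t r : R) (z w : R[i]) (F : R[i] -> R[i]) (a : nat -> R[i]).
Local Notation mu := (@lebesgue_measure R).
Local Notation circle := (`[0%R, (2 * pi)%R]%classic : set R).
#[local] Hint Resolve mcircle fcircle : core.

Lemma cint_expi_orth n m : (n < m)%N ->
  cintegral circle (fun t => expi (n%:R * t) * expi (- (m%:R * t))) = 0.
Proof.
move=> nm; have := @fourier_cst1 R (m - n)%N.
rewrite subn_eq0 leqNgt nm /= /fourier => /eqP.
rewrite mulf_eq0 realcV invr_eq0 (negPf (@pi2C_neq0 R))/= => /eqP <-.
apply: eq_cint => t _; rewrite mul1r -expiD; congr expi.
by rewrite natrB ?(ltnW nm)//; ring.
Qed.

Lemma psum_normcX a r t n : 0 <= r -> normc (a n * (r%:C * expi t) ^+ n) = normc (a n) * r ^+ n.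
Proof.
by move=> r0; rewrite normcM normcX normcM normc_expi mulr1 normc_real ger0_norm.
Qed.

Lemma parseval_fin a r N : 0 <= r ->
  \int[mu]_(t in circle) normc (series (fun n => a n * (r%:C * expi t) ^+ n) N) ^+ 2 =
  2 * pi * \sum_(0 <= n < N) normc (a n) ^+ 2 * r ^+ (2 * n).
Proof.
move=> r0; elim: N => [|N IH].
  rewrite big_geq// mulr0 (@eq_I _ _ _ (fun=> 0)).
    by rewrite Icst// mul0r.
  by move=> t _; rewrite /series/= big_geq// normc0 expr0n.
pose S t := series (fun n => a n * (r%:C * expi t) ^+ n) N.
have bS : bmC S.
  rewrite /S /series/=; apply: bmC_sum => n.
  under eq_fun do rewrite exprMn -expiMn.
  by apply: bmCM; [exact: bmC_cst|apply: bmCM; [exact: bmC_cst|exact: bmC_expi]].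
pose b := a N * (r%:C) ^+ N.
have nb : normc b ^+ 2 = normc (a N) ^+ 2 * r ^+ (2 * N).
  by rewrite /b normcM normcX normc_real ger0_norm// exprMn -exprM mulnC.
have cross : cintegral circle (fun t => S t * expi (- (N%:R * t))) = 0.
  rewrite (@eq_cint _ _ _ (fun t => \sum_(0 <= n < N)
     (a n * r%:C ^+ n) * (expi (n%:R * t) * expi (- (N%:R * t))))); last first.
    move=> t _; rewrite /S /series/= mulr_suml; apply: eq_bigr => n _.
    by rewrite exprMn -expiMn; ring.
  rewrite cint_sum//; last first.
    move=> n; apply: bmCM; first exact: bmC_cst.
    by apply: bmCM; [exact: bmC_expi|exact: bmC_expiN].
  rewrite big_nat big1// => n /andP[_ nN].
  rewrite cintZ// ?cint_expi_orth ?mulr0//.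
  by apply: bmCM; [exact: bmC_expi|exact: bmC_expiN].
have bc : bmC (fun t => b^* * (S t * expi (- (N%:R * t)))).
  by apply: bmCM; [exact: bmC_cst|apply: bmCM => //; exact: bmC_expiN].
rewrite (@eq_I _ _ _ (fun t => normc (S t) ^+ 2 +
   (normc b ^+ 2 + 2 * complex.Re (b^* * (S t * expi (- (N%:R * t))))))); last first.
  move=> t _; have -> : series (fun n => a n * (r%:C * expi t) ^+ n) N.+1 = S t + b * expi (N%:R * t).
    by rewrite /S /series/= big_nat_recr//= exprMn -expiMn /b mulrA.
  rewrite expiN.
  have : normc (expi (N%:R * t)) ^+ 2 = 1 :> R by rewrite normc_expi expr1n.
  rewrite !sqr_normcE'; case: (S t) (b) (expi _) => [x y] [u v] [p q] /= h.
  have -> : u ^+ 2 + v ^+ 2 = (u ^+ 2 + v ^+ 2) * (p ^+ 2 + q ^+ 2) by rewrite h mulr1.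
  by ring.
rewrite ID//; [|exact: bmC_normc2|]; last first.
  by apply: bmD; [exact: bm_cst|apply: bmZ; case: bc].
rewrite IH ID//; [|exact: bm_cst|by apply: bmZ; case: bc].
rewrite Icst// fine_circle IZ//; last by case: bc.
have -> : \int[mu]_(t in circle) complex.Re (b^* * (S t * expi (- (N%:R * t)))) =
   complex.Re (cintegral circle (fun t => b^* * (S t * expi (- (N%:R * t))))) by [].
rewrite cintZ//; last by apply: bmCM => //; exact: bmC_expiN.
by rewrite cross mulr0 /= mulr0 addr0 big_nat_recr//= nb; ring.
Qed.

Lemma parseval a r : rc1 a -> 0 <= r < 1 ->
  (fun N => 2 * pi * \sum_(0 <= n < N) normc (a n) ^+ 2 * r ^+ (2 * n)) @ \oo -->
  \int[mu]_(t in circle) normc (psum a (r%:C * expi t)) ^+ 2.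
Proof.
move=> ra r01; have /andP[r0 r1] := r01.
have sr := rc1_summableR ra r01.
pose B := limn (series (fun n => normc (a n) * r ^+ n)).
under eq_fun do rewrite -parseval_fin//.
have SB N t : normc (series (fun n => a n * (r%:C * expi t) ^+ n) N) <= B.
  apply: le_trans (normc_sum _ _ _) _; under eq_bigr do rewrite psum_normcX//.
  apply: (@nondecreasing_cvgn_le _ (series (fun n => normc (a n) * r ^+ n))) => //.
  by apply: nondecreasing_series => n _ _; rewrite mulr_ge0 ?normc_ge0 ?exprn_ge0.
apply: (@I_dct R circle mcircle fcircle (fun N t => normc (series (fun n => a n * (r%:C * expi t) ^+ n) N) ^+ 2) _ (B ^+ 2)).
- move=> N; apply: bmC_normc2; rewrite /series/=; apply: bmC_sum => n.
  under eq_fun do rewrite exprMn -expiMn.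
  by apply: bmCM; [exact: bmC_cst|apply: bmCM; [exact: bmC_cst|exact: bmC_expi]].
- by apply: bmC_normc2; exact: bmC_psum_circle.
- move=> N t; rewrite ger0_norm ?sqr_ge0// lerXn2r ?nnegrE ?normc_ge0//.
  exact: le_trans (normc_ge0 _) (SB N t).
- apply: aeW => t _; have c : (fun N => (series (fun n => a n * (r%:C * expi t) ^+ n) N : R[i]^o)) @ \oo -->
     (psum a (r%:C * expi t) : R[i]^o).
    apply: csum_cvg; apply: rc1_summable => //.
    by rewrite normcM normc_expi mulr1 normc_real ger0_norm.
  by under eq_fun do rewrite expr2; rewrite expr2; apply: cvgM; exact: cvg_normc c.
Qed.

Lemma parseval_le a r N : rc1 a -> 0 <= r < 1 ->
  2 * pi * \sum_(0 <= n < N) normc (a n) ^+ 2 * r ^+ (2 * n) <=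
  \int[mu]_(t in circle) normc (psum a (r%:C * expi t)) ^+ 2.
Proof.
move=> ra r01; have /andP[r0 r1] := r01; have c := parseval ra r01.
rewrite -(cvg_lim (@Rhausdorff R) c).
apply: (@nondecreasing_cvgn_le _ (fun N => 2 * pi * \sum_(0 <= n < N) normc (a n) ^+ 2 * r ^+ (2 * n))).
  apply/nondecreasing_seqP => m; rewrite ler_wpM2l ?(ltW (pi2_gt0))//.
  by rewrite big_nat_recr//= lerDl mulr_ge0 ?sqr_ge0 ?exprn_ge0.
by apply/cvg_ex; eexists; exact: c.
Qed.

Lemma cauchy_estimate a r M n : rc1 a -> 0 <= r < 1 -> 0 <= M ->
  (forall t, normc (psum a (r%:C * expi t)) <= M) -> normc (a n) * r ^+ n <= M.
Proof.
move=> ra r01 M0 aM; have /andP[r0 r1] := r01.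
rewrite -(@ler_pXn2r _ 2)// ?nnegrE ?mulr_ge0 ?normc_ge0 ?exprn_ge0//.
rewrite -(@ler_pM2l _ (2 * pi)) ?pi2_gt0//.
apply: le_trans (_ : \int[mu]_(t in circle) normc (psum a (r%:C * expi t)) ^+ 2 <= _).
  apply: le_trans (parseval_le n.+1 ra r01).
  rewrite ler_wpM2l ?(ltW pi2_gt0)// big_nat_recr//= exprMn -exprM mulnC lerDr.
  by apply: sumr_ge0 => i _; rewrite mulr_ge0 ?sqr_ge0 ?exprn_ge0.
rewrite [leRHS]mulrC -[X in _ <= _ * X]fine_circle -Icst//; apply: I_le => //.
- by apply: bmC_normc2; exact: bmC_psum_circle.
- exact: bm_cst.
- by move=> t _; rewrite lerXn2r ?nnegrE ?normc_ge0.
Qed.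

(** If [x > M > 0] the powers of [x / M] outgrow [C]: an estimate up to a constant, valid for all
    powers, holds without the constant. *)
Lemma le_powers (x M C : R) : 0 <= M -> (forall k, x ^+ k.+1 <= C * M ^+ k.+1) -> x <= M.
Proof.
move=> M0 H; rewrite leNgt; apply/negP => Mx.
have [M00|Mp] := eqVneq M 0.
  by have := H 0%N; rewrite M00 !expr1 mulr0 leNgt -{1}M00 Mx.
have {}Mp : 0 < M by rewrite lt_neqAle eq_sym Mp.
pose h := x / M - 1.
have h0 : 0 < h by rewrite /h subr_gt0 ltr_pdivlMr// mul1r.
have C0 k : k.+1%:R * h <= C.
  apply: le_trans (mulrn_expr_le _ (ltW h0)) _.
  have -> : 1 + h = x / M by rewrite /h addrC subrK.
  by rewrite expr_div_n ler_pdivrMr ?exprn_gt0.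
have := C0 (Num.truncn (C / h)); rewrite leNgt => /negP; apply.
by rewrite -ltr_pdivrMr// truncnS_gt.
Qed.

(* Cauchy's estimate applied to all powers of [F] *)
Lemma max_principle F r M z : (forall w, normc w < 1 -> cderivable F w) -> 0 < r < 1 ->
  0 <= M -> (forall t, normc (F (r%:C * expi t)) <= M) -> normc z < r -> normc (F z) <= M.
Proof.
move=> dF r01 M0 FM zr; have /andP[r0 r1] := r01.
have r01' : 0 <= r < 1 by rewrite ltW.
(* The constant is the sum of the geometric series of ratio [|z| / r], the same for all powers of
   [F]. *)
apply: (@le_powers _ _ (1 - normc z / r)^-1) => // k.
have dFk w : normc w < 1 -> cderivable (fun w => F w ^+ k.+1) w.
  by move=> w1; apply: cderivableX; exact: dF.
have [a ra aE] := holomorphic_psum dFk.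
have z1 : normc z < 1 by exact: lt_trans r1.
have nr t : normc (r%:C * expi t) < 1.
  by rewrite normcM normc_expi mulr1 normc_real gtr0_norm.
have aM n : normc (a n) * r ^+ n <= M ^+ k.+1.
  apply: cauchy_estimate => //; first exact: exprn_ge0.
  by move=> t; rewrite -aE// normcX lerXn2r ?nnegrE ?normc_ge0.
have q1 : 0 <= normc z / r < 1.
  by rewrite divr_ge0 ?normc_ge0 ?(ltW r0)//= ltr_pdivrMr// mul1r.
rewrite -normcX (aE z z1) [_^-1 * _]mulrC -geo_lim//.
apply: csum_le; last exact: geo_cvg.
move=> n; rewrite normcM normcX expr_div_n mulrA ler_pdivlMr ?exprn_gt0//.
by rewrite mulrAC ler_wpM2r ?exprn_ge0 ?normc_ge0.
Qed.

End parseval.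

(** * Disk automorphisms, the identity theorem and the strict maximum principle *)

Section moebius.
Context {R : realType}.
Implicit Types (r : R) (z w : R[i]) (F : R[i] -> R[i]).

Definition moebius z w := (w + z) / (1 + z^* * w).

Lemma moebius_den z w : normc z < 1 -> normc w < 1 -> 1 + z^* * w != 0.
Proof.
move=> z1 w1; rewrite -normc_gt0.
have : normc (z^* * w) < 1.
  by rewrite normcM normc_conj mulr_ilt1 ?normc_ge0.
have := normcD (1 + z^* * w) (- (z^* * w)); rewrite addrK normc1 normcN; lra.
Qed.

Lemma moebius_disk z w : normc z < 1 -> normc w < 1 -> normc (moebius z w) < 1.
Proof.
move=> z1 w1; have d0 := moebius_den z1 w1.
rewrite /moebius normcM normcV ltr_pdivrMr ?normc_gt0// mul1r.
rewrite -(@ltr_pXn2r _ 2)// ?nnegrE ?normc_ge0// -subr_gt0.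
have -> : normc (1 + z^* * w) ^+ 2 - normc (w + z) ^+ 2 =
   (1 - normc w ^+ 2) * (1 - normc z ^+ 2).
  by rewrite !sqr_normcE'; case: z w {z1 w1 d0} => [x y] [u v] /=; ring.
by rewrite mulr_gt0// subr_gt0 expr_lt1 ?normc_ge0.
Qed.

Lemma moebius0 z : moebius z 0 = z.
Proof. by rewrite /moebius mulr0 addr0 divr1 add0r. Qed.

Lemma moebiusK z w : normc z < 1 -> normc w < 1 -> moebius z (moebius (- z) w) = w.
Proof.
move=> z1 w1; have nz1 : normc (- z) < 1 by rewrite normcN.
have d0 := moebius_den nz1 w1; have d1 := moebius_den z1 (moebius_disk nz1 w1).
move: d1; rewrite /moebius; rewrite cJN in d0 *.
move: z^* d0 => c d0 d1.
have zc : 1 - c * z != 0.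
  apply: contraNneq d1 => h.
  have -> : 1 + c * ((w - z) / (1 + - c * w)) = (1 - c * z) / (1 + - c * w) by field.
  by rewrite h mul0r.
have e : 1 + c * ((w - z) / (1 + - c * w)) = (1 - c * z) / (1 + - c * w) by field.
by rewrite e; field; rewrite d0 zc.
Qed.

Lemma cderivable_moebius z w : normc z < 1 -> normc w < 1 -> cderivable (moebius z) w.
Proof.
move=> z1 w1; apply: cderivableM.
  by apply: cderivableD; [exact: cderivable_id|exact: cderivable_cst].
apply: cderivableV; first exact: moebius_den.
apply: cderivableD; first exact: cderivable_cst.
by apply: cderivableM; [exact: cderivable_cst|exact: cderivable_id].
Qed.

Lemma psum_at0 (a : nat -> R[i]) : psum a 0 = a 0.
Proof.
rewrite /psum (@csum_fin _ _ 1); first by rewrite /series/= big_nat1 expr0 mulr1.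
by case=> // n _; rewrite exprS mul0r mulr0.
Qed.

(** Composing with [moebius z] recentres [F] at the origin, where vanishing on a small disc kills
    all Taylor coefficients. *)
Lemma identity_theorem F z (d : R) : (forall w, normc w < 1 -> cderivable F w) ->
  normc z < 1 -> 0 < d -> (forall w, normc w < 1 -> normc (w - z) < d -> F w = 0) ->
  forall w, normc w < 1 -> F w = 0.
Proof.
move=> dF z1 d0 F0.
have dG w : normc w < 1 -> cderivable (fun w => F (moebius z w)) w.
  move=> w1; apply: cderivable_comp; first exact: cderivable_moebius.
  by apply: dF; exact: moebius_disk.
have [a ra aE] := holomorphic_psum dG.
have n0 : normc (0 : R[i]) < 1 by rewrite normc0.
have [e e0 eP] := cderivable_cont_eps (cderivable_moebius z1 n0) d0.
have a0 n : a n = 0.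
  apply: (@psum0_coef _ _ (Num.min e 1) ra).
    by rewrite lt_min e0 ltr01/= ge_min lexx orbT.
  move=> w; rewrite lt_min => /andP[we w1]; rewrite -aE// F0//; first exact: moebius_disk.
  by rewrite -{2}(moebius0 z) eP// subr0.
move=> w w1; have nz1 : normc (- z) < 1 by rewrite normcN.
rewrite -(moebiusK z1 w1) (aE _ (moebius_disk nz1 w1)) /psum (@csum_fin _ _ 0).
  by rewrite /series/= big_geq.
by move=> n _; rewrite a0 mul0r.
Qed.

(** After recentring at [z] the constant coefficient has modulus 1; by Parseval on the circle of
    radius [1/2] a mean square of at most 1 leaves nothing for the other coefficients. *)
Lemma strict_max F z : (forall w, normc w < 1 -> cderivable F w) ->
  (forall w, normc w < 1 -> normc (F w) <= 1) -> normc z < 1 -> normc (F z) = 1 ->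
  forall w, normc w < 1 -> F w = F z.
Proof.
move=> dF F1 z1 Fz.
have dG w : normc w < 1 -> cderivable (fun w => F (moebius z w)) w.
  move=> w1; apply: cderivable_comp; first exact: cderivable_moebius.
  by apply: dF; exact: moebius_disk.
have [a ra aE] := holomorphic_psum dG.
have n0 : normc (0 : R[i]) < 1 by rewrite normc0.
have a0 : a 0%N = F z by rewrite -psum_at0 -aE// moebius0.
have h2 : 0 <= (2^-1 : R) < 1 by lra.
have an n : (0 < n)%N -> a n = 0.
  move=> np; apply/eqP; rewrite -normc_eq0 -sqrf_eq0; apply/eqP/le_anti; rewrite sqr_ge0 andbT.
  have h := parseval_le n.+1 ra h2.
  have : \int[@lebesgue_measure R]_(t in `[0, 2 * pi]) normc (psum a ((2^-1)%:C * expi t)) ^+ 2 <= 2 * pi * 1.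
    rewrite [leRHS]mulrC -[X in _ <= _ * X](@fine_circle R) -Icst; last exact: mcircle.
    apply: I_le; [exact: mcircle|exact: fcircle| |exact: bm_cst|].
      by apply: bmC_normc2; exact: bmC_psum_circle.
    move=> t _.
    have nt : normc ((2^-1)%:C * expi t) < 1 :> R.
      by rewrite normcM normc_expi mulr1 normc_real ger0_norm; lra.
    by rewrite -aE// exprn_ile1 ?normc_ge0// F1// moebius_disk.
  move=> /(le_trans h); rewrite ler_pM2l ?pi2_gt0//.
  rewrite big_nat_recr//= big_ltn// a0 Fz expr1n mul1r muln0 expr0.
  set S := \sum_(_ <= _ < _) _; have S0 : 0 <= S.
    by apply: sumr_ge0 => i _; rewrite mulr_ge0 ?sqr_ge0// exprn_ge0; lra.
  move=> hh; have : normc (a n) ^+ 2 * 2^-1 ^+ (2 * n) <= 0 by lra.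
  by rewrite pmulr_lle0// exprn_gt0; lra.
move=> w w1; have nz1 : normc (- z) < 1 by rewrite normcN.
rewrite -{1}(moebiusK z1 w1) (aE _ (moebius_disk nz1 w1)) /psum (@csum_fin _ _ 1).
  by rewrite /series/= big_nat1 expr0 mulr1 a0.
by move=> n np; rewrite an// mul0r.
Qed.

End moebius.

(** * Herglotz and Poisson integrals of bounded real functions *)

Section herglotz.
Context {R : realType}.
Implicit Types (s t r : R) (z w : R[i]) (F : R[i] -> R[i]) (v u : R -> R).
Local Notation mu := (@lebesgue_measure R).
Local Notation circle := (`[0%R, (2 * pi)%R]%classic : set R).
#[local] Hint Resolve mcircle fcircle : core.

(** [cexp (herg v z)] is the outer function with boundary modulus [exp v]: the kernel is the one in
    [outer], and its real part is [pois]. *)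
Definition herg v z : R[i] := ((2 * pi)^-1)%:C *
  cintegral circle (fun t => (expi t + z) / (expi t - z) * (v t)%:C).

Definition rpois v z : R := (2 * pi)^-1 * \int[mu]_(t in circle) (pois z t * v t).

Lemma herg_kernel z t : normc z < 1 -> (expi t + z) / (expi t - z) = 2 * szego z t - 1.
Proof.
move=> z1; have d0 := szego_den_neq0 t z1; have e0 := @expi_neq0 R t.
have -> : expi t + z = expi t * (1 + z * expi (- t)).
  by rewrite mulrDr mulr1 mulrCA -expiD subrr expi0 mulr1.
rewrite szego_den_expi /szego; move: (expi t) (z * _) e0 d0 => x y x0 y0.
by field; rewrite y0 x0.
Qed.

Lemma herg_psum v z : bm v -> normc z < 1 ->
  herg v z = 2 * psum (fourier (fun t => (v t)%:C)) z - fourier (fun t => (v t)%:C) 0.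
Proof.
move=> bv z1; have bvC := bmC_real bv; have bs := bmC_szego z1.
rewrite /herg (@eq_cint _ _ _ (fun t => 2 * (szego z t * (v t)%:C) - (v t)%:C)); last first.
  by move=> t _; rewrite herg_kernel//; ring.
have b2 : bmC (fun t => szego z t * (v t)%:C) by exact: bmCM.
rewrite cintB//; last by apply: bmCM => //; exact: bmC_cst.
rewrite cintZ// cint_szego//.
have v0 : cintegral circle (fun t => (v t)%:C) = (2 * pi)%:C * fourier (fun t => (v t)%:C) 0.
  rewrite /fourier realcV mulrA divff ?pi2C_neq0// mul1r.
  by apply: eq_cint => s _; rewrite mul0r oppr0 expi0 mulr1.
rewrite v0 realcV; move: (_%:C) (@pi2C_neq0 R) => P P0; by field.
Qed.

Lemma cderivable_ext F (G : R[i] -> R[i]) z : normc z < 1 ->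
  (forall w, normc w < 1 -> F w = G w) -> cderivable G z -> cderivable F z.
Proof.
move=> z1 FG /cderivableP[l lP]; apply/cderivableP; exists l => e e0.
have [d d0 dP] := lP e e0; exists (Num.min d (1 - normc z)).
  by rewrite lt_min d0 subr_gt0.
move=> h; rewrite lt_min => /andP[hd h1]; rewrite !FG//; first exact: dP.
by rewrite (le_lt_trans (normcD _ _))//; lra.
Qed.

Lemma cderivable_herg v z : bm v -> normc z < 1 -> cderivable (herg v) z.
Proof.
move=> bv z1; set f := fourier (fun t => (v t)%:C).
apply: (@cderivable_ext _ (fun w => 2 * psum f w + - f 0) _ z1).
  by move=> w w1; exact: herg_psum.
apply: cderivableD; last exact: cderivable_cst.
apply: cderivableM; first exact: cderivable_cst.
by apply: psum_cderivable => //; apply: rc1_fourier; exact: bmC_real.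
Qed.

Lemma Re_herg v z : bm v -> normc z < 1 -> complex.Re (herg v z) = rpois v z.
Proof.
move=> bv z1; rewrite /herg /rpois cReM /= mul0r subr0; congr (_ * _).
apply: eq_I => t _; rewrite herg_kernel// cReM/= mulr0 subr0; congr (_ * _).
have -> : pois z t = complex.Re (szego z t + (szego z t)^* - 1) by rewrite -poisE.
by case: (szego z t) => x y /=; ring.
Qed.

Lemma rpoisE v z : bm v -> (rpois v z)%:C = cpois (fun t => (v t)%:C) z.
Proof.
move=> bv; rewrite /cpois /rpois realcM -(cint_real mcircle); congr (_ * _).
by apply: eq_cint => t _; rewrite realcM.
Qed.

Lemma rpois_le v u z : bm v -> bm u -> normc z < 1 ->
  (forall t, v t <= u t) -> rpois v z <= rpois u z.
Proof.
move=> bv bu z1 vu; rewrite ler_wpM2l ?invr_ge0 ?(ltW pi2_gt0)//.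
apply: I_le => //; [exact: bmM (bm_pois z1) bv|exact: bmM (bm_pois z1) bu|].
by move=> t _; rewrite ler_wpM2l// pois_ge0.
Qed.

Lemma rpoisD v u z : bm v -> bm u -> normc z < 1 ->
  rpois (fun t => v t + u t) z = rpois v z + rpois u z.
Proof.
move=> bv bu z1; have bp := bm_pois z1; rewrite /rpois -mulrDr -(ID mcircle fcircle (bmM bp bv) (bmM bp bu)).
by congr (_ * _); apply: eq_I => t _; rewrite mulrDr.
Qed.

Lemma rpoisZ c v z : bm v -> normc z < 1 ->
  rpois (fun t => c * v t) z = c * rpois v z.
Proof.
move=> bv z1; have bp := bm_pois z1; rewrite /rpois mulrCA -(IZ mcircle fcircle c (bmM bp bv)).
by congr (_ * _); apply: eq_I => t _; ring.
Qed.

Lemma rpois_cst c z : normc z < 1 -> rpois (fun=> c) z = c.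
Proof.
move=> z1; apply: complexI; rewrite rpoisE; last exact: bm_cst.
exact: cpois_cst.
Qed.

Lemma rpois_dct (u : nat -> R -> R) v (M : R) z : normc z < 1 ->
  (forall n, bm (u n)) -> bm v -> (forall n t, `|u n t| <= M) ->
  {ae mu, forall t, circle t -> (fun n => u n t) @ \oo --> v t} ->
  (fun n => rpois (u n) z) @ \oo --> rpois v z.
Proof.
move=> z1 bu bv uM uv; have bp := bm_pois z1; have [_ [P pP]] := bp.
apply: cvgMl_tmp; apply: (@I_dct R circle mcircle fcircle (fun n t => pois z t * u n t) _ (P * M)).
- by move=> n; exact: bmM.
- exact: bmM.
- by move=> n t; rewrite normrM ler_pM.
- by apply: aeS uv => t + ti => /(_ ti) h; exact: cvgMl_tmp.
Qed.

(** The Poisson kernel is a probability density, and [exp] lies above its tangent line at [m], whose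
    Poisson integral is [exp m]. *)
Lemma rpois_jensen v z : bm v -> bm (fun t => expR (v t)) -> normc z < 1 ->
  expR (rpois v z) <= rpois (fun t => expR (v t)) z.
Proof.
move=> bv be z1; set m := rpois v z.
have -> : expR m = rpois (fun t => expR m * (1 - m) + expR m * v t) z.
  by rewrite (rpoisD (bm_cst _) (bmZ _ bv) z1) (rpoisZ _ bv z1) rpois_cst// -/m; ring.
apply: rpois_le => //; first by apply: bmD; [exact: bm_cst|exact: bmZ].
move=> t; have -> : expR (v t) = expR m * expR (v t - m) by rewrite -expRD addrC subrK.
rewrite -mulrDr ler_wpM2l ?expR_ge0//.
by apply: le_trans (expR_ge1Dx _); lra.
Qed.

(* [L x <= e + L^2 x^2 / (4 e)] turns a Lipschitz bound into the hypothesis of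
   [poisson_approx]. *)
Lemma rpois_approx v (L e rho : R) t : bm v -> 0 < e -> 0 <= L -> 0 <= rho < 1 ->
  (forall s, `|v s - v t| <= L * normc (expi s - expi t)) ->
  `|rpois v (rho%:C * expi t) - v t| <= e + L ^+ 2 / e * (1 - rho ^+ 2).
Proof.
move=> bv e0 L0 rho1 vL.
have K0 : 0 <= L ^+ 2 / (4 * e) by rewrite divr_ge0 ?sqr_ge0// mulr_ge0// ltW.
have H s : 0 <= s <= 2 * pi -> normc ((v s)%:C - (v t)%:C) <=
    e + L ^+ 2 / (4 * e) * normc (expi s - expi t) ^+ 2.
  move=> _; rewrite -realcB normc_real; apply: le_trans (vL s) _.
  set x := normc _.
  have -> : e + L ^+ 2 / (4 * e) * x ^+ 2 = L * x + (e - L * x / 2) ^+ 2 / e.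
    by field; rewrite gt_eqF.
  by rewrite lerDl divr_ge0 ?sqr_ge0// ltW.
have := poisson_approx (bmC_real bv) rho1 K0 H.
rewrite -rpoisE// -realcB normc_real.
by have -> : 4 * (L ^+ 2 / (4 * e)) = L ^+ 2 / e by field; rewrite gt_eqF.
Qed.

End herglotz.

(** * Poisson majorants on circles inside the disk *)

Section subharmonic.
Context {R : realType}.
Implicit Types (s t r : R) (z w : R[i]) (F : R[i] -> R[i]) (v u : R -> R).
Local Notation mu := (@lebesgue_measure R).
Local Notation circle := (`[0%R, (2 * pi)%R]%classic : set R).
#[local] Hint Resolve mcircle fcircle : core.

Lemma subX_le z w n : normc z <= 1 -> normc w <= 1 ->
  normc (z ^+ n - w ^+ n) <= n%:R * normc (z - w).
Proof.
move=> z1 w1; elim: n => [|n IH]; first by rewrite !expr0 subrr normc0 mul0r.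
have -> : z ^+ n.+1 - w ^+ n.+1 = z * (z ^+ n - w ^+ n) + (z - w) * w ^+ n.
  by rewrite !exprS; ring.
apply: le_trans (normcD _ _) _; rewrite !normcM normcX -natr1 mulrDl mul1r.
apply: lerD.
  by apply: le_trans IH; rewrite ler_piMl ?normc_ge0.
by rewrite ler_piMr ?normc_ge0// exprn_ile1 ?normc_ge0.
Qed.

(** [L] sums [n |a n| r^n], since [|z^n - w^n| <= n |z - w|] in the closed unit disk. *)
Lemma psum_lip (a : nat -> R[i]) r : rc1 a -> 0 <= r < 1 -> exists2 L, 0 <= L &
  forall z w, normc z <= 1 -> normc w <= 1 ->
  normc (psum a (r%:C * z) - psum a (r%:C * w)) <= L * normc (z - w).
Proof.
move=> ra r01; have /andP[r0 r1] := r01.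
have sr := rc1_summableR (rc1_muln ra) r01.
set L := limn _ in sr.
have L0 : 0 <= L.
  apply: limr_ge => //; apply: nearW => n; rewrite /series/=; apply: sumr_ge0 => k _.
  by rewrite mulr_ge0 ?normc_ge0 ?exprn_ge0.
exists L => // z w z1 w1.
have nr x : normc x <= 1 -> normc (r%:C * x) < 1.
  move=> u1; rewrite normcM normc_real ger0_norm//; apply: le_lt_trans r1.
  by rewrite ler_piMr.
have s1 := rc1_summable ra (nr z z1); have s2 := rc1_summable ra (nr w w1).
have -> : psum a (r%:C * z) - psum a (r%:C * w) =
    csum (fun n => a n * r%:C ^+ n * (z ^+ n - w ^+ n)).
  rewrite [X in _ = csum X](_ : _ = fun n => a n * (r%:C * z) ^+ n + -1 * (a n * (r%:C * w) ^+ n)).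
    by rewrite csumD//; [rewrite csumZ// mulN1r|exact: csummableZ].
  by apply/funext => n; rewrite !exprMn; ring.
have -> : L * normc (z - w) = limn (series (fun n => normc (z - w) * (normc (n%:R * a n) * r ^+ n))).
  apply/esym/cvg_lim; first exact: Rhausdorff.
  have -> : series (fun n => normc (z - w) * (normc (n%:R * a n) * r ^+ n)) =
     (fun n => normc (z - w) * series (fun n => normc (n%:R * a n) * r ^+ n) n).
    by apply/funext => n; rewrite /series/= mulr_sumr.
  by rewrite mulrC; apply: cvgMl_tmp.
apply: csum_le.
  move=> n; rewrite !normcM normcX normc_real (ger0_norm r0).
  have -> : normc (n%:R : R[i]) = n%:R.
    by rewrite -(rmorph_nat (real_complex R)) normc_real ger0_norm.
  have -> : normc (z - w) * (n%:R * normc (a n) * r ^+ n) =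
     normc (a n) * r ^+ n * (n%:R * normc (z - w)) by ring.
  by rewrite ler_wpM2l ?mulr_ge0 ?normc_ge0 ?exprn_ge0// subX_le.
have -> : series (fun n => normc (z - w) * (normc (n%:R * a n) * r ^+ n)) =
     (fun n => normc (z - w) * series (fun n => normc (n%:R * a n) * r ^+ n) n).
  by apply/funext => n; rewrite /series/= mulr_sumr.
exact: is_cvgMl_tmp.
Qed.

(** Truncation at [d] gives the logarithm the Lipschitz constant that [rpois_approx] asks for. *)
Lemma ln_max_lip (x y d : R) : 0 < d ->
  `|ln (Num.max x d) - ln (Num.max y d)| <= `|x - y| / d.
Proof.
move=> d0.
have key x' y' : ln (Num.max x' d) - ln (Num.max y' d) <= `|x' - y'| / d.
  have mx : 0 < Num.max x' d by rewrite lt_max d0 orbT.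
  have my : 0 < Num.max y' d by rewrite lt_max d0 orbT.
  have dmy : d <= Num.max y' d by rewrite le_max lexx orbT.
  rewrite -ln_div ?posrE//.
  have -> : Num.max x' d / Num.max y' d = 1 + (Num.max x' d - Num.max y' d) / Num.max y' d.
    by field; rewrite gt_eqF.
  apply: le_trans (le_ln1Dx _) _.
    by rewrite mulrBl divff ?gt_eqF// ltrBrDl subrr divr_gt0.
  apply: (@le_trans _ _ (`|x' - y'| / Num.max y' d)).
    rewrite ler_pM2r ?invr_gt0//.
    have [h|h] := leP x' d; have [h'|h'] := leP y' d; rewrite ?subrr ?normr_ge0//.
    - by have := normr_ge0 (x' - y'); lra.
    - by have := ler_norm (x' - y'); lra.
    - exact: ler_norm.
  by rewrite ler_wpM2l// lef_pV2 ?posrE.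
rewrite ler_norml key andbT lerNl opprB distrC; exact: key.
Qed.

Lemma bm_ln_max v d : bm v -> 0 < d -> bm (fun t => ln (Num.max (v t) d)).
Proof.
move=> bv d0; have [mm _] := bm_max bv (bm_cst d); have [_ [M vM]] := bv.
split; first exact: (measurableT_comp (@measurable_ln R)).
exists (Num.max (ln (Num.max M d)) (- ln d)) => t.
have m0 : 0 < Num.max (v t) d by rewrite lt_max d0 orbT.
have h1 : ln d <= ln (Num.max (v t) d) by rewrite ler_ln ?posrE// le_max lexx orbT.
have h2 : ln (Num.max (v t) d) <= ln (Num.max M d).
  rewrite ler_ln ?posrE// ?lt_max ?d0 ?orbT// ge_max !le_max lexx orbT andbT.
  by rewrite (le_trans (ler_norm _) (vM t)).
by rewrite ler_norml le_max h2/= andbT lerNl le_max lerN2 h1 orbT.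
Qed.

Lemma expR_small_le1 (x : R) : (forall e, 0 < e -> x <= expR (2 * e)) -> x <= 1.
Proof.
move=> H; rewrite leNgt; apply/negP => x1.
have x0 : 0 < x by exact: lt_trans x1.
have := H (ln x / 4); rewrite divr_gt0 ?ln_gt0// => /(_ isT).
rewrite leNgt => /negP; apply; rewrite -{2}(lnK x0) ltr_expR.
have : 0 < ln x by rewrite ln_gt0.
lra.
Qed.

Lemma dil_arith (p w l q e eta q2 : R) : `|p - w| <= e + q * q2 ->
  q * q2 <= q * (2 * eta) -> eta * (2 * q + l) <= e -> w + l * eta + - p <= 2 * e.
Proof.
rewrite ler_norml => /andP[h _].
have -> : eta * (2 * q + l) = q * (2 * eta) + l * eta by ring.
lra.
Qed.

(* Compare [F (r .)] with the outer function with boundary modulus [|F (r .)|]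
   truncated from below. *)
Lemma subharmonic_dilation F r d z : (forall w, normc w < 1 -> cderivable F w) ->
  0 < r < 1 -> 0 < d -> normc z < 1 ->
  bm (fun t => ln (Num.max (normc (F (r%:C * expi t))) d)) /\
  normc (F (r%:C * z)) <=
    expR (rpois (fun t => ln (Num.max (normc (F (r%:C * expi t))) d)) z).
Proof.
move=> dF r01 d0 z1; have /andP[r0 r1] := r01.
have r01' : 0 <= r < 1 by rewrite ltW.
have [a ra aE] := holomorphic_psum dF.
have nr t : normc (r%:C * expi t) < 1.
  by rewrite normcM normc_expi mulr1 normc_real gtr0_norm.
have bF : bmC (fun t => F (r%:C * expi t)).
  by under eq_fun do rewrite aE//; exact: bmC_psum_circle.
pose v t := ln (Num.max (normc (F (r%:C * expi t))) d).
have bv : bm v by exact: bm_ln_max (bmC_normc bF) d0.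
split => //; rewrite -/v.
have [L L0 LP] := psum_lip ra r01'.
have FL w1 w2 : normc w1 <= 1 -> normc w2 <= 1 ->
    normc (F (r%:C * w1) - F (r%:C * w2)) <= L * normc (w1 - w2).
  have nr' y' : normc y' <= 1 -> normc (r%:C * y') < 1.
    move=> u1; rewrite normcM normc_real gtr0_norm//; apply: le_lt_trans r1.
    by rewrite ler_piMr// ltW.
  by move=> hx hy; rewrite (aE _ (nr' _ hx)) (aE _ (nr' _ hy)); exact: LP.
have vL s t : `|v s - v t| <= L / d * normc (expi s - expi t).
  apply: le_trans (ln_max_lip _ _ d0) _.
  rewrite mulrAC ler_wpM2r ?invr_ge0 ?(ltW d0)//.
  by apply: le_trans (normc_dist _ _) _; apply: FL; rewrite normc_expi.
have Ld0 : 0 <= L / d by rewrite divr_ge0// ltW.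
(* The quotient by the outer function. It is bounded by [exp (2 e)] on a circle of radius [1 - eta]
   enclosing [z], hence at [z] by the maximum principle. *)
pose f w := F (r%:C * w) * cexp (- herg v w).
have nrw w : normc w < 1 -> normc (r%:C * w) < 1.
  move=> w1; rewrite normcM normc_real gtr0_norm//.
  by rewrite -[ltRHS]mul1r ltr_pM ?normc_ge0 ?(ltW r0).
have df w : normc w < 1 -> cderivable f w.
  move=> w1; apply: cderivableM.
    apply: (@cderivable_comp _ (fun w => r%:C * w)); last by apply: dF; exact: nrw.
    by apply: cderivableM; [exact: cderivable_cst|exact: cderivable_id].
  apply: (@cderivable_comp _ (fun w => - herg v w)); last exact: cderivable_cexp.
  have -> : (fun w => - herg v w) = (fun w => -1 * herg v w).
    by apply/funext => x; rewrite mulN1r.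
  by apply: cderivableM; [exact: cderivable_cst|exact: cderivable_herg].
have nf w : normc w < 1 -> normc (f w) = normc (F (r%:C * w)) * expR (- rpois v w).
  by move=> w1; rewrite /f normcM normc_cexp cReN Re_herg.
suff : normc (f z) <= 1.
  by rewrite nf// expRN ler_pdivrMr ?expR_gt0// mul1r.
apply: expR_small_le1 => e e0.
(* The errors proportional to [eta]: the first comes from [1 - rho^2 <= 2 eta] in [rpois_approx],
   the second from moving the argument of [F] by [eta] off the circle. *)
pose C := 2 * ((L / d) ^+ 2 / e) + L / d.
have C0 : 0 <= C by rewrite addr_ge0// mulr_ge0// divr_ge0 ?sqr_ge0// ltW.
have [eta [eta0 eta1 etaC]] : exists eta, [/\ 0 < eta, eta < 1 - normc z & eta * C <= e].
  have C1 : 0 < C + 1 by lra.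
  exists (Num.min ((1 - normc z) / 2) (e / (C + 1))); split.
  - by rewrite lt_min !divr_gt0// subr_gt0.
  - by rewrite (@le_lt_trans _ _ ((1 - normc z) / 2))//; [rewrite ge_min lexx|lra].
  - apply: le_trans (_ : e / (C + 1) * C <= _).
      by rewrite ler_wpM2r// ge_min lexx orbT.
    by rewrite mulrAC ler_pdivrMr// ler_wpM2l ?(ltW e0)//; lra.
pose rho := 1 - eta.
have nz0 := normc_ge0 z.
have rho01 : 0 < rho < 1 by rewrite /rho; lra.
have rho01' : 0 <= rho < 1 by case/andP: rho01 => ? ?; rewrite ltW.
apply: (max_principle df rho01 (expR_ge0 _)); last by rewrite /rho; lra.
move=> t; have n1 : normc (rho%:C * expi t) = rho.
  by rewrite normcM normc_expi mulr1 normc_real gtr0_norm//; case/andP: rho01.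
have n1' : normc (rho%:C * expi t) < 1 by rewrite n1; case/andP: rho01.
rewrite nf//.
have A := rpois_approx bv e0 Ld0 rho01' (fun s => vL s t).
have B : normc (F (r%:C * (rho%:C * expi t))) <= expR (v t) * (1 + L / d * eta).
  have m0 : 0 < Num.max (normc (F (r%:C * expi t))) d by rewrite lt_max d0 orbT.
  have Ev : expR (v t) = Num.max (normc (F (r%:C * expi t))) d by rewrite /v lnK.
  have h1 : normc (F (r%:C * expi t)) <= expR (v t) by rewrite Ev le_max lexx.
  have h2 : d <= expR (v t) by rewrite Ev le_max lexx orbT.
  have h3 : normc (F (r%:C * (rho%:C * expi t)) - F (r%:C * expi t)) <= L * eta.
    apply: le_trans (FL _ _ _ _) _; rewrite ?normc_expi ?(ltW n1')//.
    have -> : rho%:C * expi t - expi t = - (eta%:C * expi t) by rewrite /rho realcB; ring.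
    by rewrite normcN normcM normc_expi mulr1 normc_real gtr0_norm.
  have h4 : L * eta <= expR (v t) * (L / d * eta).
    have -> : L * eta = d * (L / d * eta) by field; rewrite gt_eqF.
    by rewrite ler_wpM2r// mulr_ge0// ltW.
  have -> : F (r%:C * (rho%:C * expi t)) = F (r%:C * expi t) +
    (F (r%:C * (rho%:C * expi t)) - F (r%:C * expi t)) by rewrite addrC subrK.
  apply: le_trans (normcD _ _) _; rewrite mulrDr mulr1; apply: lerD => //.
  exact: le_trans h3 h4.
apply: le_trans (ler_wpM2r (expR_ge0 _) B) _.
have B2 : 1 + L / d * eta <= expR (L / d * eta) by exact: expR_ge1Dx.
apply: (@le_trans _ _ (expR (v t) * expR (L / d * eta) * expR (- rpois v (rho%:C * expi t)))).
  by rewrite ler_wpM2r ?expR_ge0// ler_wpM2l ?expR_ge0.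
rewrite -!expRD ler_expR.
have rr : 1 - rho ^+ 2 <= 2 * eta.
  by have := sqr_ge0 eta; rewrite /rho; nra.
have A2 : (L / d) ^+ 2 / e * (1 - rho ^+ 2) <= (L / d) ^+ 2 / e * (2 * eta).
  by rewrite ler_wpM2l// divr_ge0 ?sqr_ge0// ltW.
exact: dil_arith A A2 etaC.
Qed.

End subharmonic.

(** * Radial limits and the boundary log-modulus *)

Section boundary_values.
Context {R : realType}.
Implicit Types (s t r : R) (z w : R[i]) (F : R[i] -> R[i]) (v : R -> R).
Local Notation mu := (@lebesgue_measure R).
Local Notation circle := (`[0%R, (2 * pi)%R]%classic : set R).
#[local] Hint Resolve mcircle fcircle : core.

(** A sequence of radii, as dominated convergence asks for; with [k.+2] the first one is [1/2] and
    none is 0. *)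
Definition dilation (k : nat) : R := 1 - k.+2%:R^-1.

Lemma radius_itv k : 0 < dilation k < 1.
Proof.
rewrite /dilation subr_gt0 invf_lt1// ltr1n/= ltrBlDr ltrDl invr_gt0.
by rewrite ltr0n.
Qed.

Lemma radius_cvg : dilation @ \oo --> (1 : R).
Proof.
rewrite -[X in _ --> X](subr0 1); apply: cvgB; first exact: cvg_cst.
apply/cvgrPdist_lt => e e0.
exists (Num.truncn e^-1) => // k /= hk.
rewrite sub0r normrN ger0_norm ?invr_ge0//.
rewrite invf_plt ?posrE//; apply: lt_le_trans (truncnS_gt _) _.
by rewrite ler_nat ltnS leqW.
Qed.

Lemma radius_cvg_at F z : normc z <= 1 -> cderivable F z ->
  (fun k => normc (F ((dilation k)%:C * z))) @ \oo --> normc (F z).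
Proof.
move=> z1 dF.
suff h : (fun k => (F ((dilation k)%:C * z) : R[i]^o)) @ \oo --> (F z : R[i]^o).
  exact: cvg_normc h.
apply/cvg_normcP/cvgrPdist_lt => e e0.
have [d d0 dP] := cderivable_cont_eps dF e0.
have /cvgrPdist_lt/(_ _ d0)[N _ NP] := radius_cvg.
exists N => // k /NP /= h; rewrite sub0r normrN ger0_norm ?normc_ge0// dP//.
have -> : (dilation k)%:C * z - z = - ((1 - dilation k)%:C * z) by rewrite (realcB 1 (dilation k)) mulrBl opprB (_ : 1%:C = 1)// mul1r.
rewrite normcN normcM normc_real; apply: le_lt_trans h.
by rewrite ler_piMr.
Qed.

Lemma cvg_maxr (x : nat -> R) (l c : R) : x @ \oo --> l ->
  (fun k => Num.max (x k) c) @ \oo --> Num.max l c.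
Proof.
move=> xl; apply: (cvg_comp x (fun y => Num.max y c) xl).
by apply: (@continuous_max _ R^o id (cst c)); [exact: cvg_id|exact: cst_continuous].
Qed.

(** [subharmonic_dilation] on the circles of radius [dilation k], then dominated convergence. The
    majorant [max (vk, v)] tends to [v] almost everywhere, although the limit of [vk] may be
    smaller. *)
Lemma boundary_majorant F v (M : R) z : (forall w, normc w < 1 -> cderivable F w) ->
  (forall w, normc w < 1 -> normc (F w) <= M) -> bm v ->
  {ae mu, forall t, circle t -> exists2 l : R,
     (fun k => normc (F ((dilation k)%:C * expi t))) @ \oo --> l & l <= expR (v t)} ->
  normc z < 1 -> normc (F z) <= expR (rpois v z).
Proof.
move=> dF FM bv Fv z1; have [_ [V vV]] := bv.
(* Truncating at [exp (- V) <= exp v] cannot lift the limit of [vk] above [v]. *)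
pose d := expR (- V); have d0 : 0 < d by rewrite expR_gt0.
pose vk k t := ln (Num.max (normc (F ((dilation k)%:C * expi t))) d).
have sub k := subharmonic_dilation dF (radius_itv k) d0 z1.
have bvk k : bm (vk k) := (sub k).1.
pose u k t := Num.max (vk k t) (v t).
have bu k : bm (u k) by exact: bm_max.
have nr k t : normc ((dilation k)%:C * expi t) < 1.
  have /andP[r0 r1] := radius_itv k.
  by rewrite normcM normc_expi mulr1 normc_real gtr0_norm.
have vkM k t : vk k t <= ln (Num.max M d).
  rewrite ler_ln ?posrE ?lt_max ?d0 ?orbT//.
  by rewrite ge_max !le_max lexx orbT FM.
have uM k t : `|u k t| <= Num.max (ln (Num.max M d)) V.
  have := vV t; rewrite ler_norml => /andP[v1 v2].
  rewrite ler_norml; apply/andP; split.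
    by rewrite lerNl; apply: (@le_trans _ _ V); [rewrite lerNl le_max v1 orbT|rewrite le_max lexx orbT].
  by rewrite ge_max !le_max vkM v2 orbT.
have uv : {ae mu, forall t, circle t -> (fun k => u k t) @ \oo --> v t}.
  apply: aeS Fv => t H ti; have [l Fl lv] := H ti.
  have c1 : (fun k => Num.max (normc (F ((dilation k)%:C * expi t))) d) @ \oo --> Num.max l d.
    exact: cvg_maxr.
  have m0 : 0 < Num.max l d by rewrite lt_max d0 orbT.
  have c2 : (fun k => vk k t) @ \oo --> ln (Num.max l d).
    by by apply: (cvg_comp _ _ c1); exact: continuous_ln.
  have lnv : ln (Num.max l d) <= v t.
    rewrite -ler_expR lnK// ge_max lv /d ler_expR.
    by have := vV t; rewrite ler_norml => /andP[].
  rewrite -[X in _ --> X](max_idPr lnv).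
  exact: cvg_maxr.
have c1 : (fun k => expR (rpois (u k) z)) @ \oo --> expR (rpois v z).
  by apply: (cvg_comp _ _ (rpois_dct z1 bu bv uM uv)); exact: continuous_expR.
have c2 := radius_cvg_at (ltW z1) (dF z z1).
rewrite -(cvg_lim (@Rhausdorff R) c1) -(cvg_lim (@Rhausdorff R) c2).
apply: ler_lim.
- by apply/cvg_ex; eexists; exact: c2.
- by apply/cvg_ex; eexists; exact: c1.
- apply: nearW => k; have [_ h] := sub k; apply: le_trans h _.
  rewrite ler_expR; apply: (rpois_le (bvk k) (bu k) z1) => t.
  by rewrite /u le_max lexx.
Qed.

(* Outside its domain of convergence [lim] is [0], so a nonzero value of
   [radial_lim] is a genuine limit. *)
Lemma radial_lim_cvg F t : radial_lim F t != 0 ->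
  (fun k => normc (F ((dilation k)%:C * expi t))) @ \oo --> normc (radial_lim F t).
Proof.
rewrite /radial_lim; set G := (X in lim X) => l0.
have [cG|ncG] := pselect (cvg G); last first.
  have lim0 : lim G = (point : R[i]^o).
    by apply: xgetPN => x Gx; apply: ncG; apply/cvg_ex; exists x.
  by move: l0; rewrite lim0 => /eqP; case.
have cG2 : ((F (r%:C * expi t) : R[i]^o) @[r --> (1 : R)^'-]) --> (lim G : R[i]^o).
  exact: cG.
have cN : (normc (F (r%:C * expi t)) @[r --> (1 : R)^'-]) --> normc (lim G).
  exact: cvg_normc cG2.
apply: (proj1 (cvg_at_leftP _ _ _) cN); split; last exact: radius_cvg.
by move=> n; case/andP: (radius_itv n).
Qed.

Lemma ae_circleP (P : R -> Prop) : ae_circle P -> {ae mu, forall t, circle t -> P t}.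
Proof.
move=> H.
have H2 : {ae mu, forall t : R, t != 2 * pi}.
  exists [set 2 * pi : R]; split; [exact: measurable_set1|exact: lebesgue_measure_set1|].
  by move=> t /= /negP; rewrite negbK => /eqP.
apply: aeS2 H H2 => t Ht tn; rewrite /= in_itv/= => /andP[t0 t1]; apply: Ht.
by rewrite in_itv/= t0 lt_neqAle tn.
Qed.

Lemma radial_lim_le F t (M : R) : (forall w, normc w < 1 -> normc (F w) <= M) ->
  radial_lim F t != 0 -> normc (radial_lim F t) <= M.
Proof.
move=> FM l0; have c := radial_lim_cvg l0.
rewrite -(cvg_lim (@Rhausdorff R) c); apply: limr_le.
  by apply/cvg_ex; eexists; exact: c.
apply: nearW => k; apply: FM; have /andP[r0 r1] := radius_itv k.
by rewrite normcM normc_expi mulr1 normc_real gtr0_norm.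
Qed.

Lemma boundary_log F1 F2 (M p q : R) : 0 < p -> 0 < q ->
  (forall w, normc w < 1 -> cderivable F1 w) ->
  (forall w, normc w < 1 -> normc (F1 w) <= M) ->
  (forall w, normc w < 1 -> normc (F2 w) <= M) ->
  ae_circle (fun t => normc (radial_lim F1 t) `^ p * normc (radial_lim F2 t) `^ q = 1) ->
  exists2 v, bm v & {ae mu, forall t, circle t ->
    normc (radial_lim F1 t) = expR (v t) /\ normc (radial_lim F2 t) = expR (- (p / q) * v t)}.
Proof.
move=> p0 q0 dF1 F1M F2M /ae_circleP H.
wlog M1 : M F1M F2M / 1 <= M.
  move=> W; apply: (W (Num.max M 1)); last by rewrite le_max lexx orbT.
    by move=> w w1; rewrite le_max F1M.
  by move=> w w1; rewrite le_max F2M.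
have M0 : 0 < M by exact: lt_le_trans M1.
(* The lower bound for [ln n1] that [n2 <= M] imposes through [p ln n1 + q ln n2 = 0]. *)
pose A := - (q / p * ln M); pose d := expR A.
have d0 : 0 < d by rewrite expR_gt0.
pose vk k t := ln (Num.max (normc (F1 ((dilation k)%:C * expi t))) d).
have z0 : normc (0 : R[i]) < 1 by rewrite normc0.
have bvk k : bm (vk k) := (subharmonic_dilation dF1 (radius_itv k) d0 z0).1.
have nr k t : normc ((dilation k)%:C * expi t) < 1.
  have /andP[r0 r1] := radius_itv k.
  by rewrite normcM normc_expi mulr1 normc_real gtr0_norm.
have lnM0 : 0 <= ln M by rewrite ln_ge0.
have AM : A <= ln M.
  have : 0 <= q / p * ln M by rewrite mulr_ge0// divr_ge0// ltW.
  by rewrite /A; lra.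
have vkA k t : A <= vk k t.
  by rewrite -[leLHS]expRK ler_ln ?posrE ?lt_max ?d0 ?orbT// le_max lexx orbT.
have vkM k t : vk k t <= ln M.
  rewrite ler_ln ?posrE ?lt_max ?d0 ?orbT// ge_max (F1M _ (nr k t))/=.
  by rewrite -(lnK M0) ler_expR.
(* A measurable function of all [t], equal to the limit of [vk] wherever that limit exists. *)
pose w t := limn_sup (fun k => vk k t).
have mw : measurable_fun [set: R] w.
  apply: (@measurable_fun_limn_sup _ _ R setT vk).
  - by move=> t' _; exists (ln M) => _ [j _ <-]; exact: vkM.
  - by move=> t' _; exists A => _ [j _ <-]; exact: vkA.
  - by move=> j; case: (bvk j).
exists (fun t => clampR A (ln M) (w t)).
  split.
    by apply: (measurableT_comp (continuous_measurable_fun (@continuous_clampR R A (ln M)))).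
  exists (Num.max (ln M) (- A)) => t; have /andP[h1 h2] := clampR_itv (w t) AM.
  by rewrite ler_norml lerNl !le_max h2 lerN2 h1 orbT.
apply: aeS H => t Ht ti; have {Ht} := Ht ti.
set n1 := normc (radial_lim F1 t); set n2 := normc (radial_lim F2 t) => E.
have n10 : n1 != 0.
  apply/eqP => n0; move: E; rewrite n0 powR0 ?gt_eqF// mul0r => /esym/eqP.
  by rewrite oner_eq0.
have n20 : n2 != 0.
  apply/eqP => n0; move: E; rewrite n0 powR0 ?gt_eqF// mulr0 => /esym/eqP.
  by rewrite oner_eq0.
have r10 : radial_lim F1 t != 0 by rewrite -normc_eq0.
have r20 : radial_lim F2 t != 0 by rewrite -normc_eq0.
have n1p : 0 < n1 by rewrite normc_gt0.
have n2p : 0 < n2 by rewrite normc_gt0.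
have n1M : n1 <= M by exact: radial_lim_le.
have n2M : n2 <= M by exact: radial_lim_le.
have lnE : p * ln n1 + q * ln n2 = 0.
  by rewrite -!ln_powR -lnM ?posrE ?powR_gt0// E ln1.
have l1M : ln n1 <= ln M by rewrite ler_ln ?posrE.
have l2M : ln n2 <= ln M by rewrite ler_ln ?posrE.
have lA : A <= ln n1.
  have -> : ln n1 = - (q / p * ln n2).
    have -> : ln n1 = (p * ln n1) / p by rewrite mulrAC divff ?mul1r// gt_eqF.
    have -> : p * ln n1 = - (q * ln n2) by lra.
    by field; rewrite gt_eqF.
  by rewrite /A lerN2 ler_wpM2l// divr_ge0// ltW.
have dn1 : d <= n1 by rewrite /d -(lnK n1p) ler_expR.
have wE : w t = ln n1.
  have c : (fun k => Num.max (normc (F1 ((dilation k)%:C * expi t))) d) @ \oo --> Num.max n1 d.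
    by apply: cvg_maxr; exact: radial_lim_cvg.
  have c2 : (fun k => vk k t) @ \oo --> ln (Num.max n1 d).
    by apply: (cvg_comp _ _ c); apply: continuous_ln; rewrite lt_max n1p.
  by rewrite /w ((cvg_limn_inf_sup c2).2) (max_idPl dn1).
rewrite wE clampR_id ?lA//; split; first by rewrite lnK.
have -> : - (p / q) * ln n1 = ln n2.
  have -> : ln n2 = (q * ln n2) / q by rewrite mulrAC divff ?mul1r// gt_eqF.
  have -> : q * ln n2 = - (p * ln n1) by lra.
  by field; rewrite gt_eqF.
by rewrite lnK.
Qed.

End boundary_values.

(** * The doubling map and primitives *)

Section doubling_map.
Context {R : realType}.
Implicit Types (x y t c : R) (f g : R -> R).
Local Notation mu := (@lebesgue_measure R).
Local Notation tau := (@doubling R).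

(** [aff 0] and [aff 1] are the two branches of the doubling map. *)
Definition aff c y : R := 2 * y - c.

Lemma continuous_aff c : continuous (aff c).
Proof.
move=> y; apply: cvgB; last exact: cvg_cst.
by apply: cvgMl_tmp; exact: cvg_id.
Qed.

Lemma measurable_aff c : measurable_fun [set: R] (aff c).
Proof. exact: continuous_measurable_fun (@continuous_aff c). Qed.

Lemma aff_preimage c a b : aff c @^-1` `]a, b]%classic = `](a + c) / 2, (b + c) / 2]%classic.
Proof.
apply/seteqP; split => y; rewrite /aff /= !in_itv/= => /andP[h1 h2]; apply/andP; split; lra.
Qed.

Lemma aff_preimage_cc c a b : aff c @^-1` `[a, b]%classic = `[(a + c) / 2, (b + c) / 2]%classic.
Proof.
apply/seteqP; split => y; rewrite /aff /= !in_itv/= => /andP[h1 h2]; apply/andP; split; lra.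
Qed.

Definition aff_measure c : {measure set (measurableTypeR R) -> \bar R} :=
  measure_function_mscale__canonical__measure_function_Measure 2%:nng
    (@measure_function_pushforward__canonical__measure_function_Measure _ _
      (measurableTypeR R) (measurableTypeR R) R mu _ (measurable_aff c)).

Lemma aff_measureE c A : aff_measure c A = (2%:E * mu (aff c @^-1` A))%E.
Proof. by []. Qed.

Lemma measure_aff c (A : set R) : measurable A ->
  mu A = aff_measure c A.
Proof.
apply: (@lebesgue_measure_unique R (aff_measure c)).
move=> _ [[a b] _ <-]; rewrite aff_measureE/= aff_preimage.
rewrite !lebesgue_measure_itv/= !lte_fin.
have -> : ((a + c) / 2 < (b + c) / 2) = (a < b) by rewrite ltr_pM2r ?invr_gt0// ltrD2r.
case: ifP => _; last by rewrite mule0.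
rewrite -!EFinB -EFinM; congr EFin; by field.
Qed.

Lemma affine_substitution g c (D : set R) : bm g -> measurable D -> (mu D < +oo)%E ->
  \int[mu]_(x in D) g x = 2 * \int[mu]_(y in aff c @^-1` D) g (aff c y).
Proof.
move=> bg mD fD; have mA := measurable_aff c.
have mD' : measurable (aff c @^-1` D).
  by rewrite -[X in measurable X]setTI; exact: mA.
have fD' : (mu (aff c @^-1` D) < +oo)%E.
  apply: le_lt_trans fD; rewrite (measure_aff c mD) aff_measureE.
  by apply: lee_pemull; [exact: measure_ge0|rewrite lee_fin; lra].
have [mg [M gM]] := bg.
have bgc : bm (fun y => g (aff c y)).
  by split; [exact: measurableT_comp mg mA|exists M].
(* For [h >= 0] the substitution is the equality of two measures; the general case adds the constant
   [M] and subtracts it again. *)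
have pos h : bm h -> (forall x, 0 <= h x) ->
    \int[mu]_(x in D) h x = 2 * \int[mu]_(y in aff c @^-1` D) h (aff c y).
  move=> [mh [N hN]] h0; rewrite /Rintegral.
  have mhE : measurable_fun D (EFin \o h).
    by apply/measurable_EFinP; exact: measurable_funTS.
  rewrite (eq_measure_integral (aff_measure c)); last first.
    by move=> A mAA _; exact: measure_aff.
  rewrite ge0_integral_mscale//; last by move=> x _; rewrite lee_fin.
  rewrite ge0_integral_pushforward//; last by move=> x _; rewrite lee_fin.
  rewrite fineM//=.
  have bh : bm (fun y => h (aff c y)).
    by split; [exact: measurableT_comp mh mA|exists N].
  exact: (integrable_fin_num _ (bm_integrable mD' fD' bh)).
have b1 : bm (fun x => g x + M) by apply: bmD => //; exact: bm_cst.
have g0 x : 0 <= g x + M by have := gM x; rewrite ler_norml => /andP[h _]; lra.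
have b2 : bm (fun=> M) by exact: bm_cst.
have M0 x : 0 <= (fun=> M : R) x by exact: le_trans (normr_ge0 _) (gM 0).
have := pos _ b1 g0; have := pos _ b2 M0.
by rewrite !ID// mulrDr => -> /addIr.
Qed.

Lemma measurable_doubling : measurable_fun [set: R] tau.
Proof.
have m2 : measurable_fun [set: R] (fun x : R => 2 * x) by exact: mulrl_measurable.
have mf : measurable_fun [set: R] (fun x : R => (Num.floor x)%:~R : R).
  by apply: nondecreasing_measurable => // x y xy; rewrite ler_int; exact: le_floor.
exact: measurable_funB m2 (measurableT_comp mf m2).
Qed.

Lemma bm_doubling g : bm g -> bm (fun x => g (tau x)).
Proof.
move=> [mg [M gM]]; split; last by exists M.
exact: measurableT_comp mg measurable_doubling.
Qed.

Lemma doubling_lt x : 0 <= x < 1/2 -> tau x = 2 * x.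
Proof.
move=> xi; rewrite /doubling (_ : Num.floor (2 * x) = 0) ?subr0//.
by apply/eqP; rewrite floor_eq; lra.
Qed.

Lemma doubling_ge x : 1/2 <= x < 1 -> tau x = 2 * x - 1.
Proof.
move=> xi; rewrite /doubling (_ : Num.floor (2 * x) = 1)//.
by apply/eqP; rewrite floor_eq; lra.
Qed.

Lemma doubling_itv x : 0 <= tau x < 1.
Proof.
have := floor_itv (2 * x); rewrite /doubling intrD => /andP[h1 h2].
by apply/andP; split; lra.
Qed.

Lemma iter_doubling_itv n x : 0 <= x < 1 -> 0 <= iter n tau x < 1.
Proof. by case: n => // n _; exact: doubling_itv. Qed.

Local Notation J x g := (\int[mu]_(y in `[0%R, x]) g y).

Lemma ae_neq x : {ae mu, forall y : R, y != x}.
Proof.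
exists [set x]; split; [exact: measurable_set1|exact: lebesgue_measure_set1|].
by move=> y /= /negP; rewrite negbK => /eqP.
Qed.

(** With the next lemma, the self-similarity of primitives: the primitive of [g o tau] at [x] is
    half that of [g] at [2 x], or, on the second branch, half that at [2 x - 1] plus half the total
    integral. *)
Lemma int_doubling_low g x : bm g -> 0 <= x <= 1/2 ->
  J x (fun y => g (tau y)) = 2^-1 * J (2 * x) g.
Proof.
move=> bg /andP[x0 x1].
rewrite (affine_substitution 0 bg (measurable_itv _) (fin_itv _ _)) mulrA mulVf// mul1r.
rewrite aff_preimage_cc !addr0 mul0r (_ : 2 * x / 2 = x); last by field.
have ma := measurable_aff 0; have [mg [M gM]] := bg.
apply: I_ae; [exact: measurable_itv|exact: bm_doubling| |].
  by split; [exact: measurableT_comp mg ma|exists M].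
apply: aeS (ae_neq (1/2)) => y yn; rewrite /= in_itv/= => /andP[y0 y1].
by rewrite doubling_lt ?/aff ?subr0// y0/= lt_neqAle yn; lra.
Qed.

Lemma int_doubling_high g x : bm g -> 1/2 <= x <= 1 ->
  J x (fun y => g (tau y)) = 2^-1 * J 1 g + 2^-1 * J (2 * x - 1) g.
Proof.
move=> bg /andP[x0 x1].
have h2 : 0 <= (1/2 : R) by lra.
rewrite (Ix_split (bm_doubling bg) h2 x0) int_doubling_low//; last by lra.
rewrite (_ : 2 * (1 / 2) = 1 :> R); last by field.
congr (_ + _).
rewrite (affine_substitution 1 bg (measurable_itv _) (fin_itv _ _)) mulrA mulVf// !mul1r.
rewrite aff_preimage_cc add0r (_ : (2 * x - 1 + 1) / 2 = x) ?mul1r; last by field.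
have ma := measurable_aff 1; have [mg [M gM]] := bg.
apply: I_ae; [exact: measurable_itv|exact: bm_doubling| |].
  by split; [exact: measurableT_comp mg ma|exists M].
apply: aeS (ae_neq 1) => y yn; rewrite /= in_itv/= => /andP[y0 y1].
have y2 : y < 1 by rewrite lt_neqAle yn; lra.
by rewrite doubling_ge ?/aff//; lra.
Qed.

Lemma int_doubling g : bm g -> J 1 (fun y => g (tau y)) = J 1 g.
Proof.
move=> bg; rewrite int_doubling_high//; last by lra.
rewrite (_ : 2 * 1 - 1 = 1 :> R); last by ring.
by lra.
Qed.

(** By Lebesgue differentiation [g] is almost everywhere the derivative of its primitive, which is
    constant on []0, 1[]. *)
Lemma ae_int0 g : bm g -> (forall x, 0 <= x <= 1 -> J x g = 0) ->
  {ae mu, forall x, 0 <= x <= 1 -> g x = 0}.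
Proof.
move=> bg J0.
have ig (y : R) : mu.-integrable `[0, y] (EFin \o g).
  by apply: bm_integrable => //; exact: fin_itv.
have lg : locally_integrable [set: R] g.
  split; [by case: bg|exact: openT|].
  move=> K _ cK; have mK := compact_measurable cK.
  have fK : (mu K < +oo)%E by exact: compact_finite_measure.
  by have /integrableP[_] := bm_integrable mK fK bg.
have := @FTC1 R g (BLeft 0) ig lg.
move=> H; apply: aeS2 (aeS2 _ (ae_neq 0) (ae_neq 1)) H => [x + H|x h0 h1]; last exact: (conj h0 h1).
move=> [x0 x1] /andP[xge xle].
have [|_ <-] := H; first by rewrite /= lte_fin lt_neqAle eq_sym x0.
rewrite derive1E; apply: derive_val; apply: (@near_eq_is_derive _ _ _ (cst 0)).
  have xI : `]0, 1[%classic x by rewrite /= in_itv/= !lt_neqAle x1 xle eq_sym x0 xge.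
  near=> y; rewrite /cst J0//.
  have : `]0, 1[%classic y by near: y; exact: open_nbhs_nbhs.
  by rewrite /= in_itv/= => /andP[/ltW -> /ltW ->].
Unshelve. all: by end_near.
Qed.

End doubling_map.

(** * Eigenfunctions of the doubling map, Birkhoff sums and their maxima *)

Section ergodic_sums.
Context {R : realType}.
Implicit Types (x y t c : R) (f g F : R -> R).
Local Notation mu := (@lebesgue_measure R).
Local Notation tau := (@doubling R).
Local Notation J x g := (\int[mu]_(y in `[0%R, x]) g y).
Local Notation ae01 P := {ae mu, forall x : R, 0 <= x < 1 -> P x}.

Lemma ae01_closed (P : R -> Prop) : ae01 P -> {ae mu, forall x : R, 0 <= x <= 1 -> P x}.
Proof.
apply: (aeS2 _ (ae_neq 1)) => x x1 h /andP[x0 xle].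
by apply: h; rewrite x0 lt_neqAle x1.
Qed.

Lemma ae01_nonempty (P : R -> Prop) : ae01 P -> exists2 x, 0 <= x < 1 & P x.
Proof.
move=> [N [mN N0 sN]]; apply: contrapT => nP.
have : (mu `[0%R, 1%R[%classic <= mu N)%E.
  apply: le_measure; rewrite ?inE.
  - exact: measurable_itv.
  - exact: mN.
  move=> x /=; rewrite in_itv/= => x01; apply: (sN x) => h; apply: nP; exists x => //; exact: h.
by rewrite N0 lebesgue_measure_itv/= lte_fin ltr01 oppr0 adde0 lee_fin ler10.
Qed.

Lemma exists_nat_ge (y : R) : exists n : nat, y <= n%:R.
Proof. by exists (Num.truncn y).+1; rewrite ltW// real_truncnS_gt// num_real. Qed.

Lemma geometric_decay (a K : R) : 0 <= a -> 0 <= K -> (forall n, a <= K / 4 ^+ n) -> a = 0.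
Proof.
move=> a0 K0 h; apply/eqP; rewrite eq_le a0 andbT; apply/ler_addgt0Pl => e e0; rewrite addr0.
have h4 : `|(4^-1 : R)| < 1 by rewrite ger0_norm; lra.
have /cvgrPdist_le/(_ (e / (K + 1))) := @cvg_expr R 4^-1 h4.
have e1 : 0 < e / (K + 1) by rewrite divr_gt0//; lra.
move=> /(_ e1) [n _ /(_ n (leqnn n))]; rewrite sub0r normrN => hn.
apply: le_trans (h n) _; rewrite -exprVn.
apply: le_trans (_ : (K + 1) * (e / (K + 1)) <= _); last by rewrite mulrC divfK//; lra.
have p4 : 0 <= (4^-1 : R) ^+ n by rewrite exprn_ge0// invr_ge0.
apply: ler_pM => //; first lra.
exact: le_trans (ler_norm _) hn.
Qed.

Lemma rotation_norm c s (a b a' b' : R) : c ^+ 2 + s ^+ 2 = 1 ->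
  c * a - s * b = 2^-1 * a' -> s * a + c * b = 2^-1 * b' ->
  a ^+ 2 + b ^+ 2 = (a' ^+ 2 + b' ^+ 2) / 4.
Proof.
move=> cs h1 h2.
have -> : a' = 2 * (c * a - s * b) by rewrite h1 mulrA divff ?mul1r.
have -> : b' = 2 * (s * a + c * b) by rewrite h2 mulrA divff ?mul1r.
transitivity ((c ^+ 2 + s ^+ 2) * (a ^+ 2 + b ^+ 2)); first by rewrite cs mul1r.
by field.
Qed.

(* The primitives [A], [B] of the two components satisfy
   [(A^2 + B^2)(x) = (A^2 + B^2)(tau x) / 4] because their total integrals vanish. *)
Lemma doubling_eigenfunction c s f g : c ^+ 2 + s ^+ 2 = 1 -> bm f -> bm g ->
  ae01 (fun x => f (tau x) = c * f x - s * g x) ->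
  ae01 (fun x => g (tau x) = s * f x + c * g x) ->
  J 1 f = 0 -> J 1 g = 0 ->
  ae01 (fun x => f x = 0 /\ g x = 0).
Proof.
move=> cs bf bg /ae01_closed hf /ae01_closed hg J1f J1g.
have [_ [Mf fM]] := bf; have [_ [Mg gM]] := bg.
pose N x := (J x f) ^+ 2 + (J x g) ^+ 2.
have mD x : measurable `[0%R, x]%classic by exact: measurable_itv.
have fD x := fin_itv 0 x.
have rot x : 0 <= x <= 1 ->
    J x (fun y => f (tau y)) = c * J x f - s * J x g /\
    J x (fun y => g (tau y)) = s * J x f + c * J x g.
  move=> x01; rewrite -!(IZ (mD x) (fD x))// -(IB (mD x) (fD x)); [|exact: bmZ..].
  rewrite -(ID (mD x) (fD x)); [|exact: bmZ..].
  split; apply: (I_ae (mD x)).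
  - exact: bm_doubling.
  - by apply: bmB; exact: bmZ.
  - apply: aeS hf => y h; rewrite /= in_itv/= => /andP[y0 y1]; apply: h; lra.
  - exact: bm_doubling.
  - by apply: bmD; exact: bmZ.
  - apply: aeS hg => y h; rewrite /= in_itv/= => /andP[y0 y1]; apply: h; lra.
have step x : 0 <= x <= 1 -> exists2 x', 0 <= x' <= 1 & N x = N x' / 4.
  move=> x01; have [h1 h2] := rot x x01.
  have [xle|xge] := lerP x (1/2).
    exists (2 * x); first lra.
    by apply: (rotation_norm cs); rewrite -?h1 -?h2 int_doubling_low//; lra.
  exists (2 * x - 1); first lra.
  have xx : 1/2 <= x <= 1 by lra.
  by apply: (rotation_norm cs); rewrite -?h1 -?h2 int_doubling_high// ?J1f ?J1g mulr0 add0r.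
have bnd h M x : bm h -> (forall y, `|h y| <= M) -> 0 <= x <= 1 -> (J x h) ^+ 2 <= M ^+ 2.
  move=> bh hM /andP[x0 x1].
  have M0 : 0 <= M by exact: le_trans (normr_ge0 _) (hM 0).
  rewrite -real_normK ?num_real// lerXn2r ?nnegrE//.
  apply: le_trans (I_bound (mD x) (fD x) bh (fun y _ => hM y)) _.
  by rewrite mu_itv// subr0 ler_piMr.
(* Iterating the functional equation [n] times, [N x] is at most a fixed bound divided by [4^n]. *)
have N0 x : 0 <= x <= 1 -> N x = 0.
  move=> x01; apply: (@geometric_decay _ (Mf ^+ 2 + Mg ^+ 2)).
  - by rewrite addr_ge0// sqr_ge0.
  - by rewrite addr_ge0// sqr_ge0.
  move=> n; elim: n x x01 => [|n IH] x x01.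
    by rewrite expr0 divr1 lerD//; exact: bnd.
  have [x' x'01 ->] := step x x01.
  by rewrite (exprSr 4 n) invfM mulrA ler_pM2r ?invr_gt0//; exact: IH.
have NJ x : 0 <= x <= 1 -> J x f = 0 /\ J x g = 0.
  by move=> /N0/eqP; rewrite paddr_eq0 ?sqr_ge0// !sqrf_eq0 => /andP[/eqP-> /eqP->].
have z1 := ae_int0 bf (fun x h => (NJ x h).1).
have z2 := ae_int0 bg (fun x h => (NJ x h).2).
by apply: aeS2 z1 z2 => x h1 h2 /andP[x0 x1]; split; [apply: h1|apply: h2]; lra.
Qed.

Fixpoint birkhoff F n x : R := if n is n'.+1 then F x + birkhoff F n' (tau x) else 0.
(** The maximum of the sums of length at most [n], the empty one included, in the recursive form on
    which the maximal ergodic theorem rests. *)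
Fixpoint birkhoff_max F n x : R :=
  if n is n'.+1 then Num.max 0 (F x + birkhoff_max F n' (tau x)) else 0.
(** What [max 0] adds to a negative value; it measures how far the maxima are from solving
    [G = F + G o tau]. *)
Definition birkhoff_defect F n x : R := Num.max 0 (- (F x + birkhoff_max F n (tau x))).
Definition birkhoff_unbounded F : set R := [set x | forall m : nat, exists n, m%:R <= birkhoff F n x].

Lemma bm_birkhoff F n : bm F -> bm (birkhoff F n).
Proof.
move=> bF; elim: n => [|n IH] /=; first exact: bm_cst.
by apply: bmD => //; exact: bm_doubling IH.
Qed.

Lemma bm_birkhoff_max F n : bm F -> bm (birkhoff_max F n).
Proof.
move=> bF; elim: n => [|n IH] /=; first exact: bm_cst.
apply: bm_max; first exact: bm_cst.
by apply: bmD => //; exact: bm_doubling IH.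
Qed.

Lemma bm_birkhoff_defect F n : bm F -> bm (birkhoff_defect F n).
Proof.
move=> bF; apply: bm_max; first exact: bm_cst.
by apply/bmN/bmD => //; exact: bm_doubling (bm_birkhoff_max n bF).
Qed.

Lemma birkhoff_max_ge0 F n x : 0 <= birkhoff_max F n x.
Proof. by case: n => [|n] //=; rewrite le_max lexx. Qed.

Lemma birkhoff_maxS F n x : birkhoff_max F n x <= birkhoff_max F n.+1 x.
Proof.
elim: n x => [|n IH] x; first exact: birkhoff_max_ge0.
by rewrite [leRHS]/= [leLHS]/= ge_max !le_max lexx/= lerD2l IH orbT.
Qed.

Lemma birkhoff_max_nd F x : nondecreasing_seq (fun n => birkhoff_max F n x).
Proof. by apply/nondecreasing_seqP => n; exact: birkhoff_maxS. Qed.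

Lemma birkhoff_le_max F n x : birkhoff F n x <= birkhoff_max F n x.
Proof. by elim: n x => [|n IH] x //=; rewrite le_max lerD2l IH orbT. Qed.

Lemma birkhoff_max_attained F n x : exists j, birkhoff_max F n x = birkhoff F j x.
Proof.
elim: n x => [|n IH] x /=; first by exists 0%N.
have [j ->] := IH (tau x).
by case: (leP 0 (F x + birkhoff F j (tau x))) => h; [exists j.+1|exists 0%N].
Qed.

Lemma birkhoff_maxE F n x :
  birkhoff_max F n.+1 x = F x + birkhoff_max F n (tau x) + birkhoff_defect F n x.
Proof.
rewrite /birkhoff_defect /=; case: (leP 0 (F x + birkhoff_max F n (tau x))) => h.
  by rewrite max_l ?addr0// oppr_le0.
by rewrite max_r ?subrr// oppr_ge0 ltW.
Qed.

Lemma measurable_birkhoff_unbounded F : bm F -> measurable (birkhoff_unbounded F).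
Proof.
move=> bF.
have -> : birkhoff_unbounded F = \bigcap_m \bigcup_n (birkhoff F n @^-1` `[m%:R, +oo[%classic).
  apply/seteqP; split=> x /= h m.
    by move=> _; have [n hn] := h m; exists n => //=; rewrite in_itv/= hn.
  by have [n _] := h m I; rewrite /= in_itv/= andbT => hn; exists n.
apply: bigcapT_measurable => m; apply: bigcupT_measurable => n.
have [mb _] := bm_birkhoff n bF.
by rewrite -[X in measurable X]setTI; apply: mb => //; exact: measurable_itv.
Qed.

Lemma birkhoff_unbounded_doubling F x : bm F ->
  birkhoff_unbounded F (tau x) <-> birkhoff_unbounded F x.
Proof.
move=> [_ [M FM]]; split=> h m.
  have [k hk] := exists_nat_ge (m%:R + M).
  have [n hn] := h k; exists n.+1 => /=.
  by have := FM x; rewrite ler_norml => /andP[h1 _]; lra.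
have M0 : 0 <= M by exact: le_trans (normr_ge0 _) (FM 0).
have [k hk] := exists_nat_ge (m%:R + M + 1).
have [[|n] /= hn] := h k; first by exists 0%N => /=; have : 0 <= (m%:R : R) by []; lra.
by exists n; have := FM x; rewrite ler_norml => /andP[_ h1]; lra.
Qed.

End ergodic_sums.

(** * Zero-one law, maximal ergodic theorem and visit discrepancies *)

Section ergodic.
Context {R : realType}.
Implicit Types (x y t c : R) (f g F : R -> R).
Local Notation mu := (@lebesgue_measure R).
Local Notation tau := (@doubling R).
Local Notation J x g := (\int[mu]_(y in `[0%R, x]) g y).
Local Notation ae01 P := {ae mu, forall x : R, 0 <= x < 1 -> P x}.
Let mD x : measurable `[0%R, x]%classic. Proof. exact: measurable_itv. Qed.
Let fD x := fin_itv 0 x.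

(** The set is invariant under [tau], so its indicator minus its mean is a fixed function of mean 0;
    [doubling_eigenfunction] with rotation angle 0 makes it vanish. *)
Lemma birkhoff_zero_one F : bm F ->
  ae01 (birkhoff_unbounded F) \/ ae01 (fun x => ~ birkhoff_unbounded F x).
Proof.
move=> bF; have mU := measurable_birkhoff_unbounded bF.
have b1 := bm_indic mU.
set U := birkhoff_unbounded F in mU b1 *.
pose c := J 1 (\1_U).
have bc : bm (fun x => \1_U x - c) by apply: bmB => //; exact: bm_cst.
have H : ae01 (fun x => \1_U x - c = 0 /\ (0 : R) = 0).
  apply: (@doubling_eigenfunction R 1 0 (fun x => \1_U x - c) (fun=> 0)) => //.
  - by rewrite expr1n expr0n addr0.
  - exact: bm_cst.
  - apply: aeW => x _; rewrite mul1r mul0r subr0; congr (_ - _).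
    rewrite !indicE; congr (_%:R); congr nat_of_bool; apply/idP/idP; rewrite !inE /U => h.
      by apply/(birkhoff_unbounded_doubling x bF).
    by apply/(birkhoff_unbounded_doubling x bF).
  - by apply: aeW => x _ /=; rewrite !(mul0r, mulr0, addr0).
  - rewrite (IB (mD 1) (fD 1) b1 (bm_cst c)) (Icst (mD 1)) mu_itv//.
    by rewrite subr0 mulr1 subrr.
  - by rewrite (Icst (mD 1)) mul0r.
have [c1|c1] := eqVneq c 1.
  left; apply: aeS H => x h /h[/eqP]; rewrite subr_eq0 c1 indicE.
  by case: (boolP (x \in U)) => [/set_mem//|_]; rewrite eq_sym oner_eq0.
right; apply: aeS H => x h /h[/eqP]; rewrite subr_eq0 indicE => /eqP e _ Ux.
by move: c1; rewrite -e mem_set// eqxx.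
Qed.

Lemma birkhoff_defect_bound F n x M : (forall x, `|F x| <= M) -> 0 <= birkhoff_defect F n x <= M.
Proof.
move=> FM; rewrite /birkhoff_defect le_max lexx/= ge_max.
have := FM x; have := birkhoff_max_ge0 F n (tau x); rewrite ler_norml => h /andP[h1 h2].
by apply/andP; split; lra.
Qed.

Lemma int_birkhoff_defect F n : bm F ->
  J 1 (birkhoff_defect F n) =
  J 1 (fun x => birkhoff_max F n.+1 x - birkhoff_max F n x) - J 1 F.
Proof.
move=> bF; have bM k := bm_birkhoff_max k bF.
have bN := bm_birkhoff_defect n bF; have bMt := bm_doubling (bM n).
have -> : birkhoff_max F n.+1 = fun x => F x + birkhoff_max F n (tau x) + birkhoff_defect F n x.
  by apply/funext => x; exact: birkhoff_maxE.
rewrite (IB (mD 1) (fD 1))//; last by apply: bmD => //; exact: bmD.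
rewrite (ID (mD 1) (fD 1))//; last exact: bmD.
rewrite (ID (mD 1) (fD 1))// int_doubling//.
set a := J 1 F; set b := J 1 _; set d := J 1 _; ring.
Qed.

Lemma birkhoff_max_step F n x M : (forall x, `|F x| <= M) ->
  0 <= birkhoff_max F n.+1 x - birkhoff_max F n x <= M.
Proof.
move=> FM; rewrite subr_ge0 birkhoff_maxS andTb.
have M0 : 0 <= M by exact: le_trans (normr_ge0 _) (FM 0).
elim: n x => [|n IH] x; first by rewrite /= addr0 subr0 ge_max M0 (le_trans (ler_norm _) (FM x)).
have := IH (tau x); have := birkhoff_maxS F n (tau x).
rewrite lerBlDr; set a := birkhoff_max F n.+1 (tau x); set b := birkhoff_max F n (tau x) => ba h.
change (Num.max 0 (F x + a) - Num.max 0 (F x + b) <= M).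
rewrite lerBlDr ge_max; apply/andP; split.
  by rewrite addr_ge0// le_max lexx.
have : F x + b <= Num.max 0 (F x + b) by rewrite le_max lexx orbT.
by lra.
Qed.

(** If the sums were unbounded almost everywhere, the defects would tend to 0 boundedly; but the
    maxima increase with [n], so by [int_birkhoff_defect] the integrals of the defects are at least
    [- J 1 F > 0]. *)
Lemma birkhoff_bounded_above F : bm F -> J 1 F < 0 ->
  ae01 (fun x => ~ birkhoff_unbounded F x).
Proof.
move=> bF JF; have [U1|//] := birkhoff_zero_one bF; exfalso.
have [_ [M FM]] := bF.
have : (fun n => J 1 (birkhoff_defect F n)) @ \oo --> J 1 (fun=> 0).
  apply: (@I_dct R _ (mD 1) (fD 1) _ _ M); first by move=> n; exact: bm_birkhoff_defect.
  - exact: bm_cst.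
  - by move=> n x; have /andP[h1 h2] := birkhoff_defect_bound n x FM; rewrite ger0_norm.
  - apply: aeS (ae01_closed U1) => x h; rewrite /= in_itv/= => /h Ux; apply: cvg_near_cst.
    have /(birkhoff_unbounded_doubling x bF) Utx := Ux.
    have [m hm] := exists_nat_ge (- F x); have [n hn] := Utx m.
    exists n => // k /= nk; rewrite /birkhoff_defect max_l// oppr_le0.
    have := birkhoff_max_nd F (tau x) nk; have := birkhoff_le_max F n (tau x); lra.
rewrite (Icst (mD 1)) mul0r => /cvgrPdist_lt/(_ (- J 1 F)).
rewrite oppr_gt0 => /(_ JF)[n _ /(_ n (leqnn n))].
rewrite /= sub0r normrN => h; have := le_lt_trans (ler_norm _) h.
rewrite int_birkhoff_defect// gtrDr ltNge => /negP; apply.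
apply: le_trans (_ : J 1 (fun=> 0) <= _); first by rewrite (Icst (mD 1)) mul0r.
apply: (I_le (mD 1) (fD 1)) => //; first exact: bm_cst.
  by apply: bmB; exact: bm_birkhoff_max.
by move=> x _; have /andP[] := birkhoff_max_step n x FM.
Qed.

Lemma int_ge0_eq0 f : bm f -> (forall x, 0 <= f x) -> J 1 f = 0 -> ae01 (fun x => f x = 0).
Proof.
move=> bf f0 J1.
have Jge0 a b : 0 <= \int[mu]_(x in `[a, b]) f x.
  have mab : measurable `[a, b]%classic by exact: measurable_itv.
  apply: le_trans (_ : \int[mu]_(x in `[a, b]) 0 <= _); first by rewrite (Icst mab) mul0r.
  by apply: (I_le mab (fin_itv a b)) => //; exact: bm_cst.
have : forall x, 0 <= x <= 1 -> J x f = 0.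
  move=> x /andP[x0 x1]; have := Jge0 0 x; have := Jge0 x 1.
  by have := Ix_split bf x0 x1; rewrite J1; lra.
by move/(ae_int0 bf); apply: aeS => x h /andP[x0 x1]; apply: h; lra.
Qed.

Lemma rotation_fix (a b c s : R) : c < 1 -> a = c * a - s * b -> b = s * a + c * b -> a = 0.
Proof.
move=> c1 h1 h2.
have h : ((1 - c) ^+ 2 + s ^+ 2) * a = 0.
  have e1 : (1 - c) * a = - (s * b) by rewrite mulrBl mul1r {1}h1; ring.
  have e2 : (1 - c) * b = s * a by rewrite mulrBl mul1r {1}h2; ring.
  rewrite mulrDl expr2 -mulrA e1 mulrN mulrCA e2; ring.
move/eqP: h; rewrite mulf_eq0 => /orP[|/eqP//].
by rewrite paddr_eq0 ?sqr_ge0// sqrf_eq0 subr_eq0 => /andP[/eqP h _]; move: c1; rewrite -h ltxx.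
Qed.

Lemma cos2pi_lt1 (p : R) : 0 < p < 1 -> cos (2 * pi * p) < 1.
Proof.
move=> /andP[p0 p1]; have pi0 := pi_gt0 R.
have -> : 2 * pi * p = (pi * p) *+ 2 by rewrite mulr2n; ring.
rewrite cos_mulr2n [cos _ ^+ 2]cos2sin2 -subr_gt0.
have : 0 < sin (pi * p) by apply: sin_gt0_pi; rewrite mulr_gt0//= gtr_pMr.
by move=> /(exprn_gt0 2); lra.
Qed.

(* Otherwise the supremum [G] of the sums is finite a.e. and [F = G - G o tau], so
   [exp (2 i pi G)] is rotated by [exp (2 i pi p) <> 1] under the doubling map. *)
Lemma birkhoff_unbounded_ae (A : set R) (p : R) : measurable A -> 0 < p < 1 ->
  let F := fun x => \1_A x - p in
  J 1 F = 0 -> ae01 (birkhoff_unbounded F).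
Proof.
move=> mA p01 F JF.
have bF : bm F by apply: bmB; [exact: bm_indic|exact: bm_cst].
have [//|nU] := birkhoff_zero_one bF; exfalso.
have [_ [M FM]] := bF.
set U := birkhoff_unbounded F in nU.
have mU : measurable U by exact: measurable_birkhoff_unbounded.
(* Set to 0 on [U], where the maxima diverge, so that the limit exists everywhere and [G] is
   measurable. *)
pose G_ n x : R := \1_(~` U) x * birkhoff_max F n x.
pose G x : R := limn (fun n => G_ n x).
have GnU x : ~ U x -> (fun n => G_ n x) = (fun n => birkhoff_max F n x).
  by move=> Ux; apply/funext => n; rewrite /G_ indicE mem_set// mul1r.
have cvgG x : (fun n => G_ n x) @ \oo --> G x.
  have [Ux|Ux] := pselect (U x).
    suff : cvgn (fun n => G_ n x) by [].
    have -> : (fun n => G_ n x) = (fun=> 0); last exact: is_cvg_cst.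
    apply/funext => n; rewrite /G_ indicE memNset ?mul0r//; exact: (fun h => h Ux).
  suff : cvgn (fun n => G_ n x) by [].
  rewrite GnU//; apply: nondecreasing_is_cvgn; first exact: birkhoff_max_nd.
  have [m hm] : exists m : nat, forall n, birkhoff F n x < m%:R.
    apply: contrapT => h; apply: Ux => m; apply: contrapT => h'; apply: h; exists m => n.
    by rewrite ltNge; apply/negP => h2; apply: h'; exists n.
  exists m%:R => _ [n _ <-]; have [j ->] := birkhoff_max_attained F n x; exact: ltW.
have limM x : ~ U x -> (fun n => birkhoff_max F n x) @ \oo --> G x.
  by move=> Ux; rewrite -GnU//; exact: cvgG.
have Utau x : ~ U x -> ~ U (tau x).
  by move=> h h'; apply: h; apply/(birkhoff_unbounded_doubling x bF).
have mG : measurable_fun [set: R] G.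
  apply: (measurable_fun_cvg (h := G_)) => [n|x _]; last exact: cvgG.
  have [mb _] : bm (G_ n); last exact: mb.
  by apply: bmM; [apply: bm_indic; exact: measurableC|exact: bm_birkhoff_max].
(* The limit of the defects off [U]. They lie in [[0, M]], so the cap at [M] does not alter them,
   and it keeps [N] bounded everywhere. *)
pose N x := Num.max 0 (Num.min M (- (F x + G (tau x)))).
have limN x : ~ U x -> (fun n => birkhoff_defect F n x) @ \oo --> N x.
  move=> Ux.
  have -> : (fun n => birkhoff_defect F n x) =
      fun n => Num.max 0 (Num.min M (- (F x + birkhoff_max F n (tau x)))).
    apply/funext => n; have := birkhoff_defect_bound n x FM.
    rewrite /birkhoff_defect => /andP[_]; rewrite ge_max => /andP[_ h].
    by rewrite (min_r h).
  have ch : {for G (tau x), continuous (fun y => Num.max 0 (Num.min M (- (F x + y))))}.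
    have c1 : {for G (tau x), continuous (fun y => - (F x + y))}.
      by apply: cvgN; apply: cvgD; [exact: cvg_cst|exact: cvg_id].
    have c2 : {for G (tau x), continuous (fun y => Num.min M (- (F x + y)))}.
      exact: (continuous_min (@cst_continuous _ _ M _) c1).
    exact: (continuous_max (@cst_continuous _ _ 0 _) c2).
  exact: (cvg_comp _ _ (limM _ (Utau x Ux)) ch).
have bN : bm N.
  have M0 : 0 <= M by exact: le_trans (normr_ge0 _) (FM 0).
  split; last first.
    by exists M => x; rewrite ger0_norm /N ?le_max ?lexx// ge_max M0/= ge_min lexx.
  apply: measurable_maxr; first exact: measurable_cst.
  apply: measurable_minr; first exact: measurable_cst.
  apply: measurableT_comp => //; apply: measurable_funD; first by case: bF.
  exact: measurableT_comp mG (@measurable_doubling R).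
have stepc x : ~ U x -> (fun n => birkhoff_max F n.+1 x - birkhoff_max F n x) @ \oo --> (0 : R).
  move=> Ux; rewrite -(subrr (G x)); apply: cvgB; last exact: limM.
  by have := limM x Ux; rewrite -(cvg_shiftS (fun n => birkhoff_max F n x)).
(* With [J 1 F = 0] the defects and the increments of the maxima have equal integrals, and the
   increments tend to 0. *)
have JN : J 1 N = 0.
  have l1 : (fun n => J 1 (birkhoff_defect F n)) @ \oo --> J 1 N.
    apply: (@I_dct R _ (mD 1) (fD 1) _ _ M) => //; first by move=> n; exact: bm_birkhoff_defect.
      by move=> n x; have /andP[h1 h2] := birkhoff_defect_bound n x FM; rewrite ger0_norm.
    by apply: aeS (ae01_closed nU) => x h; rewrite /= in_itv/= => /h; exact: limN.
  have l2 : (fun n => J 1 (birkhoff_defect F n)) @ \oo --> J 1 (fun=> 0).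
    have -> : (fun n => J 1 (birkhoff_defect F n)) =
        (fun n => J 1 (fun x => birkhoff_max F n.+1 x - birkhoff_max F n x)).
      by apply/funext => n; rewrite int_birkhoff_defect// JF subr0.
    apply: (@I_dct R _ (mD 1) (fD 1) _ _ M).
    - by move=> n; apply: bmB; exact: bm_birkhoff_max.
    - exact: bm_cst.
    - by move=> n x; have /andP[h1 h2] := birkhoff_max_step n x FM; rewrite ger0_norm.
    - by apply: aeS (ae01_closed nU) => x h; rewrite /= in_itv/= => /h; exact: stepc.
  have e : J 1 N = J 1 (fun=> 0) by exact: (cvg_unique (@Rhausdorff R) l1 l2).
  by rewrite e (Icst (mD 1)) mul0r.
have N0 : ae01 (fun x => N x = 0).
  by apply: int_ge0_eq0 => // x; rewrite /N le_max lexx.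
have Gtau : ae01 (fun x => G (tau x) = G x - F x).
  apply: aeS2 nU N0 => x h1 h2 x01; have Ux := h1 x01.
  have l1 : (fun n => birkhoff_max F n.+1 x) @ \oo --> G x.
    by have := limM x Ux; rewrite -(cvg_shiftS (fun n => birkhoff_max F n x)).
  have l2 : (fun n => birkhoff_max F n.+1 x) @ \oo --> F x + G (tau x) + N x.
    have -> : (fun n => birkhoff_max F n.+1 x) =
        fun n => F x + birkhoff_max F n (tau x) + birkhoff_defect F n x.
      by apply/funext => n; exact: birkhoff_maxE.
    apply: cvgD; last exact: limN.
    by apply: cvgD; [exact: cvg_cst|exact: limM (Utau x Ux)].
  have e : G x = F x + G (tau x) + N x by exact: (cvg_unique (@Rhausdorff R) l1 l2).
  by rewrite e (h2 x01) addr0 addrAC subrr add0r.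
pose w := 2 * pi * p : R.
(* [F] takes the values [1 - p] and [- p], which agree modulo 1, so passing from [G x] to
   [G x - F x] adds the same angle [w] in both cases. *)
have angle : forall x y : R, y = G x - F x ->
    cos (2 * pi * y) = cos (2 * pi * G x + w) /\ sin (2 * pi * y) = sin (2 * pi * G x + w).
  move=> x y ->; rewrite /F indicE; case: (x \in A) => /=.
    have -> : 2 * pi * G x + w = 2 * pi * (G x - (1 - p)) + pi *+ 2 by rewrite /w mulr2n; ring.
    by rewrite cosD2pi sinD2pi.
  by have -> : 2 * pi * G x + w = 2 * pi * (G x - (0 - p)) by rewrite /w; ring.
have m2 : measurable_fun [set: R] (fun x => 2 * pi * G x).
  by apply: measurable_funM => //; exact: measurable_cst.
have bc : bm (fun x => cos (2 * pi * G x)).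
  split; last by exists 1 => x; rewrite ler_norml cos_geN1 cos_le1.
  by apply: measurableT_comp m2; apply: continuous_measurable_fun; exact: continuous_cos.
have bs : bm (fun x => sin (2 * pi * G x)).
  split; last by exists 1 => x; rewrite ler_norml sin_geN1 sin_le1.
  by apply: measurableT_comp m2; apply: continuous_measurable_fun; exact: continuous_sin.
have hc : ae01 (fun x => cos (2 * pi * G (tau x)) =
    cos w * cos (2 * pi * G x) - sin w * sin (2 * pi * G x)).
  by apply: aeS Gtau => x h /h/angle[-> _]; rewrite cosD; ring.
have hs : ae01 (fun x => sin (2 * pi * G (tau x)) =
    sin w * cos (2 * pi * G x) + cos w * sin (2 * pi * G x)).
  by apply: aeS Gtau => x h /h/angle[_ ->]; rewrite sinD; ring.
have iae f g : bm f -> bm g -> ae01 (fun x => f x = g x) -> J 1 f = J 1 g.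
  by move=> bf bg /ae01_closed fg; apply: (I_ae (mD 1)) => //; apply: aeS fg => x; rewrite /= in_itv.
have Jc := iae _ _ (bm_doubling bc) (bmB (bmZ (cos w) bc) (bmZ (sin w) bs)) hc.
have Js := iae _ _ (bm_doubling bs) (bmD (bmZ (sin w) bc) (bmZ (cos w) bs)) hs.
rewrite (int_doubling bc) (IB (mD 1) (fD 1) (bmZ _ bc) (bmZ _ bs))
  !(IZ (mD 1) (fD 1))// in Jc.
rewrite (int_doubling bs) (ID (mD 1) (fD 1) (bmZ _ bc) (bmZ _ bs))
  !(IZ (mD 1) (fD 1))// in Js.
have cw1 : cos w < 1 by exact: cos2pi_lt1.
have Jc0 := rotation_fix cw1 Jc Js.
have Js0 : J 1 (fun x => sin (2 * pi * G x)) = 0.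
  apply: (@rotation_fix _ (- J 1 (fun x => cos (2 * pi * G x))) _ (sin w) cw1).
    by rewrite mulrN opprK addrC.
  by rewrite {1}Jc mulrN opprB.
have [x _ [c0 s0]] := ae01_nonempty
  (doubling_eigenfunction (cos2Dsin2 w) bc bs hc hs Jc0 Js0).
by have := cos2Dsin2 (2 * pi * G x); rewrite c0 s0 expr0n addr0 => /eqP; rewrite eq_sym oner_eq0.
Qed.

(** The sums of [F] are unbounded above, whereas [F - c] with [c > 0] has negative mean, so its sums
    stay below some [m] and the sums of [F] below [m + n c]. *)
Lemma discrepancy (A : set R) (p : R) : measurable A -> A `<=` `[0, 1] ->
  fine (mu A) = p -> 0 < p < 1 ->
  ae01 (fun x => forall N k : nat, exists n,
    N%:R <= birkhoff (fun y => \1_A y - p) n x /\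
    birkhoff (fun y => \1_A y - p) n x * k.+1%:R <= n%:R).
Proof.
move=> mA A01 Ap p01; set F := fun y => \1_A y - p.
have b1 := bm_indic mA.
have bF : bm F by apply: bmB; [exact: b1|exact: bm_cst].
have JA : J 1 (\1_A) = p.
  rewrite -Ap /Rintegral; congr fine.
  by rewrite integral_indic// setIidl.
have JF c : J 1 (fun x => F x - c) = - c.
  rewrite (IB (mD 1) (fD 1) bF (bm_cst c)) (IB (mD 1) (fD 1) b1 (bm_cst p)) JA.
  by rewrite !(Icst (mD 1)) mu_itv// subr0 !mulr1 subrr sub0r.
have JF0 : J 1 F = 0.
  by rewrite (IB (mD 1) (fD 1) b1 (bm_cst p)) JA (Icst (mD 1)) mu_itv// subr0 mulr1 subrr.
have hU : ae01 (birkhoff_unbounded F) by exact: birkhoff_unbounded_ae.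
have hB : {ae mu, forall x : R, forall k : nat, 0 <= x < 1 ->
    ~ birkhoff_unbounded (fun y => F y - (k.+1%:R)^-1) x}.
  apply: ae_foralln => k; apply: birkhoff_bounded_above.
    by apply: bmB => //; exact: bm_cst.
  by rewrite JF oppr_lt0 invr_gt0.
apply: aeS2 hU hB => x h1 h2 x01 N k.
(* With [c = 1 / (2 (k + 1))] the sum times [k + 1] is at most [m (k + 1) + n / 2]; since [n] is at
   least the sum, the choice of [n] below makes [m (k + 1) <= n / 2]. *)
have [m hm] : exists m : nat, forall n,
    birkhoff (fun y => F y - ((k.*2.+1).+1%:R)^-1) n x < m%:R.
  apply: contrapT => h; apply: (h2 k.*2.+1 x01) => m; apply: contrapT => h'.
  apply: h; exists m => n; rewrite ltNge; apply/negP => h3; apply: h'; by exists n.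
have bk c n y : birkhoff (fun y => F y - c) n y = birkhoff F n y - n%:R * c.
  elim: n y => [|n IH] y /=; first by rewrite mul0r subr0.
  by rewrite IH -natr1 mulrDl mul1r; ring.
have bn n y : birkhoff F n y <= n%:R.
  elim: n y => [|n IH] y //=; have := IH (tau y); rewrite -natr1.
  have : F y <= 1.
    by rewrite /F indicE; case: (y \in A) => /=; lra.
  by lra.
have [n hn] := h1 x01 (maxn N (m * k.*2.+2)); exists n; split.
  by apply: le_trans hn; rewrite ler_nat leq_maxl.
have h4 : (m * k.*2.+2)%:R <= n%:R :> R.
  by apply: le_trans (bn n x); apply: le_trans hn; rewrite ler_nat leq_maxr.
have := hm n; rewrite bk ltrBlDr => h5.
have k2 : (k.*2.+2)%:R = 2 * k.+1%:R :> R by rewrite -doubleS -mul2n natrM.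
have kp : 0 < k.+1%:R :> R by [].
rewrite k2 in h5; rewrite natrM k2 in h4.
have h6 : (m%:R + n%:R * (2 * k.+1%:R)^-1) * (2 * k.+1%:R) =
    m%:R * (2 * k.+1%:R) + n%:R :> R.
  by rewrite mulrDl divfK// mulf_neq0// gt_eqF.
have h7 : birkhoff F n x * (2 * k.+1%:R) <= (m%:R + n%:R * (2 * k.+1%:R)^-1) * (2 * k.+1%:R).
  by apply: ler_wpM2r; [rewrite mulr_ge0//|exact: ltW].
rewrite h6 in h7; move: h7 h4.
rewrite (mulrCA (birkhoff F n x)).
set a := birkhoff F n x * _; set b := m%:R * _; lra.
Qed.

End ergodic.

(** * Multiplication operators and their adjoints *)

Section multiplication.
Context {R : realType}.
Implicit Types (f g h : hardy2 R) (z w c : R[i]) (phi : R[i] -> R[i]) (A : hardy2 R -> hardy2 R).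
Local Notation mu := (@lebesgue_measure R).
Local Notation circle := (`[0%R, (2 * pi)%R]%classic : set R).
Local Notation dot := (@hardy_dot R).

Lemma udiskE z : udisk z <-> normc z < 1.
Proof. by rewrite /udisk/= -(normrC_lt z 1). Qed.

Lemma HinftyP phi : Hinfty phi ->
  (forall z, normc z < 1 -> cderivable phi z) /\
  exists2 M, 0 <= M & forall z, normc z < 1 -> normc (phi z) <= M.
Proof.
move=> [hp [M hM]]; split; first by move=> z /udiskE/hp.
exists M => [|z /udiskE]; last exact: hM.
apply: le_trans (normc_ge0 (phi 0)) _; apply: hM; apply/udiskE.
by rewrite (normc_real 0) normr0.
Qed.

Lemma rc1_taylor f : rc1 (taylor f).
Proof. by apply: rc1_bounded => n; exact: coef_le_hn. Qed.

Lemma hardy_funE f z : hardy_fun f z = psum (taylor f) z. Proof. by []. Qed.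

Lemma hardy_fun_cderivable f z : normc z < 1 -> cderivable (hardy_fun f) z.
Proof. by move=> z1; apply: psum_cderivable => //; exact: rc1_taylor. Qed.

Lemma hardy_fun_linear c f g z : normc z < 1 ->
  hardy_fun (c *: f + g) z = c * hardy_fun f z + hardy_fun g z.
Proof.
move=> z1; have sf h := rc1_summable (rc1_taylor h) z1.
rewrite !hardy_funE /psum -(csumZ _ (sf f)) -(csumD (@csummableZ R c _ (sf f)) (sf g)).
by congr csum; apply/funext => n; rewrite taylorD taylorZ mulrDl mulrA.
Qed.

Lemma hardy_fun_eq0 f (d : R) : 0 < d <= 1 ->
  (forall z, normc z < d -> hardy_fun f z = 0) -> f = 0.
Proof. by move=> d0 h; apply: taylorP => n; exact: psum0_coef (rc1_taylor f) d0 h n. Qed.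

Lemma hardy_fun_inj f g : (forall z, normc z < 1 -> hardy_fun f z = hardy_fun g z) -> f = g.
Proof.
move=> h; apply/eqP; rewrite -subr_eq0; apply/eqP.
apply: (@hardy_fun_eq0 _ 1); first by rewrite ltr01 lexx.
move=> z z1; rewrite (_ : f - g = (-1) *: g + f); last by rewrite scaleN1r addrC.
by rewrite hardy_fun_linear// h// mulN1r addNr.
Qed.

Lemma lim_le_cst {T : Type} (F : set_system T) {FF : ProperFilter F} (u : T -> R) (l K : R) :
  u x @[x --> F] --> l -> (\forall x \near F, u x <= K) -> l <= K.
Proof. by move=> ul uK; apply: (closed_cvg (fun y => y <= K) _ uK) ul; exact: closed_le. Qed.

Lemma int_hardy_fun f (r : R) : 0 <= r < 1 ->
  \int[mu]_(t in circle) normc (hardy_fun f (r%:C * expi t)) ^+ 2 <= 2 * pi * hn f ^+ 2.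
Proof.
move=> r1; have h := parseval (rc1_taylor f) r1.
apply: (lim_le_cst h); apply: nearW => N.
rewrite ler_pM2l ?pi2_gt0// hn_sq; apply: le_trans (sqsum_le_lim (taylor_l2 f) N).
apply: ler_sum => n _; rewrite ler_piMr ?sqr_ge0//.
by apply: exprn_ile1; case/andP: r1 => // r0 /ltW.
Qed.

Lemma poly_le_limit (b : nat -> R) (N : nat) (K : R) :
  (forall r, 0 <= r < 1 -> \sum_(0 <= n < N) b n * r ^+ (2 * n) <= K) ->
  \sum_(0 <= n < N) b n <= K.
Proof.
move=> h; pose P r := \sum_(0 <= n < N) b n * r ^+ (2 * n).
have cP : (P r) @[r --> (1 : R)^'-] --> P 1.
  apply: cvg_within_filter; apply: (@cvg_sum R _ _ _ (fun n r => b n * r ^+ (2 * n))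
    (fun n => b n * 1 ^+ (2 * n))) => n.
  by apply: cvgMl_tmp; exact: exprn_continuous.
have -> : \sum_(0 <= n < N) b n = P 1 by apply: eq_bigr => n _; rewrite expr1n mulr1.
apply: (lim_le_cst cP).
near=> r; apply: h; apply/andP; split; last by near: r; exact: nbhs_left_lt.
by apply/ltW; near: r; apply: nbhs_left_gt; exact: ltr01.
Unshelve. all: by end_near.
Qed.

Section symbol.
Variables (phi : R[i] -> R[i]) (M : R).
Hypothesis dphi : forall z, normc z < 1 -> cderivable phi z.
Hypothesis M0 : 0 <= M.
Hypothesis phiM : forall z, normc z < 1 -> normc (phi z) <= M.

(** Parseval on each circle bounds the weighted square sums of the Taylor coefficients of the
    product, and the radius tends to 1. So the set from which [mul_op] chooses is nonempty. *)
Lemma mul_op_exists f : exists g,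
  (forall z, normc z < 1 -> hardy_fun g z = phi z * hardy_fun f z) /\ hn g <= M * hn f.
Proof.
have [|d rd hd] := @holomorphic_psum R (fun z => phi z * hardy_fun f z).
  by move=> z z1; apply: cderivableM; [exact: dphi|exact: hardy_fun_cderivable].
have key N : sqsum d N <= (M * hn f) ^+ 2.
  apply: (@poly_le_limit (fun n => normc (d n) ^+ 2)) => r r1.
  rewrite -(@ler_pM2l _ (2 * pi)) ?pi2_gt0//.
  apply: le_trans (parseval_le N rd r1) _.
  have rt t : normc (r%:C * expi t) < 1.
    by case/andP: r1 => r0 r1; rewrite normcM normc_expi mulr1 normc_real ger0_norm.
  have bf : bm (fun t => normc (hardy_fun f (r%:C * expi t)) ^+ 2).
    by apply: bmC_normc2; exact: bmC_psum_circle (rc1_taylor f) r1.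
  apply: le_trans (_ : M ^+ 2 *
      \int[mu]_(t in circle) normc (hardy_fun f (r%:C * expi t)) ^+ 2 <= _).
    rewrite -(IZ mcircle fcircle)//; apply: (I_le mcircle fcircle).
    - by apply: bmC_normc2; exact: bmC_psum_circle rd r1.
    - exact: bmZ.
    - move=> t _; rewrite -hd// normcM exprMn ler_wpM2r ?sqr_ge0//.
      by rewrite lerXn2r ?nnegrE ?normc_ge0 ?phiM.
  by rewrite exprMn mulrCA ler_wpM2l ?sqr_ge0// int_hardy_fun.
have dl2 : (d : nat -> R[i]^o) \in l2 by exact: l2_le key.
exists (Hardy2 dl2); split; first by move=> z z1; rewrite hd.
rewrite -(@ler_pXn2r _ 2)// ?nnegrE ?hn_ge0// ?mulr_ge0// ?hn_ge0// hn_sq.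
exact: lim_sqsum_le.
Qed.

Lemma mul_opP f z : normc z < 1 -> hardy_fun (mul_op phi f) z = phi z * hardy_fun f z.
Proof.
have [g [hg _]] := mul_op_exists f.
have : [set g | forall z, udisk z -> hardy_fun g z = phi z * hardy_fun f z] g.
  by move=> w /udiskE; exact: hg.
by move=> /(getI (P := _)) h z1; apply: h; exact/udiskE.
Qed.

Lemma mul_op_le f : hn (mul_op phi f) <= M * hn f.
Proof.
have [g [hg gM]] := mul_op_exists f.
by rewrite (_ : mul_op phi f = g)//; apply: hardy_fun_inj => z z1; rewrite hg// mul_opP.
Qed.

Lemma mul_op_linear c f g : mul_op phi (c *: f + g) = c *: mul_op phi f + mul_op phi g.
Proof.
apply: hardy_fun_inj => z z1.
rewrite mul_opP// !hardy_fun_linear// !mul_opP//; ring.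
Qed.

(** [adjoint] chooses from a set of maps, which Riesz' theorem on the whole space shows to be
    nonempty. *)
Lemma adjointP f g : dot (mul_op phi f) g = dot f (adjoint (mul_op phi) g).
Proof.
have ex h : exists x, forall f, dot (mul_op phi f) h = dot f x.
  have [|||||x [_ _ hx]] := @riesz R setT (fun f => dot (mul_op phi f) h) (M * hn h).
  - by [].
  - by [].
  - by move=> c f1 f2 _ _; rewrite mul_op_linear dotDl dotZl.
  - by rewrite mulr_ge0// hn_ge0.
  - move=> f1 _; apply: le_trans (dot_CS _ _) _; rewrite mulrAC.
    by rewrite ler_wpM2r ?hn_ge0// mul_op_le.
  by exists x => f1; exact: hx.
have [B hB] := choice ex.
have : [set B : hardy2 R -> hardy2 R |
    forall f g, dot (mul_op phi f) g = dot f (B g)] B by move=> f1 g1; exact: hB.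
by move=> /(getI (P := _)) h; exact: h.
Qed.

End symbol.
End multiplication.

(** * Evaluation kernels, polynomials, and Riesz' theorem through an operator *)

Section kernels.
Context {R : realType}.
Implicit Types (f g h x y : hardy2 R) (z w c : R[i]) (e : R).
Local Notation dot := (@hardy_dot R).

Definition eval_kernel z : hardy2 R := get [set k : hardy2 R | forall n, taylor k n = z^* ^+ n].

Lemma taylor_kernel z n : normc z < 1 -> taylor (eval_kernel z) n = z^* ^+ n.
Proof.
move=> z1; pose k n : R[i]^o := z^* ^+ n.
have kl2 : k \in l2.
  apply/l2P; rewrite (_ : sqsum k = series (fun n => 1 * (normc z ^+ 2) ^+ n)).
    by apply: geo_cvg; rewrite sqr_ge0 expr_lt1// normc_ge0.
  by apply/funext => m; apply: eq_bigr => j _; rewrite normcX normc_conj mul1r exprAC.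
have : [set k : hardy2 R | forall n, taylor k n = z^* ^+ n] (Hardy2 kl2) by [].
by move=> /(getI (P := _)) hk; exact: hk.
Qed.

Lemma dot_kernel f z : normc z < 1 -> dot f (eval_kernel z) = hardy_fun f z.
Proof.
move=> z1; rewrite dotE; congr csum; apply/funext => n.
by rewrite taylor_kernel// cJX conjcK.
Qed.

Lemma dot_inj x y : (forall g, dot g x = dot g y) -> x = y.
Proof.
move=> h; apply/eqP; rewrite -subr_eq0; apply/eqP/hn_eq0/eqP.
rewrite -sqrf_eq0; apply/eqP; apply: (@complexI R).
by rewrite -dotff dotDr dotNr h subrr.
Qed.

(** The polynomials: enough of them to separate vectors, and continuous up to the circle. *)
Definition finite_taylor f := exists N, forall n, (N <= n)%N -> taylor f n = 0.

Lemma finite_taylor0 : finite_taylor 0. Proof. by exists 0%N. Qed.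

Lemma finite_taylorP c f g : finite_taylor f -> finite_taylor g -> finite_taylor (c *: f + g).
Proof.
move=> [N hN] [N' hN']; exists (maxn N N') => n; rewrite geq_max => /andP[h1 h2].
by rewrite taylorD taylorZ hN// hN'// mulr0 addr0.
Qed.

Lemma monomial_dot n : exists2 f, finite_taylor f & forall x, dot f x = (taylor x n)^*.
Proof.
pose k m : R[i]^o := (m == n)%:R.
have kl2 : k \in l2.
  apply: (@l2_le _ _ 1) => m; rewrite /sqsum.
  have [nm|mn] := ltnP n m.
    rewrite big_mkord (bigD1 (Ordinal nm))//= big1 ?addr0 /k ?eqxx ?(normc_real 1) ?normr1 ?expr1n//.
    by move=> i; rewrite -val_eqE/= => /negbTE ->; rewrite (normc_real 0) normr0 expr0n.
  rewrite big_nat big1 ?ler01// => i /andP[_ im].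
  by rewrite /k ltn_eqF ?(leq_trans im)// (normc_real 0) normr0 expr0n.
exists (Hardy2 kl2).
  by exists n.+1 => m nm /=; rewrite /k gtn_eqF.
move=> x; rewrite dotE (@csum_fin _ _ n.+1).
  rewrite /series/= big_nat_recr//= big_nat big1 ?add0r /k ?eqxx ?mul1r//.
  by move=> i /andP[_ im]; rewrite ltn_eqF// mul0r.
by move=> m nm; rewrite /= /k gtn_eqF// mul0r.
Qed.

Lemma dot_finite_taylor_inj x y : (forall g, finite_taylor g -> dot g x = dot g y) -> x = y.
Proof.
move=> h; apply: taylorP => n; have [f pf hf] := monomial_dot n.
by have := h f pf; rewrite !hf => /(congr1 (@conjc R)); rewrite !conjcK.
Qed.

Inductive kernel_span (D : set R[i]) : hardy2 R -> Prop :=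
| kernel_span0 : kernel_span D 0
| kernel_spanD c z f : D z -> kernel_span D f -> kernel_span D (c *: eval_kernel z + f).

Lemma kernel_spanP D c f g : kernel_span D f -> kernel_span D g -> kernel_span D (c *: f + g).
Proof.
move=> hf hg; elim: hf => [|a z f1 Dz _ IH]; first by rewrite scaler0 add0r.
by rewrite scalerDr scalerA -addrA; exact: kernel_spanD.
Qed.

(** Riesz' theorem on the span yields the orthogonal projection [x] of [f] on its closure; [f - x]
    is orthogonal to the kernels, so as a function it vanishes near [z0]. *)
Lemma kernel_span_dense (D : set R[i]) z0 (d : R) f e :
  (forall z, D z -> normc z < 1) -> normc z0 < 1 -> 0 < d ->
  (forall z, normc z < 1 -> normc (z - z0) < d -> D z) -> 0 < e ->
  exists2 g, kernel_span D g & hn (g - f) <= e.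
Proof.
move=> D1 z01 d0 hD e0.
have [|||||x [_ ax hx]] := @riesz R (kernel_span D) (fun g => dot g f) (hn f).
- exact: kernel_span0.
- by move=> c g h; exact: kernel_spanP.
- by move=> c g h _ _; rewrite dotDl dotZl.
- exact: hn_ge0.
- by move=> g _; apply: le_trans (dot_CS _ _) _; rewrite mulrC.
suff -> : f = x by exact: ax.
apply/eqP; rewrite -subr_eq0; apply/eqP.
apply: (@hardy_fun_eq0 _ _ 1); first by rewrite ltr01 lexx.
apply: (@identity_theorem R (hardy_fun (f - x)) z0 d) => //.
  by move=> w w1; exact: hardy_fun_cderivable.
move=> w w1 wd; rewrite -dot_kernel// dotDl dotNl.
have /hx : kernel_span D (eval_kernel w).
  rewrite -[eval_kernel w]addr0 -[eval_kernel w]scale1r.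
  by apply: kernel_spanD; [exact: hD|exact: kernel_span0].
by rewrite dotC [dot _ x]dotC => /(congr1 (@conjc R)); rewrite !conjcK => ->; rewrite subrr.
Qed.

(** The bound forces [l] to vanish where [P] does in [G], so [l] descends to the image of [G] under
    [P], where Riesz' theorem applies; [s] is a section of [P]. *)
Lemma riesz_factor (G : set (hardy2 R)) (P : hardy2 R -> hardy2 R) (l : hardy2 R -> R[i]) (K : R) :
  G 0 -> (forall c f g, G f -> G g -> G (c *: f + g)) ->
  (forall c f g, P (c *: f + g) = c *: P f + P g) ->
  (forall c f g, l (c *: f + g) = c * l f + l g) ->
  0 <= K -> (forall g, G g -> normc (l g) <= K * hn (P g)) ->
  exists2 x, hn x <= K & forall g, G g -> l g = dot (P g) x.
Proof.
move=> G0 GP Plin llin K0 lK.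
pose s h := get [set g | G g /\ P g = h].
have sP g : G g -> G (s (P g)) /\ P (s (P g)) = P g.
  move=> Gg; have : [set g' | G g' /\ P g' = P g] g by [].
  by move=> /(getI (P := _)).
have leq g g' : G g -> G g' -> P g = P g' -> l g = l g'.
  move=> Gg Gg' e; apply/eqP; rewrite -subr_eq0 -normc_eq0 eq_le normc_ge0 andbT.
  have Gd := GP (-1) g' g Gg' Gg.
  have := lK _ Gd; rewrite llin mulN1r Plin e scaleN1r addNr hn0 mulr0 addrC.
  by [].
have ls g : G g -> l (s (P g)) = l g by move=> Gg; have [a b] := sP g Gg; exact: leq.
have P0 : P 0 = 0.
  by have := Plin (-1) 0 0; rewrite scaler0 addr0 scaleN1r addNr.
have [|||||x [xK _ hx]] := @riesz R [set h | exists2 g, G g & P g = h] (fun h => l (s h)) K.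
- by exists 0.
- by move=> c _ _ [g Gg <-] [g' Gg' <-]; exists (c *: g + g'); [exact: GP|exact: Plin].
- by move=> c _ _ [g Gg <-] [g' Gg' <-]; rewrite -Plin !ls//; exact: GP.
- exact: K0.
- by move=> _ [g Gg <-]; rewrite ls//; exact: lK.
by exists x => // g Gg; rewrite -ls// hx//; exists g.
Qed.

End kernels.

(** * Products of adjoints of multiplications *)

Section products.
Context {R : realType}.
Implicit Types (f g h x y : hardy2 R) (z w c : R[i]) (e : R).
Local Notation dot := (@hardy_dot R).
Variables (psi : nat -> R[i] -> R[i]) (M : R).
Hypothesis dpsi : forall j z, normc z < 1 -> cderivable (psi j) z.
Hypothesis M0 : 0 <= M.
Hypothesis psiM : forall j z, normc z < 1 -> normc (psi j z) <= M.

Fixpoint adjoint_product n : hardy2 R -> hardy2 R :=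
  if n is n'.+1 then adjoint (mul_op (psi n')) \o adjoint_product n' else idfun.

(** The factors come in the order opposite to [adjoint_product], so that the two are adjoint to each
    other step by step. *)
Fixpoint mul_product n f : hardy2 R :=
  if n is n'.+1 then mul_product n' (mul_op (psi n') f) else f.

Definition symbol n z := \prod_(0 <= j < n) psi j z.

Lemma mul_productE n f z : normc z < 1 ->
  hardy_fun (mul_product n f) z = symbol n z * hardy_fun f z.
Proof.
move=> z1; elim: n f => [|n IH] f /=; first by rewrite /symbol big_nil mul1r.
rewrite IH (mul_opP (@dpsi n) M0 (@psiM n))// /symbol big_nat_recr//=; ring.
Qed.

Lemma mul_product_linear n c f g :
  mul_product n (c *: f + g) = c *: mul_product n f + mul_product n g.
Proof.
apply: hardy_fun_inj => z z1; rewrite mul_productE// !hardy_fun_linear// !mul_productE//; ring.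
Qed.

Lemma dot_mul_product n f g : dot (mul_product n f) g = dot f (adjoint_product n g).
Proof.
elim: n f g => [|n IH] f g //=.
by rewrite IH (adjointP (@dpsi n) M0 (@psiM n)).
Qed.

Lemma adjoint_product_linear n c f g :
  adjoint_product n (c *: f + g) = c *: adjoint_product n f + adjoint_product n g.
Proof. by apply: dot_inj => h; rewrite -dot_mul_product !dotDr !dotZr !dot_mul_product. Qed.

Lemma adjoint_product_kernel n z : normc z < 1 ->
  adjoint_product n (eval_kernel z) = (symbol n z)^* *: eval_kernel z.
Proof.
move=> z1; apply: dot_inj => h.
by rewrite -dot_mul_product dotZr conjcK !dot_kernel// mul_productE.
Qed.

(** A preimage is an [x] with [dot (mul_product n g) x = hardy_fun g z] for all polynomials [g]; the
    lower bound on [mul_product] is what [riesz_factor] asks for. *)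
Lemma adjoint_product_preimage n z (K : R) : normc z < 1 -> 0 <= K ->
  (forall g, finite_taylor g -> normc (hardy_fun g z) <= K * hn (mul_product n g)) ->
  exists2 x, hn x <= K & adjoint_product n x = eval_kernel z.
Proof.
move=> z1 K0 h.
have [||||||x xK hx] := @riesz_factor R (@finite_taylor R) (mul_product n) (fun g => hardy_fun g z) K.
- exact: finite_taylor0.
- exact: finite_taylorP.
- exact: mul_product_linear.
- by move=> c f g; exact: hardy_fun_linear.
- exact: K0.
- exact: h.
exists x => //; apply: dot_finite_taylor_inj => g pg.
by rewrite -dot_mul_product -hx// dot_kernel.
Qed.

End products.

(** * A criterion for topological weak mixing *)

Section criterion.
Context {R : realType}.
Implicit Types (f g h x y : hardy2 R) (z w c : R[i]) (e : R).

Lemma open_hn (U : set (hardy2 R)) f : open U -> U f ->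
  exists2 e, 0 < e & forall g, hn (g - f) <= e -> U g.
Proof.
move=> oU Uf; have /nbhs_ballP[e e0 hU] := open_nbhs_nbhs (conj oU Uf).
case: e e0 hU => a b; rewrite /= ltcE => /andP[/eqP/= -> a0] hU.
exists (a / 2); first by rewrite divr_gt0.
move=> g hg; apply: hU; rewrite -ball_normE/= distrC hnE ltcR.
by apply: le_lt_trans hg _; lra.
Qed.

(** [Q n f e] stands for [S n f] having norm at most [e], or for [f] having a preimage of norm at
    most [e]; both pass from kernels to linear combinations. *)
Lemma eventually_span (B : nat -> set nat) (Q : nat -> hardy2 R -> R -> Prop) (D : set R[i]) f :
  (forall i j, (i <= j)%N -> B j `<=` B i) ->
  (forall n e, 0 < e -> Q n 0 e) ->
  (forall n c f g e1 e2 e, normc c * e1 + e2 <= e -> Q n f e1 -> Q n g e2 -> Q n (c *: f + g) e) ->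
  (forall z e, D z -> 0 < e -> exists j, forall n, B j n -> Q n (eval_kernel z) e) ->
  kernel_span D f -> forall e, 0 < e -> exists j, forall n, B j n -> Q n f e.
Proof.
move=> BB Q0 QD Qk; elim => [|c z g Dz _ IH] e e0; first by exists 0%N => n _; exact: Q0.
have c1 : 0 < 2 * (normc c + 1) by have := normc_ge0 c; lra.
have e1 : 0 < e / (2 * (normc c + 1)) by rewrite divr_gt0.
have e2 : 0 < e / 2 by rewrite divr_gt0.
have [j hj] := Qk z _ Dz e1; have [j' hj'] := IH _ e2.
exists (maxn j j') => n Bn; apply: (QD _ _ _ _ _ _ _ _ (hj n _) (hj' n _)).
- have : normc c * (e / (2 * (normc c + 1))) <= e / 2; last by lra.
  rewrite invfM !mulrA ler_pdivrMr; last by have := normc_ge0 c; lra.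
  by move: (normc c) => N; lra.
- exact: BB (leq_maxl _ _) _ Bn.
- exact: BB (leq_maxr _ _) _ Bn.
Qed.

(* A form of the hypercyclicity criterion, along the sets of times [B j]. *)
Lemma weak_mixing_criterion (S : nat -> hardy2 R -> hardy2 R) (B : nat -> set nat)
    (D1 D2 : set R[i]) :
  (forall n c f g, S n (c *: f + g) = c *: S n f + S n g) ->
  (forall i j, (i <= j)%N -> B j `<=` B i) -> (forall j, B j !=set0) ->
  (forall j n, B j n -> (1 <= n)%N) ->
  (forall z e, D1 z -> 0 < e -> exists j, forall n, B j n -> hn (S n (eval_kernel z)) <= e) ->
  (forall z e, D2 z -> 0 < e -> exists j, forall n, B j n ->
    exists2 x, hn x <= e & S n x = eval_kernel z) ->
  (forall f e, 0 < e -> exists2 g, kernel_span D1 g & hn (g - f) <= e) ->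
  (forall f e, 0 < e -> exists2 g, kernel_span D2 g & hn (g - f) <= e) ->
  topologically_weakly_mixing S.
Proof.
move=> Slin BB B0 B1 hD1 hD2 dense1 dense2 U1 U2 V1 V2 oU1 oU2 oV1 oV2 [u1 Uu1] [u2 Uu2] [v1 Vv1] [v2 Vv2].
have S0 n : S n 0 = 0.
  by have := Slin n (-1) 0 0; rewrite scaler0 addr0 scaleN1r addNr.
have h1 := @eventually_span B (fun n f e => hn (S n f) <= e) D1.
have h2 := @eventually_span B (fun n f e => exists2 x, hn x <= e & S n x = f) D2.
have key U V u v : open U -> open V -> U u -> V v ->
    exists j, forall n, B j n -> (S n @` U) `&` V !=set0.
  move=> oU oV Uu Vv.
  have [e e0 hU] := open_hn oU Uu; have [e' e'0 hV] := open_hn oV Vv.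
  have e2 : 0 < e / 2 by lra. have e2' : 0 < e' / 2 by lra.
  have [x sx xu] := dense1 u _ e2; have [y sy yv] := dense2 v _ e2'.
  have [||j hj] := h1 x BB _ _ hD1 sx _ e2'.
  - by move=> n a a0; rewrite S0 hn0 ltW.
  - move=> n c f g a b d le ha hb; rewrite Slin; apply: le_trans (hnD _ _) (le_trans _ le).
    by rewrite lerD// hnZ ler_wpM2l// normc_ge0.
  have [||j' hj'] := h2 y BB _ _ hD2 sy _ e2.
  - by move=> n a a0; exists 0; rewrite ?hn0 ?S0// ltW.
  - move=> n c f g a b d le [f' hf <-] [g' hg <-]; exists (c *: f' + g'); last exact: Slin.
    apply: le_trans (hnD _ _) (le_trans _ le).
    by rewrite lerD// hnZ ler_wpM2l// normc_ge0.
  exists (maxn j j') => n Bn.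
  have hx := hj n (BB _ _ (leq_maxl _ _) _ Bn).
  have [y' hy' Sy'] := hj' n (BB _ _ (leq_maxr _ _) _ Bn).
  (* [x + y'] is close to [u] because [y'] is small, and its image [S n x + y] is close to [v]
     because [S n x] is small. *)
  exists (S n (x + y')); split.
    exists (x + y') => //; apply: hU; rewrite addrAC; apply: le_trans (hnD _ _) _; lra.
  apply: hV; rewrite -[x]scale1r Slin scale1r Sy' -addrA.
  by apply: le_trans (hnD _ _) _; lra.
have [j hj] := key _ _ _ _ oU1 oV1 Uu1 Vv1; have [j' hj'] := key _ _ _ _ oU2 oV2 Uu2 Vv2.
have [n Bn] := B0 (maxn j j'); exists n; split; first exact: B1 Bn.
  exact: hj (BB _ _ (leq_maxl _ _) _ Bn).
exact: hj' (BB _ _ (leq_maxr _ _) _ Bn).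
Qed.

End criterion.

(** * The lower bound for multiplication that yields small preimages *)

Section preimage.
Context {R : realType}.
Implicit Types (s t r : R) (z w : R[i]) (f g h : hardy2 R) (v b : R -> R).
Local Notation mu := (@lebesgue_measure R).
Local Notation circle := (`[0%R, (2 * pi)%R]%classic : set R).

Lemma cderivable_sum (N : nat) (F : nat -> R[i] -> R[i]) z : (forall n, cderivable (F n) z) ->
  cderivable (fun w => \sum_(0 <= n < N) F n w) z.
Proof.
move=> dF; elim: N => [|N IH].
  have -> : (fun w : R[i] => \sum_(0 <= n < 0) F n w) = (fun=> 0) by apply/funext => w; rewrite big_nil.
  exact: cderivable_cst.
have -> : (fun w : R[i] => \sum_(0 <= n < N.+1) F n w) =
    (fun w => \sum_(0 <= n < N) F n w + F N w) by apply/funext => w; rewrite big_nat_recr.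
exact: (cderivableD IH (dF N)).
Qed.

Lemma hardy_fun_finite_taylor g : finite_taylor g -> exists N, forall w,
  hardy_fun g w = \sum_(0 <= n < N) taylor g n * w ^+ n.
Proof.
move=> [N hN]; exists N => w; rewrite hardy_funE /psum (@csum_fin _ _ N)// => n Nn.
by rewrite hN// mul0r.
Qed.

Lemma cderivable_finite_taylor g z : finite_taylor g -> cderivable (hardy_fun g) z.
Proof.
move=> /hardy_fun_finite_taylor[N gE].
have -> : hardy_fun g = (fun w => \sum_(0 <= n < N) taylor g n * w ^+ n) by exact/funext.
apply: cderivable_sum => n.
refine (@cderivableM R (fun=> taylor g n) (fun w => w ^+ n) z _ _).
  exact: (@cderivable_cst R (taylor g n) z).
exact: (@cderivableX R (fun w => w) z n (@cderivable_id R z)).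
Qed.

Lemma bmC_finite_taylor g : finite_taylor g -> bmC (fun t => hardy_fun g (expi t)).
Proof.
move=> /hardy_fun_finite_taylor[N gE].
have -> : (fun t => hardy_fun g (expi t)) =
    (fun t => \sum_(0 <= n < N) taylor g n * expi (n%:R * t)); last first.
  by apply: bmC_sum => n; apply: bmCM; [exact: bmC_cst|exact: bmC_expi].
by apply/funext => t; rewrite gE; apply: eq_bigr => n _; rewrite expiMn.
Qed.

Lemma finite_taylor_bounded g : finite_taylor g ->
  exists M, forall w, normc w < 1 -> normc (hardy_fun g w) <= M.
Proof.
move=> /hardy_fun_finite_taylor[N gE]; exists (\sum_(0 <= n < N) normc (taylor g n)) => w w1.
rewrite gE; apply: le_trans (normc_sum _ _ _) _; apply: ler_sum => n _.
rewrite normcM normcX ler_piMr ?normc_ge0// exprn_ile1 ?normc_ge0//; exact: ltW.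
Qed.

Lemma radius_disk k t : normc ((dilation k)%:C * expi t : R[i]) < 1.
Proof.
have /andP[r0 r1] := @radius_itv R k.
by rewrite normcM normc_expi mulr1 normc_real gtr0_norm.
Qed.

Lemma boundary_l2 h b (K : R) : bm b ->
  (forall w, normc w < 1 -> normc (hardy_fun h w) <= K) ->
  {ae mu, forall t, circle t ->
    (fun k => normc (hardy_fun h ((dilation k)%:C * expi t))) @ \oo --> b t} ->
  \int[mu]_(t in circle) (b t ^+ 2) <= 2 * pi * hn h ^+ 2.
Proof.
move=> bb hK hb.
have b2 : bm (fun t => b t ^+ 2) by under eq_fun do rewrite expr2; exact: bmM.
have rk k : 0 <= (dilation k : R) < 1 by have /andP[/ltW -> ->] := @radius_itv R k.
have H : (fun k => \int[mu]_(t in circle) (normc (hardy_fun h ((dilation k)%:C * expi t)) ^+ 2))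
    @ \oo --> \int[mu]_(t in circle) (b t ^+ 2).
  apply: (@I_dct R _ mcircle fcircle _ _ (K ^+ 2)) => //.
  - by move=> k; apply: bmC_normc2; exact: bmC_psum_circle (rc1_taylor h) (rk k).
  - move=> k t; rewrite ger0_norm ?sqr_ge0// lerXn2r ?nnegrE ?normc_ge0//.
      exact: le_trans (normc_ge0 _) (hK _ (radius_disk k t)).
    exact: hK (radius_disk k t).
  - by apply: aeS hb => t + ti => /(_ ti) hc; rewrite expr2; under eq_fun do rewrite expr2; exact: cvgM.
by apply: (lim_le_cst H); apply: nearW => k; exact: int_hardy_fun.
Qed.

(** [C] bounds the Poisson kernel at [z]; its square root is the constant of [preimage_bound]. *)
Lemma rpois_bound z : normc z < 1 -> exists2 C, 0 <= C &
  forall u, bm u -> (forall t, 0 <= u t) ->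
  rpois u z <= C * ((2 * pi)^-1 * \int[mu]_(t in circle) u t).
Proof.
move=> z1; have [_ [C hC]] := bm_pois z1.
have C0 : 0 <= C by exact: le_trans (normr_ge0 _) (hC 0).
exists C => // u bu u0; rewrite mulrCA ler_wpM2l// ?invr_ge0 ?mulr_ge0// ?pi_ge0//.
rewrite -(IZ mcircle fcircle)//; apply: (I_le mcircle fcircle).
- by apply: bmM => //; exact: bm_pois.
- exact: bmZ.
- by move=> t _; rewrite ler_wpM2r// (le_trans (ler_norm _) (hC t)).
Qed.

Lemma max_sq_le (a d : R) : 0 <= a -> Num.max a d ^+ 2 <= a ^+ 2 + d ^+ 2.
Proof.
by move=> a0; case: (leP a d) => h; rewrite ?lerDl ?lerDr sqr_ge0.
Qed.

Lemma le_sq_small (x y E : R) : 0 <= E -> (forall d, 0 < d -> x <= y + d ^+ 2 * E) -> x <= y.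
Proof.
move=> E0 h; apply: le_small => e e0.
have e1 : 0 < e / (E + 1) by rewrite divr_gt0//; lra.
have s0 : 0 < Num.sqrt (e / (E + 1)) by rewrite sqrtr_gt0.
apply: le_trans (h _ s0) _; rewrite (sqr_sqrtr (ltW e1)) lerD2l mulrAC ler_pdivrMr; last by lra.
by rewrite ler_pM2l//; lra.
Qed.

(* Jensen's inequality for [2 (ln |g| + c v)], with [|g|] truncated from below. *)
Lemma preimage_bound z : normc z < 1 -> exists2 C, 0 <= C &
  forall (c : R) v g h (K : R), bm v -> finite_taylor g ->
    (forall w, normc w < 1 -> normc (hardy_fun h w) <= K) ->
    {ae mu, forall t, circle t ->
      (fun k => normc (hardy_fun h ((dilation k)%:C * expi t))) @ \oo -->
        normc (hardy_fun g (expi t)) * expR (c * v t)} ->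
    normc (hardy_fun g z) <= C * expR (- (c * rpois v z)) * hn h.
Proof.
move=> z1; have [C C0 hC] := rpois_bound z1.
exists (Num.sqrt C); first exact: sqrtr_ge0.
move=> c v g h K bv pg hK hb.
have bg : bm (fun t => normc (hardy_fun g (expi t))) by exact: bmC_normc (bmC_finite_taylor pg).
have bcv : bm (fun t => c * v t) by exact: bmZ.
have bexp u : bm u -> bm (fun t => expR (u t)).
  move=> bu; apply: (@bm_comp_cont R u expR bu (@continuous_expR R)).
  have [_ [M uM]] := bu; exists (expR M) => x.
  by rewrite ger0_norm ?expR_ge0// ler_expR (le_trans (ler_norm _) (uM x)).
(* The boundary modulus of [h], which in the application is the symbol times [g]. *)
pose b t := normc (hardy_fun g (expi t)) * expR (c * v t).
have bb : bm b by apply: bmM => //; exact: bexp.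
have b2 : bm (fun t => b t ^+ 2) by under eq_fun do rewrite expr2; exact: bmM.
have be2 : bm (fun t => expR (2 * (c * v t))) by apply: bexp; exact: bmZ.
pose E := (2 * pi)^-1 * \int[mu]_(t in circle) expR (2 * (c * v t)).
have E0 : 0 <= E.
  rewrite mulr_ge0 ?invr_ge0 ?mulr_ge0// ?pi_ge0//.
  apply: le_trans (_ : \int[mu]_(t in circle) 0 <= _); first by rewrite (Icst mcircle) mul0r.
  by apply: (I_le mcircle fcircle (bm_cst 0) be2) => t _; exact: expR_ge0.
set X := normc (hardy_fun g z).
suff key : (X * expR (c * rpois v z)) ^+ 2 <= C * hn h ^+ 2.
  have : X * expR (c * rpois v z) <= Num.sqrt C * hn h.
    rewrite -(@ler_pXn2r _ 2)// ?nnegrE ?mulr_ge0 ?sqrtr_ge0 ?hn_ge0 ?expR_ge0 ?normc_ge0//.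
    by rewrite [leRHS]exprMn sqr_sqrtr.
  by rewrite expRN mulrAC ler_pdivlMr ?expR_gt0.
(* Truncating [|g|] from below at [d] costs [d^2 C E], which vanishes as [d] tends to 0. *)
apply: (@le_sq_small _ _ (C * E)); first by rewrite mulr_ge0.
move=> d d0.
pose v1 t := ln (Num.max (normc (hardy_fun g (expi t))) d).
have bv1 : bm v1 by exact: bm_ln_max.
have e1 t : expR (v1 t) = Num.max (normc (hardy_fun g (expi t))) d.
  by rewrite lnK// posrE lt_max d0 orbT.
have [M gM] := finite_taylor_bounded pg.
have X1 : X <= expR (rpois v1 z).
  apply: (@boundary_majorant R (hardy_fun g) v1 M z) => //.
    by move=> w _; exact: cderivable_finite_taylor.
  apply: aeW => t _; exists (normc (hardy_fun g (expi t))); last by rewrite e1 le_max lexx.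
  by apply: radius_cvg_at; [rewrite normc_expi|exact: cderivable_finite_taylor].
pose w t := v1 t + c * v t.
have bw : bm w by exact: bmD.
have bw2 : bm (fun t => 2 * w t) by exact: bmZ.
have X2 : (X * expR (c * rpois v z)) ^+ 2 <= expR (rpois (fun t => 2 * w t) z).
  rewrite rpoisZ// rpoisD// rpoisZ// expRM_natl.
  rewrite lerXn2r ?nnegrE ?mulr_ge0 ?expR_ge0 ?normc_ge0// expRD ler_wpM2r ?expR_ge0//.
apply: le_trans X2 (le_trans (rpois_jensen bw2 (bexp _ bw2) z1) _).
apply: le_trans (hC _ (bexp _ bw2) (fun t => expR_ge0 _)) _.
rewrite (mulrCA _ C E) -mulrDr ler_wpM2l//.
rewrite mulrC ler_pdivrMr ?pi2_gt0//.
have -> : (hn h ^+ 2 + d ^+ 2 * E) * (2 * pi) =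
    2 * pi * hn h ^+ 2 + d ^+ 2 * \int[mu]_(t in circle) expR (2 * (c * v t)).
  have P0 : 2 * pi != 0 :> R by rewrite gt_eqF// pi2_gt0.
  rewrite /E; move: (\int[mu]_(t in circle) _) => I1.
  by move: (2 * pi) P0 => P P0; field.
apply: le_trans (_ : \int[mu]_(t in circle) (b t ^+ 2 + d ^+ 2 * expR (2 * (c * v t))) <= _).
  apply: (I_le mcircle fcircle).
  - exact: bexp.
  - by apply: bmD => //; exact: bmZ.
  - move=> t _; rewrite /w mulrDr expRD [expR (2 * v1 t)]expRM_natl e1 /b exprMn.
    rewrite -expRM_natl -mulrDl ler_wpM2r ?expR_ge0//.
    by apply: max_sq_le; exact: normc_ge0.
rewrite (ID mcircle fcircle b2 (bmZ _ be2)) (IZ mcircle fcircle)// lerD2r.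
exact: boundary_l2 hK hb.
Qed.

End preimage.

(** * Weak mixing along one orbit *)

Section mixing.
Context {R : realType}.
Implicit Types (t r e s : R) (z : R[i]) (f g h : hardy2 R).
Local Notation mu := (@lebesgue_measure R).
Local Notation tau := (@doubling R).
Local Notation circle := (`[0%R, (2 * pi)%R]%classic : set R).

Lemma birkhoff_sum (F : R -> R) n x : birkhoff F n x = \sum_(0 <= j < n) F (iter j tau x).
Proof.
elim: n x => [|n IH] x; first by rewrite big_nil.
by rewrite /= IH big_nat_recl//; congr (_ + _); apply: eq_bigr => j _; rewrite -iterSr.
Qed.

Lemma symbol_exp_bound (psi : nat -> R[i] -> R[i]) (F : nat -> R) (a b : R) n z :
  (forall j, normc (psi j z) <= expR (a + b * F j)) ->
  normc (symbol psi n z) <= expR (a * n%:R + b * \sum_(0 <= j < n) F j).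
Proof.
move=> h; elim: n => [|n IH].
  by rewrite /symbol !big_nil !mulr0 addr0 expR0 (normc_real 1) normr1.
rewrite /symbol big_nat_recr//= [in leRHS]big_nat_recr//= normcM.
have -> : a * n.+1%:R + b * (\sum_(0 <= i < n) F i + F n) =
  (a * n%:R + b * \sum_(0 <= i < n) F i) + (a + b * F n) by rewrite -natr1; ring.
by rewrite expRD ler_pM ?normc_ge0.
Qed.

Lemma symbol_bound (psi : nat -> R[i] -> R[i]) (M : R) n z :
  (forall j, normc (psi j z) <= M) -> normc (symbol psi n z) <= M ^+ n.
Proof.
move=> h; elim: n => [|n IH]; first by rewrite /symbol big_nil (normc_real 1) normr1.
by rewrite /symbol big_nat_recr//= normcM exprSr ler_pM ?normc_ge0.
Qed.

(** Since [X (j + 1) <= n], half of [a n] absorbs [b X] for large [j], and the other half is at most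
    [a j / 2]. *)
Lemma decay_arith (a b X n j : R) : a < 0 -> 0 <= j -> j <= X -> X * (j + 1) <= n ->
  `|b| <= - a / 2 * j -> a * n + b * X <= a / 2 * j.
Proof.
move=> a0 j0 jX Xn hb.
have h1 : b * X <= - a / 2 * n.
  apply: le_trans (_ : `|b| * X <= _); first by rewrite ler_wpM2r ?ler_norm//; lra.
  apply: le_trans (_ : - a / 2 * j * X <= _); first by rewrite ler_wpM2r//; lra.
  rewrite -mulrA ler_wpM2l//; first lra.
  by rewrite mulrDr mulr1 in Xn; rewrite mulrC; lra.
have h2 : j <= n.
  apply: le_trans Xn; rewrite mulrDr mulr1; have : 0 <= X * j by apply: mulr_ge0; lra.
  by lra.
have h3 : a / 2 * n <= a / 2 * j by rewrite ler_wnM2l//; lra.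
by lra.
Qed.

Lemma decay_arith' (a b X n j : R) : a <= 0 -> b < 0 -> 0 <= n -> j <= X ->
  a * n + b * X <= b * j.
Proof.
move=> a0 b0 n0 jX.
have : b * X <= b * j by rewrite ler_wnM2l// ltW.
by have := mulr_le0_ge0 a0 n0; lra.
Qed.

Section fixed_point.
Variables (psi : nat -> R[i] -> R[i]) (F : nat -> R) (M q sg : R) (v : R -> R).
Hypothesis dpsi : forall j z, normc z < 1 -> cderivable (psi j) z.
Hypothesis M0 : 0 <= M.
Hypothesis psiM : forall j z, normc z < 1 -> normc (psi j z) <= M.
Hypothesis bv : bm v.
Hypothesis q0 : 0 < q.
Hypothesis psi_boundary : forall j, {ae mu, forall t, circle t ->
  (fun k => normc (psi j ((dilation k)%:C * expi t))) @ \oo --> expR (F j / q * v t)}.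
Let D n := \sum_(0 <= j < n) F j.
Hypothesis sg1 : sg * sg = 1.
Hypothesis discrepant : forall N k : nat, exists n,
  N%:R <= sg * D n /\ sg * D n * k.+1%:R <= n%:R.
(** Times at which [D n] is large with sign [sg] and yet at most [n / (j + 1)] in size; both demands
    grow with [j]. *)
Let times (j : nat) : set nat :=
  [set n | j.+1%:R <= sg * D n /\ sg * D n * j.+1%:R <= n%:R].

Lemma times_decr i j : (i <= j)%N -> times j `<=` times i.
Proof.
move=> ij n [h1 h2]; split; first by apply: le_trans h1; rewrite ler_nat ltnS.
apply: le_trans h2; rewrite ler_wpM2l ?ler_nat ?ltnS//.
exact: le_trans h1.
Qed.

Lemma times_pos j n : times j n -> (1 <= n)%N.
Proof.
move=> [h1 h2]; rewrite -(ltr_nat R); apply: lt_le_trans h2.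
by apply: mulr_gt0 => //; exact: lt_le_trans h1.
Qed.

(** Two ways to decay: through [a n], since [D n = o(n)] along [times], or through [b D n], since
    [sg * D n] tends to infinity. *)
Lemma times_decay (a b e : R) : a <= 0 -> (a < 0 \/ sg * b < 0) -> 0 < e ->
  exists j, forall n, times j n -> expR (a * n%:R + b * D n) <= e.
Proof.
move=> a0 hab e0.
have bX n : b * D n = (sg * b) * (sg * D n) by rewrite mulrACA sg1 mul1r.
have [al|b0] := hab.
  have [j hj] := @exists_nat_ge R (Num.max (`|sg * b| / (- a / 2)) (ln e / (a / 2))).
  move: hj; rewrite ge_max ler_pdivrMr; last lra.
  rewrite ler_ndivrMr; last lra.
  move=> /andP[hj1 hj2]; exists j => n [h1 h2].
  rewrite -[leRHS]lnK ?posrE// ler_expR bX.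
  apply: le_trans (_ : a / 2 * j%:R <= _); last by rewrite [leLHS]mulrC.
  apply: decay_arith => //; last by rewrite [leRHS]mulrC.
    by apply: le_trans h1; rewrite ler_nat.
  by rewrite natr1.
have [j hj] := @exists_nat_ge R (ln e / (sg * b)).
move: hj; rewrite ler_ndivrMr// => hj; exists j => n [h1 h2].
rewrite -[leRHS]lnK ?posrE// ler_expR bX.
apply: le_trans (_ : sg * b * j%:R <= _); last by rewrite [leLHS]mulrC.
by apply: decay_arith' => //; apply: le_trans h1; rewrite -natr1 lerDl.
Qed.

Lemma symbol_boundary n : {ae mu, forall t, circle t ->
  (fun k => normc (symbol psi n ((dilation k)%:C * expi t))) @ \oo --> expR (D n / q * v t)}.
Proof.
elim: n => [|n IH].
  apply: aeW => t _; rewrite /D big_nil mul0r mul0r expR0.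
  under eq_fun do rewrite /symbol big_nil (normc_real 1) normr1.
  exact: cvg_cst.
apply: aeS2 IH (psi_boundary n) => t h1 h2 ti.
rewrite /D big_nat_recr//= 2!mulrDl expRD.
under eq_fun do rewrite /symbol big_nat_recr//= normcM.
by apply: cvgM; [exact: h1|exact: h2].
Qed.

Lemma preimage_small z e : normc z < 1 -> 0 < sg * rpois v z -> 0 < e ->
  exists j, forall n, times j n -> exists2 x, hn x <= e & adjoint_product psi n x = eval_kernel z.
Proof.
move=> z1 U0 e0; have [C C0 hC] := preimage_bound z1.
have e1 : 0 < e / (C + 1) by rewrite divr_gt0//; lra.
(* The exponent supplied by [preimage_bound] is [- (rpois v z / q) D n], and the sign of
   [sg * rpois v z] makes it tend to minus infinity along [times]. *)
have sb : sg * (- (rpois v z / q)) < 0 by rewrite mulrN oppr_lt0 mulrA divr_gt0.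
have [j hj] := @times_decay 0 (- (rpois v z / q)) _ (lexx _) (or_intror sb) e1.
exists j => n tn; have {hj} := hj n tn; rewrite mul0r add0r => hj.
have [] := @adjoint_product_preimage R psi M dpsi M0 psiM n z
   (C * expR (- (D n / q * rpois v z))) z1.
- by rewrite mulr_ge0// expR_ge0.
- move=> g pg; have [Mg gM] := finite_taylor_bounded pg.
  apply: (hC (D n / q) v g _ (M ^+ n * Mg) bv pg) => [w w1|].
    rewrite (mul_productE dpsi M0 psiM)// normcM ler_pM ?normc_ge0//; last exact: gM.
    by apply: symbol_bound => i; exact: psiM.
  apply: aeS (symbol_boundary n) => t h ti.
  under eq_fun do rewrite (mul_productE dpsi M0 psiM) ?radius_disk// normcM mulrC.
  apply: cvgM; last exact: h.
  by apply: radius_cvg_at; [rewrite normc_expi|exact: cderivable_finite_taylor].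
- move=> x xC Sx; exists x => //; apply: le_trans xC _.
  rewrite (_ : - (D n / q * rpois v z) = - (rpois v z / q) * D n); last by ring.
  apply: le_trans (_ : C * (e / (C + 1)) <= _); first exact: ler_wpM2l.
  by rewrite mulrCA ler_piMr// ?ler_pdivrMr; lra.
Qed.

Lemma adjoint_product_mixing (D1 D2 : set R[i]) z1 z2 (d1 d2 : R) :
  (forall z, D1 z -> normc z < 1 /\ exists a b, [/\ a <= 0, a < 0 \/ sg * b < 0 &
    forall j, normc (psi j z) <= expR (a + b * F j)]) ->
  normc z1 < 1 -> 0 < d1 -> (forall z, normc z < 1 -> normc (z - z1) < d1 -> D1 z) ->
  (forall z, D2 z -> normc z < 1 /\ 0 < sg * rpois v z) ->
  normc z2 < 1 -> 0 < d2 -> (forall z, normc z < 1 -> normc (z - z2) < d2 -> D2 z) ->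
  topologically_weakly_mixing (adjoint_product psi).
Proof.
move=> hD1 z11 d10 D1n hD2 z21 d20 D2n.
apply: (@weak_mixing_criterion R _ times D1 D2).
- by move=> n c f g; exact: (adjoint_product_linear dpsi M0 psiM).
- exact: times_decr.
- by move=> j; have [n hn] := discrepant j.+1 j; exists n.
- exact: times_pos.
- move=> z e /hD1[zz [a [b [a0 ab hpsi]]]] e0.
  have K0 := hn_ge0 (eval_kernel z).
  have e1 : 0 < e / (hn (eval_kernel z) + 1) by rewrite divr_gt0//; lra.
  have [j hj] := times_decay a0 ab e1; exists j => n /hj h.
  rewrite (adjoint_product_kernel dpsi M0 psiM)// hnZ normc_conj.
  apply: le_trans (_ : e / (hn (eval_kernel z) + 1) * hn (eval_kernel z) <= _).
    by rewrite ler_wpM2r//; apply: le_trans h; exact: symbol_exp_bound.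
  by rewrite mulrAC ler_pdivrMr ?ler_pM2l//; lra.
- by move=> z e /hD2[zz Uz] e0; exact: preimage_small.
- by move=> f e e0; apply: (@kernel_span_dense R D1 z1 d1) => // z /hD1[].
- by move=> f e e0; apply: (@kernel_span_dense R D2 z2 d2) => // z /hD2[].
Qed.

End fixed_point.

Lemma cocycle_adjoint_product (T : R -> hardy2 R -> hardy2 R) (Phi : R -> R[i] -> R[i]) w :
  (forall x, 0 <= x < 1 -> T x = adjoint (mul_op (Phi x))) -> 0 <= w < 1 ->
  (fun n => cocycle tau T n w) = adjoint_product (fun j => Phi (iter j tau w)).
Proof.
move=> hT w01; apply/funext; elim=> [|n IH] //=.
by rewrite IH hT//; exact: iter_doubling_itv.
Qed.

End mixing.

(** * Exponentials of Herglotz integrals are outer *)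

Section outer_functions.
Context {R : realType}.
Implicit Types (s t k : R) (z c : R[i]) (v : R -> R) (F : R[i] -> R[i]).
Local Notation mu := (@lebesgue_measure R).
Local Notation circle := (`[0%R, (2 * pi)%R]%classic : set R).

Lemma expi_inj s t : 0 <= s < 2 * pi -> 0 <= t < 2 * pi -> expi s = expi t -> s = t.
Proof.
wlog st : s t / s <= t.
  move=> W hs ht e; have [st|/ltW ts] := leP s t; first exact: W.
  by apply/esym; exact: W.
move=> /andP[s0 s1] /andP[t0 t1] e; apply/eqP; rewrite eq_le st/= leNgt; apply/negP => lt.
have P0 := @pi2_gt0 R.
have : expi (t - s) = 1 by rewrite expiD expiN -e -sqr_normcE normc_expi expr1n.
move=> /(congr1 (@complex.Re R)) /= c1.
have e2 : 2 * pi * ((t - s) / (2 * pi)) = t - s by rewrite [LHS]mulrC divfK// gt_eqF.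
have := @cos2pi_lt1 R ((t - s) / (2 * pi)); rewrite e2 c1 ltxx => h; suff : false by [].
by apply: h; rewrite divr_gt0 ?subr_gt0// ltr_pdivrMr// mul1r; lra.
Qed.

(** [outer] takes its density on the unit circle, whereas [v] is a function of the angle. *)
Definition circle_arg (u : R[i]) : R := get [set t | 0 <= t < 2 * pi /\ expi t = u].

Lemma circle_argK t : 0 <= t < 2 * pi -> circle_arg (expi t) = t.
Proof.
move=> ht; have : [set s | 0 <= s < 2 * pi /\ expi s = expi t] t by [].
by move=> /(getI (P := _))[h1 h2]; exact: expi_inj.
Qed.

Lemma bmC_herg_kernel z : normc z < 1 -> bmC (fun t => (expi t + z) / (expi t - z)).
Proof.
move=> z1; under eq_fun do rewrite herg_kernel//.
by apply: bmCB; [apply: bmCM; [exact: bmC_cst|exact: bmC_szego]|exact: bmC_cst].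
Qed.

Lemma outer_cexp v k c F : bm v -> normc c = 1 ->
  (forall z, normc z < 1 -> F z = c * cexp (k%:C * herg v z)) -> outer F.
Proof.
move=> bv c1 FE; split.
  move=> z /udiskE z1; apply: (cderivable_ext z1 FE).
  refine (@cderivableM R (fun=> c) (fun z => cexp (k%:C * herg v z)) z _ _).
    exact: cderivable_cst.
  apply: (@cderivable_comp R (fun z => k%:C * herg v z) cexp); last exact: cderivable_cexp.
  refine (@cderivableM R (fun=> k%:C) (herg v) z _ _); first exact: cderivable_cst.
  exact: cderivable_herg.
pose h (u : R[i]) := expR (k * v (circle_arg u)).
(* The density at [expi (2 pi) = expi 0] is read at angle 0, so [v] is corrected at the single point
   [2 pi]. *)
pose v' t := k * (v t + (v 0 - v (2 * pi)) * \1_[set (2 * pi)%R] t).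
have bv' : bm v'.
  by apply: bmZ; apply: bmD => //; apply: bmZ; apply: bm_indic; exact: measurable_set1.
have P0 := @pi2_gt0 R.
have hv' t : circle t -> ln (h (expi t)) = v' t.
  rewrite /= in_itv/= /h expRK /v' indicE => /andP[t0]; rewrite le_eqVlt => /orP[/eqP ->|t1].
    by rewrite mem_set// mulr1 expi2pi -expi0 circle_argK ?lexx// subrKC.
  rewrite memNset; last by move=> /= e; move: t1; rewrite e ltxx.
  by rewrite mulr0 addr0 circle_argK// t0.
exists c, h; split.
- by rewrite normr_normc c1.
- by move=> u _; exact: expR_gt0.
- have e : {in circle, EFin \o v' =1 EFin \o (fun t => ln (h (expi t)))}.
    by move=> t /set_mem ti; rewrite /= hv'.
  exact: (@eq_integrable _ _ R mu circle mcircle _ _ e (bm_integrable mcircle fcircle bv')).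
- move=> z /udiskE z1; rewrite FE//; congr (c * cexp _).
  have bK := bmC_herg_kernel z1.
  rewrite (@eq_cint R _ _ (fun t => (expi t + z) / (expi t - z) * (v' t)%:C)); last first.
    by move=> t ti; rewrite hv'.
  rewrite /herg mulrCA; congr (_ * _).
  rewrite -(cintZ mcircle fcircle); last by apply: bmCM => //; exact: bmC_real.
  apply: (cint_ae mcircle).
  + by apply: bmCM; [exact: bmC_cst|apply: bmCM => //; exact: bmC_real].
  + by apply: bmCM => //; exact: bmC_real.
  + apply: aeS (ae_neq (2 * pi)) => t tn _; rewrite /v' indicE memNset; last by move=> /= e; rewrite e eqxx in tn.
    by rewrite mulr0 addr0 rmorphM/= mulrCA.
Qed.

End outer_functions.

(** * Signs of the Poisson integral, and factorisation by an outer function *)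

Section dichotomy.
Context {R : realType}.
Implicit Types (s t k : R) (z w c : R[i]) (f phi : R[i] -> R[i]).
Local Notation mu := (@lebesgue_measure R).
Local Notation circle := (`[0%R, (2 * pi)%R]%classic : set R).

Lemma unimodular_or_strict f : (forall z, normc z < 1 -> cderivable f z) ->
  (forall z, normc z < 1 -> normc (f z) <= 1) ->
  (exists2 c, normc c = 1 & forall z, normc z < 1 -> f z = c) \/
  (forall z, normc z < 1 -> normc (f z) < 1).
Proof.
move=> df f1; have [[z z1 fz]|h] := pselect (exists2 z, normc z < 1 & normc (f z) = 1).
  by left; exists (f z) => //; exact: strict_max.
right=> z z1; rewrite lt_neqAle f1// andbT; apply/eqP => fz; apply: h; by exists z.
Qed.

Lemma lt1_exp (y : R) : y < 1 -> exists2 l, 0 < l & y <= expR (- l).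
Proof.
move=> y1; have m0 : 0 < Num.max y (2^-1) by rewrite lt_max invr_gt0 ltr0n orbT.
exists (- ln (Num.max y (2^-1))).
  by rewrite oppr_gt0 ln_lt0// m0 gt_max y1/=; lra.
by rewrite opprK lnK ?posrE// le_max lexx.
Qed.

Variable v : R -> R.
Hypothesis bv : bm v.
Local Notation U := (rpois v).

Lemma normc_cexp_herg s z : normc z < 1 -> normc (cexp (s%:C * herg v z)) = expR (s * U z).
Proof.
move=> z1; rewrite normc_cexp -Re_herg//; congr expR.
by case: (herg v z) => x y /=; rewrite mul0r subr0.
Qed.

Lemma cderivable_cexp_herg s z : normc z < 1 -> cderivable (fun w => cexp (s%:C * herg v w)) z.
Proof.
move=> z1; apply: (@cderivable_comp R (fun z => s%:C * herg v z) cexp); last exact: cderivable_cexp.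
refine (@cderivableM R (fun=> s%:C) (herg v) z _ _); first exact: cderivable_cst.
exact: cderivable_herg.
Qed.

(** Otherwise [cexp (s herg v)] is bounded by 1 and has modulus 1 at [z0]; the strict maximum
    principle makes it constant, so [U] vanishes everywhere. *)
Lemma rpois_sign s z0 : s != 0 -> normc z0 < 1 -> U z0 = 0 ->
  (exists2 z, normc z < 1 & U z != 0) -> exists2 z, normc z < 1 & 0 < s * U z.
Proof.
move=> s0 z01 Uz0 [z z1 Uz]; apply: contrapT => h.
have le0 w : normc w < 1 -> s * U w <= 0.
  by move=> w1; rewrite leNgt; apply/negP => h'; apply: h; exists w.
have := @strict_max R (fun w => cexp (s%:C * herg v w)) z0.
move=> /(_ (fun w => @cderivable_cexp_herg s w)) H.
have {}H : cexp (s%:C * herg v z) = cexp (s%:C * herg v z0).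
  apply: H => // [w w1|]; first by rewrite normc_cexp_herg// -expR0 ler_expR le0.
  by rewrite normc_cexp_herg// Uz0 mulr0 expR0.
have := congr1 (@normc R) H.
rewrite (normc_cexp_herg s z1) (normc_cexp_herg s z01) Uz0 mulr0 => /expR_inj/eqP.
by rewrite mulf_eq0 (negbTE s0) (negbTE Uz).
Qed.

Lemma rpois_near s z0 : s * s = 1 -> normc z0 < 1 -> 0 < s * U z0 -> exists2 d, 0 < d &
  forall z, normc z < 1 -> normc (z - z0) < d -> 0 < s * U z.
Proof.
move=> ss z01 U0; have [d d0 hd] := cderivable_cont_eps (cderivable_herg bv z01) U0.
exists d => // z z1 /hd h.
have n1 : `|s| = 1.
  by apply/eqP; rewrite -(@eqrXn2 _ 2)// expr1n real_normK ?num_real// expr2 ss.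
have : `|s * U z - s * U z0| < s * U z0.
  have e : U z - U z0 = complex.Re (herg v z - herg v z0) by rewrite cReD cReN !Re_herg.
  by rewrite -mulrBr normrM n1 mul1r e; exact: le_lt_trans (normc_Re _) h.
by rewrite ltr_norml => /andP[h1 _]; lra.
Qed.

Lemma boundary_convergence phi s :
  {ae mu, forall t, circle t -> normc (radial_lim phi t) = expR (s * v t)} ->
  {ae mu, forall t, circle t ->
    (fun k : nat => normc (phi ((dilation k)%:C * expi t))) @ \oo --> expR (s * v t)}.
Proof.
apply: aeS => t h ti; rewrite -(h ti); apply: radial_lim_cvg.
by rewrite -normc_gt0 h// expR_gt0.
Qed.

(* [f] is [phi] divided by the outer function with boundary modulus [exp (s v)]. *)
Lemma boundary_factor phi s (M : R) : (forall z, normc z < 1 -> cderivable phi z) ->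
  (forall z, normc z < 1 -> normc (phi z) <= M) ->
  {ae mu, forall t, circle t -> normc (radial_lim phi t) = expR (s * v t)} ->
  exists f, [/\ forall z, normc z < 1 -> cderivable f z,
    forall z, normc z < 1 -> normc (f z) <= 1 &
    forall z, normc z < 1 -> phi z = f z * cexp (s%:C * herg v z)].
Proof.
move=> dphi phiM /boundary_convergence hb.
have bsv : bm (fun t => s * v t) by exact: bmZ.
have Nrm z : normc z < 1 -> normc (phi z) <= expR (s * U z).
  move=> z1; rewrite -rpoisZ//; apply: (@boundary_majorant R phi _ M z) => //.
  by apply: aeS hb => t h ti; exists (expR (s * v t)); [exact: h|].
exists (fun z => phi z * cexp ((- s)%:C * herg v z)); split => z z1.
- by apply: cderivableM; [exact: dphi|exact: cderivable_cexp_herg].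
- by rewrite normcM normc_cexp_herg// mulNr expRN ler_pdivrMr ?expR_gt0// mul1r Nrm.
- by rewrite -mulrA -cexpD -mulrDl -rmorphD/= addNr mul0r cexp0 mulr1.
Qed.

End dichotomy.

(** * Choice of the sign of the discrepancy and of the two points *)

Section sign_choice.
Context {R : realType}.
Implicit Types (s t k : R) (z w c : R[i]).
Local Notation mu := (@lebesgue_measure R).
Local Notation circle := (`[0%R, (2 * pi)%R]%classic : set R).
Variables (phi1 phi2 : R[i] -> R[i]) (M p q : R) (v : R -> R).
Hypothesis p0 : 0 < p.
Hypothesis q0 : 0 < q.
Hypothesis pq1 : p + q = 1.
Hypothesis bv : bm v.
Hypothesis d1 : forall z, normc z < 1 -> cderivable phi1 z.
Hypothesis d2 : forall z, normc z < 1 -> cderivable phi2 z.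
Hypothesis M1 : forall z, normc z < 1 -> normc (phi1 z) <= M.
Hypothesis M2 : forall z, normc z < 1 -> normc (phi2 z) <= M.
Hypothesis b1 : {ae mu, forall t, circle t -> normc (radial_lim phi1 t) = expR (1 * v t)}.
Hypothesis b2 : {ae mu, forall t, circle t -> normc (radial_lim phi2 t) = expR (- (p / q) * v t)}.
Local Notation U := (rpois v).

(* [1 - p] and [0 - p] are the values on A1 and A2 of the function whose sums
   along the orbit are the visit discrepancies. *)
Definition decays (sg : R) z := exists a b, [/\ a <= 0, a < 0 \/ sg * b < 0,
  normc (phi1 z) <= expR (a + b * (1 - p)) & normc (phi2 z) <= expR (a + b * (0 - p))].

Lemma sign_choice :
  (exists2 z, normc z < 1 & U z != 0) ->
  (~ outer (fun z => phi1 z * phi2 z) \/ exists2 z, normc z < 1 &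
    normc (phi1 z) = 1 \/ normc (phi2 z) = 1) ->
  exists sg, [/\ sg = 1 \/ sg = -1,
    exists z0 d, [/\ normc z0 < 1, 0 < d &
      forall z, normc z < 1 -> normc (z - z0) < d -> decays sg z] &
    exists2 z, normc z < 1 & 0 < sg * U z].
Proof.
move=> Unz alt.
have [f1 [df1 f11 phi1E]] := boundary_factor bv d1 M1 b1.
have [f2 [df2 f21 phi2E]] := boundary_factor bv d2 M2 b2.
have q1 : 1 - p = q by rewrite -pq1 addrC addKr.
have n1 z : normc z < 1 -> normc (phi1 z) = normc (f1 z) * expR (U z).
  by move=> z1; rewrite phi1E// normcM normc_cexp_herg// mul1r.
have n2 z : normc z < 1 -> normc (phi2 z) = normc (f2 z) * expR (- (p / q) * U z).
  by move=> z1; rewrite phi2E// normcM normc_cexp_herg.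
have sgn z : U z != 0 -> exists2 sg : R, sg = 1 \/ sg = -1 & 0 < sg * U z.
  rewrite neq_lt => /orP[h|h]; [exists (-1)|exists 1]; rewrite ?mulN1r ?oppr_gt0 ?mul1r//.
    by right.
  by left.
have strict : (forall z, normc z < 1 -> exists a b, [/\ a < 0,
     normc (phi1 z) <= expR (a + b * (1 - p)) & normc (phi2 z) <= expR (a + b * (0 - p))]) ->
    exists sg, [/\ sg = 1 \/ sg = -1,
    exists z0 d, [/\ normc z0 < 1, 0 < d &
      forall z, normc z < 1 -> normc (z - z0) < d -> decays sg z] &
    exists2 z, normc z < 1 & 0 < sg * U z].
  (* With [a < 0] the symbols decay on the whole disk for either sign of [D_n], so [sg] is dictated
     by any point where [U] is nonzero. *)
  move=> h; have [z z1 /sgn[sg sg1 Uz]] := Unz.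
  exists sg; split => //; last by exists z.
  exists 0, 1; split; [by rewrite (normc_real 0) normr0| by [] |move=> w w1 _].
  by have [a [b [a0 h1 h2]]] := h w w1; exists a, b; split; [exact: ltW|left| |].
have key : q * (q^-1) = 1 by rewrite mulfV// gt_eqF.
have [[c1 nc1 f1c]|s1] := unimodular_or_strict df1 f11; last first.
  apply: strict => z z1; have [l l0 hl] := lt1_exp (s1 z z1).
  (* The solution of [a + b q = U z - l] and [a - b p = - (p/q) U z], using [p + q = 1]. *)
  exists (- l * p), (U z / q - l); split; first by rewrite mulNr oppr_lt0 mulr_gt0.
    rewrite n1//; have -> : - l * p + (U z / q - l) * (1 - p) = - l * (p + q) + U z * (q * q^-1).
      by rewrite q1; ring.
    by rewrite pq1 key !mulr1 expRD ler_wpM2r// expR_ge0.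
  rewrite n2//; have -> : - l * p + (U z / q - l) * (0 - p) = - (p / q) * U z by ring.
  by rewrite ler_piMl ?expR_ge0// f21.
have [[c2 nc2 f2c]|s2] := unimodular_or_strict df2 f21; last first.
  apply: strict => z z1; have [l l0 hl] := lt1_exp (s2 z z1).
  (* The loss [l] is now in the second equation: [a + b q = U z] and [a - b p = - (p/q) U z - l]. *)
  exists (- l * q), (U z / q + l); split; first by rewrite mulNr oppr_lt0 mulr_gt0.
    rewrite n1//; have -> : - l * q + (U z / q + l) * (1 - p) = U z * (q * q^-1).
      by rewrite q1; ring.
    by rewrite key mulr1 ler_piMl ?expR_ge0// f11.
  rewrite n2//; have -> : - l * q + (U z / q + l) * (0 - p) = - l * (p + q) + - (p / q) * U z.
    by ring.
  by rewrite pq1 mulr1 expRD ler_wpM2r// expR_ge0.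
(* Both [f1] and [f2] are unimodular constants, so [phi1 phi2] is [c1 c2] times
   [cexp ((1 - p/q) herg v)], an outer function. *)
have [] := alt.
  case; apply: (@outer_cexp R v (1 - p / q) (c1 * c2)) => //.
    by rewrite normcM nc1 nc2 mulr1.
  move=> z z1; rewrite phi1E// phi2E// f1c// f2c// mulrACA -cexpD -mulrDl -rmorphD/=.
  by [].
move=> [z0 z01 hz0].
have Uz0 : U z0 = 0.
  case: hz0; rewrite ?n1 ?n2// ?f1c ?f2c// ?nc1 ?nc2 mul1r -expR0 => /expR_inj//.
  move=> /eqP; rewrite mulf_eq0 oppr_eq0 mulf_eq0 invr_eq0 (gt_eqF p0) (gt_eqF q0)/= => /eqP//.
have [z z1 Uz] := @rpois_sign R v bv 1 z0 (oner_neq0 _) z01 Uz0 Unz.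
have n10 : -1 != 0 :> R by rewrite oppr_eq0 oner_eq0.
have [w w1 Uw] := @rpois_sign R v bv (-1) z0 n10 z01 Uz0 Unz.
(* Two different points are used: with [a = 0] and [b = U / q] the symbols decay near [w], where
   [U < 0], while small preimages are found near [z], where [U > 0]. *)
exists 1; split; [by left| |by exists z].
have n11 : -1 * -1 = 1 :> R by rewrite mulrNN mulr1.
have [d d0 hd] := @rpois_near R v bv (-1) w n11 w1 Uw.
exists w, d; split => // y y1 /(hd _ y1) Uy; exists 0, (U y / q); split.
- by [].
- by right; rewrite mul1r pmulr_llt0 ?invr_gt0//; rewrite mulN1r oppr_gt0 in Uy.
- rewrite n1// f1c// nc1 mul1r add0r q1 mulrAC -mulrA key mulr1.
  by [].
- by rewrite n2// f2c// nc2 mul1r add0r; rewrite (_ : - (p / q) * U y = U y / q * (0 - p))//; ring.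
Qed.

End sign_choice.

(** * Nontriviality of the Poisson integral, and the theorem *)

Section assembly.
Context {R : realType}.
Implicit Types (t : R) (z : R[i]).
Local Notation mu := (@lebesgue_measure R).
Local Notation circle := (`[0%R, (2 * pi)%R]%classic : set R).

Lemma circle_ae (P : R -> Prop) : {ae mu, forall t, circle t -> P t} -> ae_circle P.
Proof.
apply: aeS => t h; rewrite in_itv/= => /andP[t0 t1]; apply: h.
by rewrite /= in_itv/= t0 ltW.
Qed.

(** If [U = 0], both functions are bounded by 1. Touching the circle then makes one of them
    constant; otherwise both boundary moduli are at most 1 with exponents of opposite sign, so
    [v = 0] and both functions are inner. *)
Lemma rpois_neq0 (phi1 phi2 : R[i] -> R[i]) (p q : R) (v : R -> R) :
  0 < p -> 0 < q -> bm v -> Hinfty phi1 -> Hinfty phi2 ->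
  ~ constant_on_disk phi1 -> ~ constant_on_disk phi2 ->
  {ae mu, forall t, circle t -> normc (radial_lim phi1 t) = expR (1 * v t)} ->
  {ae mu, forall t, circle t -> normc (radial_lim phi2 t) = expR (- (p / q) * v t)} ->
  (exists2 z, normc z < 1 & normc (phi1 z) = 1 \/ normc (phi2 z) = 1) \/
    (~ inner phi1 \/ ~ inner phi2) ->
  exists2 z, normc z < 1 & rpois v z != 0.
Proof.
move=> p0 q0 bv H1 H2 nc1 nc2 b1 b2 alt; apply: contrapT => h.
have U0 z : normc z < 1 -> rpois v z = 0.
  by move=> z1; apply/eqP/negPn/negP => Uz; apply: h; exists z.
have [d1 [M1 _ hM1]] := HinftyP H1; have [d2 [M2 _ hM2]] := HinftyP H2.
have le1 phi s (M : R) : (forall z, normc z < 1 -> cderivable phi z) ->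
    (forall z, normc z < 1 -> normc (phi z) <= M) ->
    {ae mu, forall t, circle t -> normc (radial_lim phi t) = expR (s * v t)} ->
    forall z, normc z < 1 -> normc (phi z) <= 1.
  move=> d hM hb z z1; have [f [_ f1 fE]] := boundary_factor bv d hM hb.
  by rewrite fE// normcM normc_cexp_herg// U0// mulr0 expR0 mulr1 f1.
have l1 := le1 _ _ _ d1 hM1 b1; have l2 := le1 _ _ _ d2 hM2 b2.
have [[z z1 hz]|ninner] := alt.
  case: hz => hz.
    by apply: nc1; exists (phi1 z) => w /udiskE; exact: strict_max.
  by apply: nc2; exists (phi2 z) => w /udiskE; exact: strict_max.
have ne0 phi s t : normc (radial_lim phi t) = expR (s * v t) -> radial_lim phi t != 0.
  by move=> e; rewrite -normc_gt0 e expR_gt0.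
have v0 : {ae mu, forall t, circle t -> v t = 0}.
  apply: aeS2 b1 b2 => t h1 h2 ti; have {}h1 := h1 ti; have {}h2 := h2 ti.
  have e (x : R) : expR x <= 1 -> x <= 0 by rewrite -expR0 ler_expR.
  have := radial_lim_le l1 (ne0 _ _ _ h1); have := radial_lim_le l2 (ne0 _ _ _ h2).
  rewrite h1 h2 => /e + /e; rewrite mul1r mulNr oppr_le0 pmulr_rge0 ?divr_gt0// => a b.
  by apply/eqP; rewrite eq_le a b.
have inn phi s : Hinfty phi ->
    {ae mu, forall t, circle t -> normc (radial_lim phi t) = expR (s * v t)} -> inner phi.
  move=> H hb; split=> //; apply: circle_ae; apply: aeS2 hb v0 => t h1 h2 ti.
  by rewrite h1// h2// mulr0 expR0.
by case: ninner; apply; apply: inn; [exact: H1|exact: b1|exact: H2|exact: b2].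
Qed.

End assembly.

Theorem theorem1p6 (R : realType) (A1 A2 : set R) (phi1 phi2 : R[i] -> R[i])
    (T : R -> hardy2 R -> hardy2 R) :
  is_interval A1 -> is_interval A2 ->
  A1 `&` A2 = set0 -> A1 `|` A2 = [set` `[0, 1[] ->
  let m (A : set R) := fine (lebesgue_measure A) in
  0 < m A1 -> 0 < m A2 ->
  Hinfty phi1 -> Hinfty phi2 ->
  ~ constant_on_disk phi1 -> ~ constant_on_disk phi2 ->
  (forall w, A1 w -> T w = adjoint (mul_op phi1)) ->
  (forall w, A2 w -> T w = adjoint (mul_op phi2)) ->
  let unimodular := ae_circle (fun t : R =>
    normc (radial_lim phi1 t) `^ m A1 * normc (radial_lim phi2 t) `^ m A2 = 1) in
  (unimodular /\
    ((exists2 z, udisk z & `|phi1 z| = 1) \/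
     (exists2 z, udisk z & `|phi2 z| = 1)))
  \/
  (unimodular /\ ~ outer (fun z => phi1 z * phi2 z) /\
    (~ inner phi1 \/ ~ inner phi2)) ->
  {ae lebesgue_measure, forall w : R, w \in `[0, 1[ ->
    topologically_weakly_mixing (fun n => cocycle doubling T n w)}.
Proof.
move=> iA1 iA2 A12 A12T m mA1 mA2 H1 H2 nc1 nc2 T1 T2 unimodular hyp.
have uni : unimodular by case: hyp => -[].
set p := m A1 in mA1 *; set q := m A2 in mA2 *.
have measA1 : measurable A1 by exact: is_interval_measurable.
have measA2 : measurable A2 by exact: is_interval_measurable.
have sub1 : A1 `<=` `[0, 1[ by rewrite -A12T; exact: subsetUl.
have sub2 : A2 `<=` `[0, 1[ by rewrite -A12T; exact: subsetUr.
have oc : `[0, 1[%classic `<=` `[0 : R, 1]%classic by exact: subset_itv_co_cc.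
have fin (A : set R) : measurable A -> A `<=` `[0, 1[ -> lebesgue_measure A \is a fin_num.
  move=> mA sA; rewrite ge0_fin_numE//; apply: le_lt_trans (fin_itv 0 1).
  by apply: le_measure; rewrite ?inE//; exact: subset_trans sA oc.
have pq1 : p + q = 1.
  have e : lebesgue_measure (A1 `|` A2) = (lebesgue_measure A1 + lebesgue_measure A2)%E.
    exact: measureU.
  rewrite /p /q /m -fineD ?fin// -e A12T lebesgue_measure_itv/= lte_fin ltr01.
  by rewrite oppr0 adde0.
have [d1 [N1 N10 hN1]] := HinftyP H1; have [d2 [N2 N20 hN2]] := HinftyP H2.
pose M := Num.max N1 N2.
have M1 z : normc z < 1 -> normc (phi1 z) <= M by move=> z1; rewrite le_max hN1.
have M2 z : normc z < 1 -> normc (phi2 z) <= M by move=> z1; rewrite le_max hN2// orbT.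
have M0 : 0 <= M by rewrite le_max N10.
have [v bv vb] := boundary_log mA1 mA2 d1 M1 M2 uni.
have b1 : {ae lebesgue_measure, forall t : R, `[0%R, (2 * pi)%R]%classic t ->
    normc (radial_lim phi1 t) = expR (1 * v t)}.
  by apply: aeS vb => t h /h[-> _]; rewrite mul1r.
have b2 : {ae lebesgue_measure, forall t : R, `[0%R, (2 * pi)%R]%classic t ->
    normc (radial_lim phi2 t) = expR (- (p / q) * v t)}.
  by apply: aeS vb => t h /h[_].
have norm1 phi : (exists2 z, udisk z & `|phi z| = 1) ->
    exists2 z : R[i], normc z < 1 & normc (phi z : R[i]) = 1.
  by move=> [z /udiskE z1]; rewrite normr_normc => /complexI e; exists z.
have touch : unimodular /\ ((exists2 z, udisk z & `|phi1 z| = 1) \/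
      (exists2 z, udisk z & `|phi2 z| = 1)) ->
    exists2 z, normc z < 1 & normc (phi1 z) = 1 \/ normc (phi2 z) = 1.
  by move=> [_ [/norm1[z z1 e]|/norm1[z z1 e]]]; exists z => //; [left|right].
have Unz : exists2 z, normc z < 1 & rpois v z != 0.
  apply: (rpois_neq0 mA1 mA2 bv H1 H2 nc1 nc2 b1 b2).
  by case: hyp => [/touch|[_ [_]]]; [left|right].
have [] := @sign_choice R phi1 phi2 M p q v mA1 mA2 pq1 bv d1 d2 M1 M2 b1 b2 Unz.
  by case: hyp => [/touch|[_ []]]; [right|left].
move=> sg [sgE [z1 [e1 [z11 e10 hz1]]] [z2 z21 Uz2]].
have sg1 : sg * sg = 1 by case: sgE => ->; rewrite ?mulrNN mulr1.
have [e2 e20 hz2] := rpois_near bv sg1 z21 Uz2.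
pose F (x : R) : R := \1_A1 x - p.
have p01 : 0 < p < 1 by rewrite mA1/= -pq1 ltrDl.
have q01 : 0 < q < 1 by rewrite mA2/= -pq1 ltrDr.
have D1 := discrepancy measA1 (subset_trans sub1 oc) (erefl p) p01.
(* The discrepancy of [A2] is minus that of [A1], so this gives the times at which [D_n] tends to
   minus infinity. *)
have D2 := discrepancy measA2 (subset_trans sub2 oc) (erefl q) q01.
have FE x : 0 <= x < 1 -> \1_A2 x - q = - F x.
  move=> x01; have : (A1 `|` A2) x by rewrite A12T /= in_itv.
  rewrite /F !indicE => -[Ax|Ax].
    have nA : ~ A2 x by move=> A2x; suff : set0 x by []; rewrite -A12.
    by rewrite (mem_set Ax) (memNset nA) /= -pq1; ring.
  have nA : ~ A1 x by move=> A1x; suff : set0 x by []; rewrite -A12.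
  by rewrite (mem_set Ax) (memNset nA) /= -pq1; ring.
apply: aeS2 D1 D2 => w h1 h2; rewrite in_itv/= => w01.
pose Phi (x : R) := if x \in A1 then phi1 else phi2.
have TPhi x : 0 <= x < 1 -> T x = adjoint (mul_op (Phi x)).
  move=> x01; rewrite /Phi; case: ifPn => [/set_mem|]; first exact: T1.
  rewrite notin_setE => nA1; apply: T2; have : (A1 `|` A2) x by rewrite A12T /= in_itv.
  by case.
rewrite (cocycle_adjoint_product TPhi w01).
pose psi j := Phi (iter j doubling w).
pose G j := F (iter j doubling w).
have dpsi j z : normc z < 1 -> cderivable (psi j) z.
  by move=> zz; rewrite /psi /Phi; case: ifP => _; [exact: d1|exact: d2].
have psiM j z : normc z < 1 -> normc (psi j z) <= M.
  by move=> zz; rewrite /psi /Phi; case: ifP => _; [exact: M1|exact: M2].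
(* [G j / q] is 1 on [A1] and [- (p / q)] on [A2], the exponents of the two boundary moduli. *)
have psib j : {ae lebesgue_measure, forall t : R, `[0%R, (2 * pi)%R]%classic t ->
    (fun k : nat => normc (psi j ((dilation k)%:C * expi t))) @ \oo --> expR (G j / q * v t)}.
  rewrite /psi /Phi /G /F indicE; case: (_ \in A1).
    rewrite (_ : (1 - p) / q = 1); first exact: boundary_convergence.
    by rewrite -pq1 addrC addKr mulfV// gt_eqF.
  by rewrite sub0r mulNr; exact: boundary_convergence.
have disc N k : exists n, N%:R <= sg * \sum_(0 <= j < n) G j /\
    sg * (\sum_(0 <= j < n) G j) * k.+1%:R <= n%:R.
  case: sgE => ->.
    have [n [hn1 hn2]] := h1 w01 N k; exists n.
    have -> : \sum_(0 <= j < n) G j = birkhoff F n w by rewrite birkhoff_sum.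
    by rewrite mul1r; exact: (conj hn1 hn2).
  have [n [hn1 hn2]] := h2 w01 N k; exists n.
  have -> : -1 * \sum_(0 <= j < n) G j = birkhoff (fun y => \1_A2 y - q) n w; last exact: (conj hn1 hn2).
  rewrite birkhoff_sum mulN1r -sumrN; apply: eq_bigr => j _.
  by rewrite FE//; exact: iter_doubling_itv.
apply: (adjoint_product_mixing dpsi M0 psiM bv mA2 psib sg1 disc
  (D1 := [set z | normc z < 1 /\ decays phi1 phi2 p sg z])
  (D2 := [set z | normc z < 1 /\ 0 < sg * rpois v z]) _ z11 e10 _ _ z21 e20 _).
- move=> z [zz [a [b [a0 ab h3 h4]]]]; split=> //; exists a, b; split=> // j.
  by rewrite /psi /Phi /G /F indicE; case: (_ \in A1).
- by move=> z zz dz; split=> //; exact: hz1.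
- by move=> z [].
- by move=> z zz dz; split=> //; exact: hz2.
Qed.
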